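(* Let $a,b\in\mathbb{R}\setminus\{0\}$ and $$A=\begin{pmatrix}0&a\lambda^{-1}+b\\ a\lambda+b&0\end{pmatrix}.$$ Then the $r$-Iwasawa factorization $\exp((x+iy)A)=F\,B$ for any $r\in(0,1]$ is given by $$F=\Phi\,\exp(-\mathbf{f}A)\,B_1^{-1},\qquad B=B_1\exp(\mathbf{f}A),\qquad\text{with }\ \Phi=\exp((x+iy)A),$$ where the nonconstant Jacobian elliptic function $v=v(x)$, the elliptic integral $\mathbf{f}=\mathbf{f}(x)$ and the matrices $B_0,B_1$ satisfy $${v'}^2=-(v^2-4a^2)(v^2-4b^2),\qquad v(0)=2b,\qquad B_1=(\det B_0)^{-1/2}B_0,$$ $$B_0=\begin{pmatrix}2v(b+a\lambda)&-v'\\0&4ab\lambda+v^2\end{pmatrix},\qquad \mathbf{f}=\int_0^x\frac{2\,dt}{1+(4ab\lambda)^{-1}v^2(t)} .$$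
   Context: For $0<r\le1$ let $C_r=\{|\lambda|=r\}$, $I_r=\{|\lambda|<r\}$, $\bar A_r=\{r\le|\lambda|\le1/r\}$, and let $\Lambda_r\mathrm{SL}_2(\mathbb{C})=C^\infty(C_r,\mathrm{SL}_2(\mathbb{C}))$. With $F^*(\lambda)=\overline{F(1/\bar\lambda)}^{\,t}$, $\Lambda_r^{\mathbb{R}}\mathrm{SL}_2(\mathbb{C})$ is the group of loops in $\Lambda_r\mathrm{SL}_2(\mathbb{C})$ extending analytically to $F:\bar A_r\to\mathrm{SL}_2(\mathbb{C})$ with $F^*=F^{-1}$. $\Lambda_r^+\mathrm{SL}_2(\mathbb{C})$ is the group of loops $B\in\Lambda_r\mathrm{SL}_2(\mathbb{C})$ extending analytically to $I_r\to\mathrm{SL}_2(\mathbb{C})$ with $B(0)$ upper triangular with positive real diagonal entries. The $r$-Iwasawa factorization of $\Phi\in\Lambda_r\mathrm{SL}_2(\mathbb{C})$ is the unique splitting $\Phi=FB$ with $F\in\Lambda_r^{\mathbb{R}}\mathrm{SL}_2(\mathbb{C})$ and $B\in\Lambda_r^+\mathrm{SL}_2(\mathbb{C})$; here it is taken pointwise in $x+iy\in\mathbb{C}$, with $x,y$ real. A prime denotes $d/dx$.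
   Formalization: The formulas for F and B are asserted at those λ on C_r where 4abλ+v(t)² does not vanish for t between 0 and x (elsewhere the integral f is undefined); ''nonconstant'' is required of v only if a²≠b², since for a²=b² only v=2b exists; the root of det B_0 is the continuous branch with B_1=Id at x=0. *)

(* Defs.v *)
From Stdlib Require Import Reals Factorial List.
From Coquelicot Require Import Coquelicot.

Local Open Scope R_scope.

Definition M2 : Type := @matrix C 2 2.

Definition mat2 (p q u w : C) : M2 := [ [ p , q ] , [ u , w ] ].

Definition entry (M : M2) (i j : nat) : C := coeff_mat (RtoC 0) M i j.

Definition mscal (c : C) (M : M2) : M2 :=
  mk_matrix 2 2 (fun i j => (c * entry M i j)%C).

Definition mmul (M N : M2) : M2 := Mmult (T := C_Ring) M N.

Definition mdet (M : M2) : C :=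
  (entry M 0 0 * entry M 1 1 - entry M 0 1 * entry M 1 0)%C.

Definition minv (M : M2) : M2 :=
  mscal (/ mdet M)%C
    (mat2 (entry M 1 1) (- entry M 0 1)%C (- entry M 1 0)%C (entry M 0 0)).

Definition mconjT (M : M2) : M2 :=
  mk_matrix 2 2 (fun i j => Cconj (entry M j i)).

(** [exp M = sum_n M^n / n!], summed entry by entry, with real and imaginary
    parts separated because [Series] is real-valued. *)
Definition mexp (M : M2) : M2 :=
  let P (n : nat) : M2 := pow_n (K := matrix_Ring (T := C_Ring) (n := 2)) M n in
  mk_matrix 2 2 (fun i j =>
    (Series (fun n => Re (entry (P n) i j) / INR (fact n))%R,
     Series (fun n => Im (entry (P n) i j) / INR (fact n))%R) : C).

(** A loop on [|z| = r] is represented by a function [C -> M2] of which only the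
    values on that circle matter. *)

Definition on_circle (r : R) (z : C) : Prop := Cmod z = r.

Definition in_disk (r : R) (z : C) : Prop := Cmod z < r.

Definition in_closed_disk (r : R) (z : C) : Prop := Cmod z <= r.

Definition in_annulus (r : R) (z : C) : Prop := r < Cmod z < / r.

Definition in_closed_annulus (r : R) (z : C) : Prop := r <= Cmod z <= / r.

Definition circle_pt (r t : R) : C := (r * cos t, r * sin t)%R.

Definition smooth (f : R -> R) : Prop := forall n t, ex_derive_n f n t.

Definition loop (r : R) (F : C -> M2) : Prop :=
  (forall z, on_circle r z -> mdet (F z) = RtoC 1) /\
  (forall i j, (i < 2)%nat -> (j < 2)%nat ->
     smooth (fun t => Re (entry (F (circle_pt r t)) i j)) /\
     smooth (fun t => Im (entry (F (circle_pt r t)) i j))).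

(** "Extends analytically to [D]" means continuous on the closed region [D] and
    holomorphic on its interior [U]. *)
Definition analytic_SL2 (U D : C -> Prop) (G : C -> M2) : Prop :=
  (forall z, D z -> mdet (G z) = RtoC 1) /\
  (forall i j, (i < 2)%nat -> (j < 2)%nat ->
     continuous_on (T := C_UniformSpace) (U := C_UniformSpace) D
       (fun z => entry (G z) i j) /\
     (forall z, U z ->
        ex_derive (K := C_AbsRing) (V := C_NormedModule)
          (fun z => entry (G z) i j) z)).

Definition mstar (F : C -> M2) (z : C) : M2 := mconjT (F (/ Cconj z)%C).

(** For [r = 1] the annulus degenerates to the unit circle, its interior is
    empty, and the condition says that [F] is unitary on the unit circle. *)
Definition loop_real (r : R) (F : C -> M2) : Prop :=
  loop r F /\
  exists G : C -> M2,
    (forall z, on_circle r z -> G z = F z) /\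
    analytic_SL2 (in_annulus r) (in_closed_annulus r) G /\
    (forall z, in_closed_annulus r z -> mstar G z = minv (G z)).

Definition pos_real (z : C) : Prop := Im z = 0 /\ 0 < Re z.

Definition loop_plus (r : R) (B : C -> M2) : Prop :=
  loop r B /\
  exists G : C -> M2,
    (forall z, on_circle r z -> G z = B z) /\
    analytic_SL2 (in_disk r) (in_closed_disk r) G /\
    entry (G (RtoC 0)) 1 0 = RtoC 0 /\
    pos_real (entry (G (RtoC 0)) 0 0) /\
    pos_real (entry (G (RtoC 0)) 1 1).

Definition iwasawa_splitting (r : R) (Phi F B : C -> M2) : Prop :=
  loop_real r F /\ loop_plus r B /\
  (forall z, on_circle r z -> Phi z = mmul (F z) (B z)).

(** Loops are compared on [|z| = r] only, where they are defined. *)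
Definition is_iwasawa (r : R) (Phi F B : C -> M2) : Prop :=
  iwasawa_splitting r Phi F B /\
  (forall F' B' : C -> M2, iwasawa_splitting r Phi F' B' ->
     forall z, on_circle r z -> F' z = F z /\ B' z = B z).

(** [sn, cn, dn] with real parameter [m = k^2] (possibly negative). *)
Definition jacobi_triple (m : R) (sn cn dn : R -> R) : Prop :=
  sn 0 = 0 /\ cn 0 = 1 /\ dn 0 = 1 /\
  (forall u, is_derive sn u (cn u * dn u)) /\
  (forall u, is_derive cn u (- (sn u * dn u))) /\
  (forall u, is_derive dn u (- (m * sn u * cn u))).

(** In Glaisher's notation the Jacobian functions are the quotients [pq = p/q]
    with [p], [q] among [sn, cn, dn, 1]; amplitude, frequency and phase are free.
    Constants ([p = q]) are included. *)
Definition jacobian_elliptic (v : R -> R) : Prop :=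
  exists (m : R) (sn cn dn p q : R -> R) (c k u0 : R),
    jacobi_triple m sn cn dn /\
    In p (sn :: cn :: dn :: (fun _ => 1) :: nil) /\
    In q (sn :: cn :: dn :: (fun _ => 1) :: nil) /\
    (forall x, q (k * x + u0) <> 0) /\
    (forall x, v x = c * (p (k * x + u0) / q (k * x + u0))).

Definition nonconstant (v : R -> R) : Prop := exists x1 x2, v x1 <> v x2.

(** When [a^2 = b^2] the differential equation forces [v'^2 <= 0], so [v] is
    necessarily the constant [2b] (the degenerate Jacobian function, [m = 0]);
    non-constancy is therefore only demanded when [a^2 <> b^2]. *)
Definition profile (a b : R) (v : R -> R) : Prop :=
  jacobian_elliptic v /\
  (a ^ 2 <> b ^ 2 -> nonconstant v) /\
  (forall x, Derive v x ^ 2 = - ((v x ^ 2 - 4 * a ^ 2) * (v x ^ 2 - 4 * b ^ 2))) /\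
  v 0 = 2 * b.

Section Factors.
Local Open Scope C_scope.

Definition A_mat (a b : R) (z : C) : M2 :=
  mat2 (RtoC 0) (a * / z + b) (a * z + b) (RtoC 0).

Definition Phi_mat (a b x y : R) (z : C) : M2 :=
  mexp (mscal ((x, y) : C) (A_mat a b z)).

Definition B0_mat (a b : R) (v : R -> R) (x : R) (z : C) : M2 :=
  mat2 (2 * v x * (b + a * z)) (- Derive v x)
       (RtoC 0) (4 * a * b * z + v x ^ 2).

Definition f_int (a b : R) (v : R -> R) (x : R) (z : C) : C :=
  RInt (V := C_R_CompleteNormedModule)
    (fun t : R => 2 / (1 + / (4 * a * b * z) * v t ^ 2)) 0 x.

Definition between (x t : R) : Prop := (Rmin 0 x <= t <= Rmax 0 x)%R.

(** The points where the integrand of [f_int] has no pole on the integration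
    path. As [v 0 = 2b], taking [t = 0] gives [b + a z <> 0], so [B0_mat] is then
    invertible along the path. On a circle [|z| = r > 0] at most one point, on
    the real axis, is excluded; there the factors are given by continuity. *)
Definition regular_pt (a b : R) (v : R -> R) (x : R) (z : C) : Prop :=
  forall t : R, between x t -> 4 * a * b * z + v t ^ 2 <> RtoC 0.

(** The branch of [(det B_0)^(1/2)] at fixed [z]: continuous in the real variable
    from [0] to [x], with value [4b(b + a z)] at [0], where
    [B_0 = 4b(b + a z) Id]; i.e. [B_1 = Id] at [0]. *)
Definition sqrt_det_branch
    (a b : R) (v : R -> R) (x : R) (z : C) (s : R -> C) : Prop :=
  continuous_on (T := R_UniformSpace) (U := C_UniformSpace) (between x) s /\
  (forall t, between x t -> s t * s t = mdet (B0_mat a b v t z)) /\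
  s 0%R = 4 * b * (b + a * z).

Definition B1_mat (a b : R) (v : R -> R) (s : R -> C) (x : R) (z : C) : M2 :=
  mscal (/ s x) (B0_mat a b v x z).

Definition B_formula (a b : R) (v : R -> R) (s : R -> C) (x : R) (z : C) : M2 :=
  mmul (B1_mat a b v s x z) (mexp (mscal (f_int a b v x z) (A_mat a b z))).

Definition F_formula (a b : R) (v : R -> R) (s : R -> C) (x y : R) (z : C) : M2 :=
  mmul (mmul (Phi_mat a b x y z)
             (mexp (mscal (- f_int a b v x z) (A_mat a b z))))
       (minv (B1_mat a b v s x z)).

End Factors.

(* Main.v *)
Require Import Defs.
From Stdlib Require Import Reals Lra Lia Factorial List ClassicalEpsilon.
From Coquelicot Require Import Coquelicot.

(** Conjugation of [A] by the plus factor [B] of the formula is conjugation by [B_0], because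
    [exp (f A)] commutes with [A]; by the differential equation of [v] it gives the Laurent
    polynomial [V = 1 / (2 v) * [[-v', v^2 + 4 a b / z], [v^2 + 4 a b z, v']]].  Write
    [V = Omega + W] where [Omega^* = - Omega] and [W] is a polynomial in [z] whose value at [0] is
    upper triangular with real diagonal.  Since [exp ((x + i y) A) = F B] has the logarithmic
    derivative [A] in [x], the factors have to solve [B' = W B] and [F' = F Omega], with [B = 1] at
    [x = 0].

    As functions of [z], the explicit formulas have poles and branch points, so the factors are not
    defined by them.  Instead [plus_factor] is the solution of [B' = W B].  The gauge transformation
    [diag (1 / d, d)] with [d = sqrt (v / (2 b))] makes the system antidiagonal, with entries
    [alpha x] and [z * beta x]; its solution is a power series in [z] whose coefficients are
    iterated integrals, and their factorial decay makes it entire in [z].  The other factor,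
    [real_factor], is [exp ((x + i y) A) B^-1], holomorphic for [z <> 0].  The Lax equation
    [V' = W V - V W], where the second-order equation of [v] enters, gives [B A B^-1 = V]
    ([conj_A_plus_factor]); therefore [F' = F Omega], and [F F^* = 1] because its derivative in [x]
    vanishes ([real_factor_real]).

    For the formulas, fix [z].  The matrix [Z = B^-1 B_0 exp (f A)] satisfies [Z' = sg Z] where
    [2 sg] is the logarithmic derivative of [det B_0].  It is scalar at [x = 0], hence always, and
    its diagonal entry is the branch of [sqrt (det B_0)] that is asked for ([explicit_factor]).

    Uniqueness ([iwasawa_unique]) is a reflection argument.  For two splittings, [X = F^-1 F'] is
    analytic in the annulus, satisfies [X^* = X^-1], and agrees on [|z| = r] with [Y = B B'^-1],
    analytic in the disk.  The squared modulus of an entry of [X], minus a constant, is then a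
    product of two entries taken at [z] and at [z / r^2], which continues analytically to the disk;
    with the right constant it vanishes at the centre, so its mean over [|z| = r] is zero
    ([reflection_vanish]).  All that is used is that the mean of an analytic function over a circle
    does not depend on the radius, which is Goursat's argument on a rectangle in logarithmic polar
    coordinates ([goursat_green], [circle_integral_annulus]). *)

(** * Derivatives of complex functions along a real and along a complex variable *)

Local Open Scope C_scope.

Lemma Ceq (z w : C) : Re z = Re w -> Im z = Im w -> z = w.
Proof. destruct z, w; simpl; congruence. Qed.

(** Stated on components because the mean value theorem needs real values. *)
Definition cderiv (f : R -> C) (t : R) (l : C) : Prop :=
  is_derive (fun u => Re (f u)) t (Re l) /\ is_derive (fun u => Im (f u)) t (Im l).

(** [C] carries two structures of normed module over itself, with different uniform structures.
    The product and chain rules are stated for this one; [holo_is_derive] transfers them to the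
    other. *)
Definition holo (f : C -> C) (z l : C) : Prop :=
  is_derive (K := C_AbsRing) (V := AbsRing_NormedModule C_AbsRing) f z l.

Lemma holo_is_derive (f : C -> C) (z l : C) :
  holo f z l <-> is_derive (K := C_AbsRing) (V := C_NormedModule) f z l.
Proof. split; intros [[H1 H2 H3] H4]; (split; [split|]); assumption. Qed.

Lemma holo_eps (f : C -> C) (z l : C) :
  holo f z l <->
  forall eps : posreal,
    locally (T := C_UniformSpace) z (fun w => (Cmod (f w - f z - l * (w - z)) <= eps * Cmod
      (w - z))%R).
Proof.
split.
- intros [_ H] eps.
  apply locally_C.
  apply (filter_imp (fun w : C => norm (minus (minus (f w) (f z))
    (scal (K:=C_AbsRing) (V:=AbsRing_NormedModule C_AbsRing) (minus w z) l)) <= eps * norm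
    (K:=C_AbsRing) (V:=AbsRing_NormedModule C_AbsRing) (minus w z))%R
    (fun w => (Cmod (f w - f z - l * (w - z)) <= eps * Cmod (w - z))%R)).
  + intros w Hw. refine (Rle_trans _ _ _ _ Hw). right.
    unfold norm; simpl. unfold abs; simpl. f_equal.
    unfold minus, plus, opp, scal, mult; simpl. unfold mult; simpl. ring.
  + apply (H z); auto. intros P HP; exact HP.
- intros H. split; [apply is_linear_scal_l|].
  intros x Hx.
  assert (x = z) as ->.
  { symmetry; apply (is_filter_lim_locally_unique (V := AbsRing_NormedModule C_AbsRing)). exact Hx.
      }
  intros eps. generalize (H eps); intros H1. apply locally_C in H1. revert H1. apply filter_imp.
  intros w Hw. refine (Rle_trans _ _ _ _ Hw). right.
    unfold norm; simpl. unfold abs; simpl. f_equal.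
    unfold minus, plus, opp, scal, mult; simpl. unfold mult; simpl. ring.
Qed.

Lemma is_derive_eps (f : R -> R) (t l : R) :
  is_derive f t l <->
  forall eps : posreal, locally t (fun u => (Rabs (f u - f t - l * (u - t)) <= eps * Rabs
    (u - t))%R).
Proof.
split.
- intros [_ H] eps. generalize (H t (fun P HP => HP) eps).
  apply filter_imp. intros u Hu. refine (Rle_trans _ _ _ _ Hu). right.
  unfold norm; simpl. unfold abs; simpl. f_equal.
  unfold minus, plus, opp, scal; simpl. unfold mult; simpl. ring.
- intros H. split; [apply is_linear_scal_l|].
  intros x Hx.
  assert (x = t) as -> by (symmetry; apply is_filter_lim_locally_unique; exact Hx).
  intros eps. generalize (H eps). apply filter_imp. intros u Hu. refine (Rle_trans _ _ _ _ Hu).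
    right.
  unfold norm; simpl. unfold abs; simpl. f_equal.
  unfold minus, plus, opp, scal; simpl. unfold mult; simpl. ring.
Qed.

Lemma im_le_Cmod (c : C) : (Rabs (Im c) <= Cmod c)%R.
Proof. generalize (Rmax_Cmod c) (Rmax_r (Rabs (fst c)) (Rabs (snd c))). unfold Im. lra. Qed.

Lemma Cmod_le_Re_Im (c : C) : (Cmod c <= Rabs (Re c) + Rabs (Im c))%R.
Proof.
assert (E : c = RtoC (Re c) + Ci * RtoC (Im c)) by (destruct c; apply Ceq; simpl; ring).
rewrite E at 1.
eapply Rle_trans; [apply Cmod_triangle|]. rewrite Cmod_mult, Cmod_Ci, !Cmod_R. lra.
Qed.

(** The same estimate as in [holo_eps], so that the two kinds of derivative can be composed. *)
Lemma cderiv_eps (f : R -> C) (t : R) (l : C) :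
  cderiv f t l <->
  forall eps : posreal,
    locally t (fun u => (Cmod (f u - f t - l * RtoC (u - t)) <= eps * Rabs (u - t))%R).
Proof.
assert (HRe : forall u, Re (f u - f t - l * RtoC (u - t)) =
  (Re (f u) - Re (f t) - Re l * (u - t))%R)
  by (intros; destruct (f u), (f t), l; simpl; ring).
assert (HIm : forall u, Im (f u - f t - l * RtoC (u - t)) =
  (Im (f u) - Im (f t) - Im l * (u - t))%R)
  by (intros; destruct (f u), (f t), l; simpl; ring).
split.
- intros [H1 H2] eps.
  assert (He : (0 < eps / 2)%R) by (generalize (cond_pos eps); lra).
  generalize (proj1 (is_derive_eps _ _ _) H1 (mkposreal _ He)).
  generalize (proj1 (is_derive_eps _ _ _) H2 (mkposreal _ He)).
  intros K2 K1. generalize (filter_and _ _ K1 K2). apply filter_imp.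
  intros u [L1 L2]. eapply Rle_trans; [apply Cmod_le_Re_Im|].
  rewrite HRe, HIm. simpl in *. lra.
- intros H; split; apply is_derive_eps; intros eps; generalize (H eps); apply filter_imp;
  intros u Hu; (eapply Rle_trans; [|exact Hu]).
  + rewrite <- HRe. apply re_le_Cmod.
  + rewrite <- HIm. apply im_le_Cmod.
Qed.

Lemma cderiv_val (f : R -> C) t l l' : cderiv f t l -> l = l' -> cderiv f t l'.
Proof. now intros H <-. Qed.

Lemma cderiv_ext (f g : R -> C) t l : (forall u, f u = g u) -> cderiv f t l -> cderiv g t l.
Proof.
intros E [H1 H2]; split; [revert H1|revert H2]; apply is_derive_ext; intros u; now rewrite E.
Qed.

Lemma cderiv_const (c : C) t : cderiv (fun _ => c) t 0.
Proof. split; simpl; apply (is_derive_const (V := R_NormedModule)). Qed.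

Lemma cderiv_RtoC (f : R -> R) t l : is_derive f t l -> cderiv (fun u => RtoC (f u)) t (RtoC l).
Proof. intros H; split; simpl; [exact H|apply (is_derive_const (V := R_NormedModule))]. Qed.

Lemma cderiv_plus f g t l m : cderiv f t l -> cderiv g t m -> cderiv (fun u => f u + g u) t (l + m).
Proof.
intros [H1 H2] [K1 K2]; split; simpl; apply (is_derive_plus (V := R_NormedModule)); assumption.
Qed.

Lemma cderiv_opp f t l : cderiv f t l -> cderiv (fun u => - f u) t (- l).
Proof. intros [H1 H2]; split; simpl; apply (is_derive_opp (V := R_NormedModule)); assumption. Qed.

Lemma cderiv_minus f g t l m : cderiv f t l -> cderiv g t m ->
  cderiv (fun u => f u - g u) t (l - m).
Proof. intros H K. apply cderiv_plus; [assumption|now apply cderiv_opp]. Qed.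

Lemma cderiv_conj f t l : cderiv f t l -> cderiv (fun u => Cconj (f u)) t (Cconj l).
Proof.
intros [H1 H2]; split; simpl; [assumption|]. apply (is_derive_opp (V := R_NormedModule));
  assumption.
Qed.

Lemma is_derive_Rmult (f g : R -> R) t l m : is_derive f t l -> is_derive g t m ->
  is_derive (fun u => (f u * g u)%R) t (l * g t + f t * m)%R.
Proof. intros H K. apply (is_derive_mult (K := R_AbsRing)); auto. intros; apply Rmult_comm. Qed.

Lemma cderiv_mult f g t l m : cderiv f t l -> cderiv g t m ->
  cderiv (fun u => f u * g u) t (l * g t + f t * m).
Proof.
intros [H1 H2] [K1 K2]; split; simpl.
- evar_last. apply (is_derive_minus (V := R_NormedModule)); apply is_derive_Rmult; eassumption.
  unfold minus, plus, opp; simpl. unfold Re, Im. ring.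
- evar_last. apply (is_derive_plus (V := R_NormedModule)); apply is_derive_Rmult; eassumption.
  unfold minus, plus, opp; simpl. unfold Re, Im. ring.
Qed.

Lemma cderiv_zero_const (f : R -> C) (a b : R) :
  (forall t, Rmin a b <= t <= Rmax a b -> cderiv f t 0)%R -> f b = f a.
Proof.
intros H.
assert (K : forall g : R -> R, (forall t, Rmin a b <= t <= Rmax a b -> is_derive g t 0)%R ->
  g b = g a).
{ intros g Hg. destruct (MVT_gen g a b (fun _ => 0%R)) as [c [_ Hc]].
  - intros x Hx. apply Hg. lra.
  - intros x Hx. apply continuity_pt_filterlim. apply (ex_derive_continuous g x). exists 0%R;
      now apply Hg.
  - lra. }
apply Ceq.
- apply (K (fun u => Re (f u))). intros t Ht; apply H, Ht.
- apply (K (fun u => Im (f u))). intros t Ht; apply H, Ht.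
Qed.

Lemma holo_val f z l l' : holo f z l -> l = l' -> holo f z l'.
Proof. now intros H <-. Qed.

Lemma holo_const (c : C) z : holo (fun _ => c) z 0.
Proof. exact (is_derive_const (K := C_AbsRing) (V := AbsRing_NormedModule C_AbsRing) c z). Qed.

Lemma holo_id z : holo (fun w => w) z 1.
Proof. exact (is_derive_id (K := C_AbsRing) z). Qed.

Lemma holo_plus f g z l m : holo f z l -> holo g z m -> holo (fun w => f w + g w) z (l + m).
Proof.
intros H K; exact (is_derive_plus (K := C_AbsRing) (V := AbsRing_NormedModule C_AbsRing) f g z l m H
  K).
Qed.

Lemma holo_opp f z l : holo f z l -> holo (fun w => - f w) z (- l).
Proof.
intros H; exact (is_derive_opp (K := C_AbsRing) (V := AbsRing_NormedModule C_AbsRing) f z l H).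
Qed.

Lemma holo_mult f g z l m : holo f z l -> holo g z m ->
  holo (fun w => f w * g w) z (l * g z + f z * m).
Proof. intros H K; exact (is_derive_mult (K := C_AbsRing) f g z l m H K Cmult_comm). Qed.

Lemma holo_comp f g z l m : holo f (g z) l -> holo g z m -> holo (fun w => f (g w)) z (m * l).
Proof.
intros H K; exact (is_derive_comp (K := C_AbsRing) (V := AbsRing_NormedModule C_AbsRing) f g z l m H
  K).
Qed.

Lemma locally_C_eps (z : C) (P : C -> Prop) :
  locally (T := C_UniformSpace) z P <-> exists d : posreal, forall w, (Cmod (w - z) < d)%R -> P w.
Proof.
split.
- intros H. apply locally_C in H. destruct H as [d Hd]. exists d. intros w Hw. apply Hd. exact Hw.
- intros [d Hd]. apply locally_C. exists d. intros w Hw. apply Hd. exact Hw.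
Qed.

Lemma holo_cont f z l : holo f z l -> forall eps : posreal,
  locally (T := C_UniformSpace) z (fun w => (Cmod (f w - f z) < eps)%R).
Proof.
intros H eps. apply holo_eps with (eps := mkposreal 1 Rlt_0_1) in H. simpl in H.
set (k := (Cmod l + 2)%R). assert (Hk : (0 < k)%R) by (generalize (Cmod_ge_0 l); unfold k; lra).
assert (Hd : (0 < eps / k)%R) by (apply Rdiv_lt_0_compat; [apply cond_pos|assumption]).
assert (H2 : locally (T := C_UniformSpace) z (fun w => (Cmod (w - z) < eps / k)%R)).
{ apply locally_C_eps. exists (mkposreal _ Hd). auto. }
generalize (filter_and _ _ H H2). apply filter_imp. intros w [K1 K2].
replace (f w - f z) with ((f w - f z - l * (w - z)) + l * (w - z)) by ring.
eapply Rle_lt_trans; [apply Cmod_triangle|]. rewrite Cmod_mult.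
apply Rle_lt_trans with ((1 + Cmod l) * Cmod (w - z))%R; [lra|].
apply Rle_lt_trans with (k * Cmod (w - z))%R.
- apply Rmult_le_compat_r; [apply Cmod_ge_0|unfold k; lra].
- apply Rlt_le_trans with (k * (eps / k))%R; [apply Rmult_lt_compat_l; assumption|].
  right. field. lra.
Qed.

Lemma holo_inv (z : C) : z <> 0 -> holo (fun w => / w) z (- / (z * z)).
Proof.
intros Hz. apply holo_eps. intros eps.
assert (Hm : (0 < Cmod z)%R) by now apply Cmod_gt_0.
set (d := Rmin (Cmod z / 2) (eps * (Cmod z * Cmod z * Cmod z) / 2)).
assert (Hd : (0 < d)%R).
{ apply Rmin_pos; [lra|]. apply Rdiv_lt_0_compat; [|lra]. repeat apply Rmult_lt_0_compat; auto.
    apply cond_pos. }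
apply locally_C_eps. exists (mkposreal d Hd). simpl. intros w Hw.
assert (H1 : (Cmod (w - z) < Cmod z / 2)%R) by (eapply Rlt_le_trans; [exact Hw|apply Rmin_l]).
assert (H2 : (Cmod (w - z) < eps * (Cmod z * Cmod z * Cmod z) / 2)%R)
  by (eapply Rlt_le_trans; [exact Hw|apply Rmin_r]).
assert (H3 : (Cmod z / 2 <= Cmod w)%R).
{ generalize (Cmod_triangle w (z - w)). replace (w + (z - w)) with z by ring.
  replace (z - w) with (- (w - z)) by ring. rewrite Cmod_opp. lra. }
assert (Hw0 : w <> 0) by (apply Cmod_gt_0; lra).
replace (/ w - / z - - / (z * z) * (w - z)) with ((w - z) * ((w - z) / (z * z * w)))
  by (field; auto).
rewrite Cmod_mult, Rmult_comm. apply Rmult_le_compat_r; [apply Cmod_ge_0|].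
assert (z * z * w <> 0) by (repeat apply Cmult_neq_0; auto).
rewrite Cmod_div by auto. rewrite !Cmod_mult.
apply Rmult_le_reg_r with (Cmod z * Cmod z * Cmod w)%R;
  [repeat apply Rmult_lt_0_compat; auto; lra|].
unfold Rdiv. rewrite Rmult_assoc, Rinv_l, Rmult_1_r
  by (apply Rgt_not_eq; repeat apply Rmult_lt_0_compat; auto; lra).
left. eapply Rlt_le_trans; [exact H2|].
generalize (cond_pos eps); intros He.
apply Rle_trans with (eps * (Cmod z * Cmod z * (Cmod z / 2)))%R; [right; field|].
apply Rmult_le_compat_l; [lra|]. apply Rmult_le_compat_l; [|assumption]. apply Rmult_le_pos; lra.
Qed.

Lemma cderiv_cont (f : R -> C) t l : cderiv f t l ->
  forall eps : posreal, locally t (fun u => (Cmod (f u - f t) < eps)%R).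
Proof.
intros [H1 H2] eps.
assert (He : (0 < eps / 2)%R) by (generalize (cond_pos eps); lra).
assert (C1 : continuous (fun u => Re (f u)) t)
  by (apply (ex_derive_continuous (fun u => Re (f u))); eexists; exact H1).
assert (C2 : continuous (fun u => Im (f u)) t)
  by (apply (ex_derive_continuous (fun u => Im (f u))); eexists; exact H2).
assert (L1 : locally t (fun u => ball (Re (f t)) (mkposreal _ He) (Re (f u))))
  by (apply C1; apply locally_ball).
assert (L2 : locally t (fun u => ball (Im (f t)) (mkposreal _ He) (Im (f u))))
  by (apply C2; apply locally_ball).
generalize (filter_and _ _ L1 L2). apply filter_imp. intros u [K1 K2].
eapply Rle_lt_trans; [apply Cmod_le_Re_Im|].
change (Rabs (Re (f u) - Re (f t)) < eps / 2)%R in K1.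
change (Rabs (Im (f u) - Im (f t)) < eps / 2)%R in K2.
change (Re (f u - f t)) with (Re (f u) - Re (f t))%R.
change (Im (f u - f t)) with (Im (f u) - Im (f t))%R. lra.
Qed.

Lemma cderiv_holo_comp (f : C -> C) (g : R -> C) t l m :
  holo f (g t) l -> cderiv g t m -> cderiv (fun u => f (g u)) t (l * m).
Proof.
intros Hf Hg. apply cderiv_eps. intros eps.
set (k := (Cmod m + 1)%R). set (k' := (Cmod l + 1)%R).
assert (Hk : (0 < k)%R) by (generalize (Cmod_ge_0 m); unfold k; lra).
assert (Hk' : (0 < k')%R) by (generalize (Cmod_ge_0 l); unfold k'; lra).
assert (He0 := cond_pos eps).
assert (E1 : (0 < eps / 2 / k)%R) by (repeat apply Rdiv_lt_0_compat; lra).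
assert (E2 : (0 < Rmin 1 (eps / 2 / k'))%R) by
  (apply Rmin_pos; [lra|repeat apply Rdiv_lt_0_compat; lra]).
apply holo_eps with (eps := mkposreal _ E1) in Hf. apply locally_C_eps in Hf. destruct Hf as [d Hd].
generalize (cderiv_cont _ _ _ Hg d).
apply cderiv_eps with (eps := mkposreal _ E2) in Hg. intros Hc.
generalize (filter_and _ _ Hg Hc). apply filter_imp. simpl. intros u [K1 K2].
specialize (Hd _ K2). simpl in Hd.
set (r := Rabs (u - t)) in *. assert (Hr : (0 <= r)%R) by apply Rabs_pos.
assert (K3 : (Cmod (g u - g t) <= k * r)%R).
{ replace (g u - g t) with ((g u - g t - m * RtoC (u - t)) + m * RtoC (u - t)) by ring.
  eapply Rle_trans; [apply Cmod_triangle|]. rewrite Cmod_mult, Cmod_R. fold r.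
  generalize (Rmult_le_compat_r r _ _ Hr (Rmin_l 1 (eps / 2 / k'))). unfold k. lra. }
replace (f (g u) - f (g t) - l * m * RtoC (u - t)) with
  ((f (g u) - f (g t) - l * (g u - g t)) + l * (g u - g t - m * RtoC (u - t))) by ring.
eapply Rle_trans; [apply Cmod_triangle|]. rewrite Cmod_mult.
assert (L1 : (Cmod (f (g u) - f (g t) - l * (g u - g t)) <= eps / 2 * r)%R).
{ eapply Rle_trans; [exact Hd|]. apply Rle_trans with (eps / 2 / k * (k * r))%R.
  - apply Rmult_le_compat_l; [lra|assumption].
  - right; field; lra. }
assert (L2 : (Cmod l * Cmod (g u - g t - m * RtoC (u - t)) <= eps / 2 * r)%R).
{ apply Rle_trans with (k' * (eps / 2 / k' * r))%R.
  - apply Rmult_le_compat; try apply Cmod_ge_0; [unfold k'; lra|].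
    eapply Rle_trans; [exact K1|]. apply Rmult_le_compat_r; [assumption|apply Rmin_r].
  - right; field; lra. }
lra.
Qed.

Lemma cderiv_inv (f : R -> C) t l : cderiv f t l -> f t <> 0 ->
  cderiv (fun u => / f u) t (- l / (f t * f t)).
Proof.
intros H H0. eapply cderiv_val; [apply (cderiv_holo_comp (fun w => / w)); [apply holo_inv|];
  eassumption|].
field; auto.
Qed.

Lemma holo_ext f g z l : (forall w, f w = g w) -> holo f z l -> holo g z l.
Proof.
intros E H. exact (is_derive_ext (K := C_AbsRing) (V := AbsRing_NormedModule C_AbsRing) f g z l E
  H).
Qed.

(** * Matrices of size two *)

Definition adj (M : M2) : M2 := mat2 (entry M 1 1) (- entry M 0 1) (- entry M 1 0) (entry M 0 0).

Lemma M2_eta (M : M2) : M = mat2 (entry M 0 0) (entry M 0 1) (entry M 1 0) (entry M 1 1).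
Proof. destruct M as [[p [q []]] [[u [w []]] []]]. reflexivity. Qed.

Lemma mat2_inj p q u w p' q' u' w' : mat2 p q u w = mat2 p' q' u' w' -> p = p' /\ q = q' /\
  u = u' /\ w = w'.
Proof. unfold mat2. intros H. injection H. auto. Qed.

Lemma mmul_mat2 p q u w p' q' u' w' :
  mmul (mat2 p q u w) (mat2 p' q' u' w') =
  mat2 (p * p' + q * u') (p * q' + q * w') (u * p' + w * u') (u * q' + w * w').
Proof.
unfold mmul, Mmult, mk_matrix, mat2. cbn [mk_Tn]. unfold mk_Tn, coeff_mat. simpl.
rewrite !sum_Sn, !sum_O. reflexivity.
Qed.

Lemma mscal_mat2 c p q u w : mscal c (mat2 p q u w) = mat2 (c * p) (c * q) (c * u) (c * w).
Proof. reflexivity. Qed.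

Lemma adj_mat2 p q u w : adj (mat2 p q u w) = mat2 w (- q) (- u) p.
Proof. reflexivity. Qed.

Lemma mdet_mat2 p q u w : mdet (mat2 p q u w) = p * w - q * u.
Proof. reflexivity. Qed.

Lemma mconjT_mat2 p q u w : mconjT (mat2 p q u w) = mat2 (Cconj p) (Cconj u) (Cconj q) (Cconj w).
Proof. reflexivity. Qed.

Lemma mat2_eq p q u w p' q' u' w' : p = p' -> q = q' -> u = u' -> w = w' ->
  mat2 p q u w = mat2 p' q' u' w'.
Proof. now intros -> -> -> ->. Qed.

(** Reduces an identity between matrices to scalar ring identities. *)
Lemma M2_destruct (P : M2 -> Prop) : (forall p q u w, P (mat2 p q u w)) -> forall M, P M.
Proof. intros H M. rewrite (M2_eta M). apply H. Qed.

Definition madd (M N : M2) : M2 :=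
  mat2 (entry M 0 0 + entry N 0 0) (entry M 0 1 + entry N 0 1) (entry M 1 0 + entry N 1 0)
    (entry M 1 1 + entry N 1 1).

Lemma madd_mat2 p q u w p' q' u' w' : madd (mat2 p q u w) (mat2 p' q' u' w') = mat2 (p + p')
  (q + q') (u + u') (w + w').
Proof. reflexivity. Qed.

Ltac mat_norm :=
  repeat first [rewrite adj_mat2 | rewrite mmul_mat2 | rewrite madd_mat2 | rewrite mscal_mat2
               | rewrite mconjT_mat2 | rewrite mdet_mat2].

Ltac mat_ring :=
  repeat match goal with M : M2 |- _ => revert M; refine (M2_destruct _ _); intros ? ? ? ? end;
  mat_norm; try apply mat2_eq; try ring.

Definition Mid : M2 := mat2 1 0 0 1.

Lemma mmul_assoc (L M N : M2) : mmul (mmul L M) N = mmul L (mmul M N).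
Proof. mat_ring. Qed.

Lemma mmul_1_l (M : M2) : mmul Mid M = M.
Proof. unfold Mid. mat_ring. Qed.

Lemma mmul_1_r (M : M2) : mmul M Mid = M.
Proof. unfold Mid. mat_ring. Qed.

Lemma mdet_mmul (M N : M2) : mdet (mmul M N) = mdet M * mdet N.
Proof. mat_ring. Qed.

Lemma mdet_adj (M : M2) : mdet (adj M) = mdet M.
Proof. mat_ring. Qed.

Lemma adj_mmul (M N : M2) : adj (mmul M N) = mmul (adj N) (adj M).
Proof. mat_ring. Qed.

Lemma mmul_adj_r (M : M2) : mdet M = 1 -> mmul M (adj M) = Mid.
Proof. revert M. refine (M2_destruct _ _). intros p q u w. rewrite mdet_mat2, adj_mat2, mmul_mat2.
  unfold Mid.
intros H. apply mat2_eq; try ring; rewrite <- H; ring. Qed.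

Lemma mmul_adj_l (M : M2) : mdet M = 1 -> mmul (adj M) M = Mid.
Proof. revert M. refine (M2_destruct _ _). intros p q u w. rewrite mdet_mat2, adj_mat2, mmul_mat2.
  unfold Mid.
intros H. apply mat2_eq; try ring; rewrite <- H; ring. Qed.

Lemma minv_adj (M : M2) : mdet M = 1 -> minv M = adj M.
Proof.
unfold minv. intros ->. revert M. refine (M2_destruct _ _). intros p q u w. rewrite adj_mat2.
change (mscal (/ 1) (mat2 w (- q) (- u) p) = mat2 w (- q) (- u) p).
replace (/ 1) with (RtoC 1) by (field; apply C1_nz). mat_ring.
Qed.

Lemma mconjT_mmul (M N : M2) : mconjT (mmul M N) = mmul (mconjT N) (mconjT M).
Proof.
mat_ring; rewrite Cplus_conj, !Cmult_conj; ring.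
Qed.

Lemma mconjT_adj (M : M2) : mconjT (adj M) = adj (mconjT M).
Proof. mat_ring; rewrite ?Copp_conj; reflexivity. Qed.

Lemma entry_mmul (M N : M2) (i j : nat) : (i < 2)%nat -> (j < 2)%nat ->
  entry (mmul M N) i j = entry M i 0 * entry N 0 j + entry M i 1 * entry N 1 j.
Proof.
revert M N. refine (M2_destruct _ _). intros p q u w. refine (M2_destruct _ _). intros p' q' u' w'.
intros Hi Hj. rewrite mmul_mat2. destruct i as [|[|i]], j as [|[|j]]; try lia; reflexivity.
Qed.

Lemma entry_adj (M : M2) : entry (adj M) 0 0 = entry M 1 1 /\ entry (adj M) 0 1 = - entry M 0 1 /\
  entry (adj M) 1 0 = - entry M 1 0 /\ entry (adj M) 1 1 = entry M 0 0.
Proof. repeat split. Qed.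

Lemma mmul_mscal_l c M N : mmul (mscal c M) N = mscal c (mmul M N).
Proof. mat_ring. Qed.

Lemma mmul_mscal_r c M N : mmul M (mscal c N) = mscal c (mmul M N).
Proof. mat_ring. Qed.

Definition mderiv (F : R -> M2) (t : R) (L : M2) : Prop :=
  cderiv (fun u => entry (F u) 0 0) t (entry L 0 0) /\
    cderiv (fun u => entry (F u) 0 1) t (entry L 0 1) /\
  cderiv (fun u => entry (F u) 1 0) t (entry L 1 0) /\
    cderiv (fun u => entry (F u) 1 1) t (entry L 1 1).

Lemma mderiv_val F t L L' : mderiv F t L -> L = L' -> mderiv F t L'.
Proof. now intros H <-. Qed.

Lemma mderiv_ext F G t L : (forall u, F u = G u) -> mderiv F t L -> mderiv G t L.
Proof.
intros E (H1 & H2 & H3 & H4). split; [|split; [|split]].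
- apply (cderiv_ext (fun u => entry (F u) 0 0)); [intros u; now rewrite E|assumption].
- apply (cderiv_ext (fun u => entry (F u) 0 1)); [intros u; now rewrite E|assumption].
- apply (cderiv_ext (fun u => entry (F u) 1 0)); [intros u; now rewrite E|assumption].
- apply (cderiv_ext (fun u => entry (F u) 1 1)); [intros u; now rewrite E|assumption].
Qed.

Lemma mderiv_mat2 p q u w t p' q' u' w' :
  cderiv p t p' -> cderiv q t q' -> cderiv u t u' -> cderiv w t w' ->
  mderiv (fun x => mat2 (p x) (q x) (u x) (w x)) t (mat2 p' q' u' w').
Proof. intros H1 H2 H3 H4. split; [exact H1|split; [exact H2|split; [exact H3|exact H4]]]. Qed.

Lemma mderiv_mmul F G t L K : mderiv F t L -> mderiv G t K ->
  mderiv (fun u => mmul (F u) (G u)) t (madd (mmul L (G t)) (mmul (F t) K)).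
Proof.
intros (H1 & H2 & H3 & H4) (K1 & K2 & K3 & K4).
assert (E : forall M N, mmul M N = mat2 (entry M 0 0 * entry N 0 0 + entry M 0 1 * entry N 1 0)
  (entry M 0 0 * entry N 0 1 + entry M 0 1 * entry N 1 1)
   (entry M 1 0 * entry N 0 0 + entry M 1 1 * entry N 1 0)
     (entry M 1 0 * entry N 0 1 + entry M 1 1 * entry N 1 1)).
{ intros M N. rewrite (M2_eta (mmul M N)), !entry_mmul by lia. reflexivity. }
refine (mderiv_ext _ _ _ _ (fun u => eq_sym (E (F u) (G u))) _).
eapply mderiv_val; [apply mderiv_mat2; apply cderiv_plus; apply cderiv_mult; eassumption|].
rewrite !E, madd_mat2. apply mat2_eq; ring.
Qed.

Lemma mderiv_adj F t L : mderiv F t L -> mderiv (fun u => adj (F u)) t (adj L).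
Proof. intros (H1 & H2 & H3 & H4). apply mderiv_mat2; auto using cderiv_opp. Qed.

Lemma mderiv_mconjT F t L : mderiv F t L -> mderiv (fun u => mconjT (F u)) t (mconjT L).
Proof.
intros (H1 & H2 & H3 & H4).
apply (mderiv_mat2 _ _ _ _ t (Cconj (entry L 0 0)) (Cconj (entry L 1 0)) (Cconj (entry L 0 1))
  (Cconj (entry L 1 1)));
 auto using cderiv_conj.
Qed.

Lemma mderiv_zero_const F a b : (forall t, Rmin a b <= t <= Rmax a b -> mderiv F t (mat2 0 0 0 0))%R
  -> F b = F a.
Proof.
intros H. rewrite (M2_eta (F a)), (M2_eta (F b)).
apply mat2_eq.
- apply (cderiv_zero_const (fun u => entry (F u) 0 0)). intros t Ht. apply (H t Ht).
- apply (cderiv_zero_const (fun u => entry (F u) 0 1)). intros t Ht. apply (H t Ht).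
- apply (cderiv_zero_const (fun u => entry (F u) 1 0)). intros t Ht. apply (H t Ht).
- apply (cderiv_zero_const (fun u => entry (F u) 1 1)). intros t Ht. apply (H t Ht).
Qed.

(** * Complex series and entire power series *)

Lemma ex_series_le_R (a b : nat -> R) : (forall n, (Rabs (a n) <= b n)%R) -> ex_series b ->
  ex_series a.
Proof. apply (ex_series_le (K := R_AbsRing) (V := R_CompleteNormedModule)). Qed.

Lemma ex_series_scal_R (c : R) (a : nat -> R) : ex_series a -> ex_series (fun n => c * a n)%R.
Proof. apply (ex_series_scal (K := R_AbsRing) (V := R_NormedModule)). Qed.

Definition Cseries (a : nat -> C) : C := (Series (fun n => Re (a n)), Series (fun n => Im (a n))).

Definition csummable (a : nat -> C) : Prop := ex_series (fun n => Cmod (a n)).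

Lemma csummable_le a (M : nat -> R) : (forall n, (Cmod (a n) <= M n)%R) -> ex_series M ->
  csummable a.
Proof.
intros H. apply ex_series_le_R. intros n. rewrite Rabs_pos_eq by apply Cmod_ge_0. apply H.
Qed.

Lemma csummable_Re a : csummable a -> ex_series (fun n => Re (a n)).
Proof. apply ex_series_le_R. intros n. apply re_le_Cmod. Qed.

Lemma csummable_Im a : csummable a -> ex_series (fun n => Im (a n)).
Proof. apply ex_series_le_R. intros n. apply im_le_Cmod. Qed.

Lemma Cseries_ext a b : (forall n, a n = b n) -> Cseries a = Cseries b.
Proof. intros H. unfold Cseries. f_equal; apply Series_ext; intros n; now rewrite H. Qed.

Lemma Cseries_plus a b : csummable a -> csummable b ->
  Cseries (fun n => a n + b n) = Cseries a + Cseries b.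
Proof.
intros Ha Hb. apply Ceq; simpl; apply Series_plus; auto using csummable_Re, csummable_Im.
Qed.

Lemma Cseries_scal c a : csummable a -> Cseries (fun n => c * a n) = c * Cseries a.
Proof.
intros Ha. assert (Hr := csummable_Re _ Ha). assert (Hi := csummable_Im _ Ha).
apply Ceq; destruct c as [x y]; simpl.
- rewrite <- !Series_scal_l, <- Series_minus.
  + apply Series_ext. intros n. destruct (a n); reflexivity.
  + now apply (ex_series_scal_R x).
  + now apply (ex_series_scal_R y).
- rewrite <- !Series_scal_l, <- Series_plus.
  + apply Series_ext. intros n. destruct (a n); reflexivity.
  + now apply (ex_series_scal_R x).
  + now apply (ex_series_scal_R y).
Qed.

Lemma csummable_scal c a : csummable a -> csummable (fun n => c * a n).
Proof.
intros H. apply (csummable_le _ (fun n => Cmod c * Cmod (a n))%R).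
- intros n. rewrite Cmod_mult. lra.
- now apply ex_series_scal_R.
Qed.

Lemma csummable_plus a b : csummable a -> csummable b -> csummable (fun n => a n + b n).
Proof.
intros H K. apply (csummable_le _ (fun n => Cmod (a n) + Cmod (b n))%R).
- intros n. apply Cmod_triangle.
- now apply (ex_series_plus (K := R_AbsRing) (V := R_NormedModule)).
Qed.

Lemma Cseries_incr_1 a : csummable a -> Cseries a = a O + Cseries (fun n => a (S n)).
Proof.
intros H. apply Ceq; simpl; rewrite Series_incr_1 by auto using csummable_Re, csummable_Im;
  reflexivity.
Qed.

Lemma Cseries_conj a : Cconj (Cseries a) = Cseries (fun n => Cconj (a n)).
Proof. apply Ceq; simpl; [reflexivity|]. symmetry. apply Series_opp. Qed.

Lemma Cseries_bound a (M : nat -> R) : (forall n, (Cmod (a n) <= M n)%R) -> ex_series M ->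
  (Cmod (Cseries a) <= 2 * Series M)%R.
Proof.
intros H HM.
assert (K : forall f : nat -> R, (forall n, (Rabs (f n) <= M n)%R) ->
  (Rabs (Series f) <= Series M)%R).
{ intros f Hf. eapply Rle_trans; [apply Series_Rabs|].
  - apply (ex_series_le_R _ M); [|assumption]. intros n.
    rewrite Rabs_Rabsolu. apply Hf.
  - apply Series_le; [|assumption]. intros n. split; [apply Rabs_pos|apply Hf]. }
eapply Rle_trans; [apply Cmod_le_Re_Im|].
assert (K1 := K (fun n => Re (a n)) (fun n => Rle_trans _ _ _ (re_le_Cmod _) (H n))).
assert (K2 := K (fun n => Im (a n)) (fun n => Rle_trans _ _ _ (im_le_Cmod _) (H n))).
simpl. lra.
Qed.

Lemma Series_tail_small (M : nat -> R) (eps : R) : ex_series M -> (0 < eps)%R ->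
  exists N, (Series (fun n => M (N + n)%nat) < eps)%R /\ ex_series (fun n => M (N + n)%nat).
Proof.
intros HM He. assert (L := Series_correct _ HM).
assert (L' : is_lim_seq (sum_n M) (Series M)) by exact L.
apply is_lim_seq_spec in L'. destruct (L' (mkposreal eps He)) as [N HN]. simpl in HN.
exists (S N). assert (HS : ex_series (fun n => M (S N + n)%nat))
  by (apply (ex_series_incr_n M (S N)); assumption).
split; [|exact HS].
assert (E := Series_incr_n M (S N) ltac:(lia) HM). simpl pred in E. rewrite <- sum_n_Reals in E.
specialize (HN N (Nat.le_refl _)). apply Rabs_lt_between in HN. lra.
Qed.

(** Termwise differentiation, reduced to remainders: if the remainders [a n] are dominated by
    [M n * d] with a summable [M], the tail costs little and each of the finitely many other terms
    is negligible.  The filter is arbitrary so that real and complex variables are both covered. *)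
Lemma Cseries_little_o {T : Type} (F : (T -> Prop) -> Prop) {FF : Filter F} (d : T -> R)
  (a : nat -> T -> C) (M : nat -> R) :
  ex_series M -> F (fun t => 0 <= d t)%R -> F (fun t => forall n, Cmod (a n t) <= M n * d t)%R ->
  (forall n (eps : posreal), F (fun t => Cmod (a n t) <= eps * d t)%R) ->
  forall eps : posreal, F (fun t => Cmod (Cseries (fun n => a n t)) <= eps * d t)%R.
Proof.
intros HM Hd HB Hn eps.
assert (He := cond_pos eps).
destruct (Series_tail_small M (eps / 4) HM ltac:(lra)) as [N [HN HSN]].
(* peel off finitely many terms, each of them being negligible *)
assert (K : forall k (b : nat -> T -> C), F (fun t => csummable (fun n => b n t)) ->
   (forall n (e : posreal), F (fun t => Cmod (b n t) <= e * d t)%R) ->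
   forall e : posreal, F (fun t => Cmod (Cseries (fun n => b n t)) <= e * d t + Cmod
     (Cseries (fun n => b (k + n)%nat t)))%R).
{ induction k as [|k IH]; intros b Hs Hb e.
  - revert Hd. apply filter_imp. intros t Ht. simpl. assert (0 <= e * d t)%R
      by (apply Rmult_le_pos; [left; apply cond_pos|assumption]). lra.
  - assert (He2 : (0 < e / 2)%R) by (generalize (cond_pos e); lra).
    assert (Hs' : F (fun t => csummable (fun n => b (S n) t))).
    { revert Hs. apply filter_imp. intros t Ht. apply (ex_series_incr_1 (fun n => Cmod (b n t))).
        exact Ht. }
    generalize (IH (fun n => b (S n)) Hs' (fun n => Hb (S n)) (mkposreal _ He2))
      (Hb O (mkposreal _ He2)).
    intros K1 K2. generalize (filter_and _ _ Hs (filter_and _ _ K1 K2)). apply filter_imp.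
    simpl. intros t [L0 [L1 L2]]. rewrite Cseries_incr_1 by assumption.
    eapply Rle_trans; [apply Cmod_triangle|]. lra. }
assert (Hs : F (fun t => csummable (fun n => a n t))).
{ generalize (filter_and _ _ Hd HB). apply filter_imp. intros t [Ht Hb].
  apply (csummable_le _ (fun n => M n * d t)%R); [exact Hb|]. now apply ex_series_scal_r. }
assert (He2 : (0 < eps / 2)%R) by lra.
generalize (filter_and _ _ (K N a Hs Hn (mkposreal _ He2)) (filter_and _ _ Hd HB)).
apply filter_imp. simpl. intros t [K1 [Ht Hb]].
assert (B : (Cmod (Cseries (fun n => a (N + n)%nat t)) <= 2 * Series
  (fun n => M (N + n)%nat * d t))%R).
{ apply Cseries_bound; [intros n; apply Hb|]. now apply ex_series_scal_r. }
rewrite Series_scal_r in B. nra.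
Qed.

Lemma cderiv_Cseries (f : nat -> R -> C) (f' : nat -> C) (M : nat -> R) (t : R) :
  ex_series M -> locally t (fun u => csummable (fun n => f n u)) ->
  (forall n, cderiv (f n) t (f' n)) -> (forall n, (Cmod (f' n) <= M n)%R) ->
  locally t (fun u => forall n, Cmod (f n u - f n t) <= M n * Rabs (u - t))%R ->
  cderiv (fun u => Cseries (fun n => f n u)) t (Cseries f').
Proof.
intros HM Hs Hd Hf' HL. apply cderiv_eps. intros eps.
assert (Hst : csummable (fun n => f n t)) by exact (locally_singleton _ _ Hs).
assert (Hsf' : csummable f') by exact (csummable_le _ _ Hf' HM).
assert (K := Cseries_little_o (locally t) (fun u => Rabs (u - t))
  (fun n u => f n u + (-(1) * f n t + - RtoC (u - t) * f' n))%C (fun n => 2 * M n)%R).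
assert (K' : locally t (fun u => Cmod (Cseries
  (fun n => f n u + (-(1) * f n t + - RtoC (u - t) * f' n))%C) <= eps * Rabs (u - t))%R).
{ apply K.
  - now apply (ex_series_scal_R 2%R).
  - apply filter_forall. intros; apply Rabs_pos.
  - revert HL. apply filter_imp. intros u Hu n.
    replace (f n u + (- (1) * f n t + - RtoC (u - t) * f' n))%C with
      ((f n u - f n t) + - (RtoC (u - t) * f' n))%C by ring.
    eapply Rle_trans; [apply Cmod_triangle|]. rewrite Cmod_opp, Cmod_mult, Cmod_R.
    specialize (Hu n). simpl in Hu. assert (Rabs (u - t) * Cmod (f' n) <= Rabs (u - t) * M n)%R
      by (apply Rmult_le_compat_l; [apply Rabs_pos|apply Hf']). lra.
  - intros n e. generalize (proj1 (cderiv_eps _ _ _) (Hd n) e). apply filter_imp. intros u Hu.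
    replace (f n u + (- (1) * f n t + - RtoC (u - t) * f' n)) with
      (f n u - f n t - f' n * RtoC (u - t)) by ring. exact Hu. }
generalize (filter_and _ _ Hs K'). apply filter_imp. intros u [Su Ku].
rewrite Cseries_plus, Cseries_plus, !Cseries_scal in Ku; auto using csummable_scal, csummable_plus.
replace (Cseries (fun n => f n u) - Cseries (fun n => f n t) - Cseries f' * RtoC (u - t)) with
  (Cseries (fun n => f n u) + (- (1) * Cseries (fun n => f n t) + - RtoC (u - t) * Cseries f'))
    by ring. exact Ku.
Qed.

Definition entire (c : nat -> R) : Prop := forall r, (0 <= r)%R ->
  ex_series (fun n => Rabs (c n) * r ^ n)%R.

Definition Cpseries (c : nat -> R) (z : C) : C := Cseries (fun n => RtoC (c n) * z ^ n).

Lemma entire_summable c z : entire c -> csummable (fun n => RtoC (c n) * z ^ n).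
Proof.
intros H. apply (csummable_le _ (fun n => Rabs (c n) * Cmod z ^ n)%R); [|apply H, Cmod_ge_0].
intros n. rewrite Cmod_mult, Cmod_R, Cmod_pow. lra.
Qed.

(** Differentiating a power series costs a factor [n + 1], which is paid for by a larger radius. *)
Lemma INR_pow_bound (r : R) (n : nat) : (0 <= r -> INR (S n) * r ^ n <= (r + 1) ^ S n)%R.
Proof.
intros Hr. induction n as [|n IH].
- simpl. lra.
- rewrite S_INR. assert (P1 : (r ^ S n <= (r + 1) ^ S n)%R) by (apply pow_incr; lra).
  change ((r + 1) ^ S (S n))%R with ((r + 1) * (r + 1) ^ S n)%R.
  assert (0 <= r ^ n)%R by now apply pow_le. assert (0 <= INR (S n))%R by apply pos_INR.
  assert (r * (INR (S n) * r ^ n) <= r * (r + 1) ^ S n)%R by now apply Rmult_le_compat_l.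
  simpl pow in *. lra.
Qed.

Lemma entire_PS_derive c : entire c -> entire (PS_derive c).
Proof.
intros H r Hr.
assert (K := H (r + 1)%R ltac:(lra)). apply (ex_series_incr_1 (fun n => Rabs (c n) * (r + 1) ^ n)%R)
  in K.
revert K. apply ex_series_le_R. intros n. unfold PS_derive. rewrite Rabs_pos_eq.
- rewrite Rabs_mult, (Rabs_pos_eq (INR _)) by apply pos_INR.
  rewrite (Rmult_comm (INR (S n))), Rmult_assoc. apply Rmult_le_compat_l; [apply Rabs_pos|].
    now apply INR_pow_bound.
- apply Rmult_le_pos; [apply Rabs_pos|now apply pow_le].
Qed.

Lemma holo_pow n z : holo (fun w => w ^ n) z (RtoC (INR n) * z ^ pred n).
Proof.
induction n as [|n IH].
- apply (holo_val _ _ 0); [apply (holo_ext (fun _ => 1)); [reflexivity|apply holo_const]|]. simpl.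
    ring.
- apply (holo_ext (fun w => w * w ^ n)); [reflexivity|].
  refine (holo_val _ _ _ _ (holo_mult _ _ _ _ _ (holo_id z) IH) _).
  rewrite S_INR, RtoC_plus. destruct n; simpl; ring.
Qed.

Lemma Cpow_lipschitz (r : R) (z w : C) n : (Cmod z <= r)%R -> (Cmod w <= r)%R ->
  (Cmod (w ^ n - z ^ n) <= (r + 1) ^ n * Cmod (w - z))%R.
Proof.
intros Hz Hw. assert (Hr : (0 <= r)%R) by (generalize (Cmod_ge_0 z); lra).
induction n as [|n IH].
- simpl. replace (1 - 1) with (RtoC 0) by ring. rewrite Cmod_0. generalize (Cmod_ge_0 (w - z)). lra.
- simpl. replace (w * w ^ n - z * z ^ n) with (w * (w ^ n - z ^ n) + (w - z) * z ^ n) by ring.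
  eapply Rle_trans; [apply Cmod_triangle|]. rewrite !Cmod_mult, Cmod_pow.
  assert (P1 : (Cmod z ^ n <= (r + 1) ^ n)%R) by (apply pow_incr; split; [apply Cmod_ge_0|lra]).
  assert (P2 : (Cmod w * Cmod (w ^ n - z ^ n) <= r * ((r + 1) ^ n * Cmod (w - z)))%R)
    by (apply Rmult_le_compat; auto; apply Cmod_ge_0).
  assert (P3 : (Cmod (w - z) * Cmod z ^ n <= Cmod (w - z) * (r + 1) ^ n)%R)
    by (apply Rmult_le_compat_l; [apply Cmod_ge_0|assumption]).
  lra.
Qed.

Lemma Cpow_derive_bound (r : R) (z : C) n : (Cmod z <= r)%R ->
  (Cmod (RtoC (INR n) * z ^ pred n) <= (r + 1) ^ n)%R.
Proof.
intros Hz. assert (Hz0 := Cmod_ge_0 z). destruct n as [|n].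
- simpl. rewrite Cmult_0_l, Cmod_0. lra.
- rewrite Cmod_mult, Cmod_R, Rabs_pos_eq, Cmod_pow by apply pos_INR. simpl pred.
  eapply Rle_trans; [|apply INR_pow_bound; lra]. apply Rmult_le_compat_l; [apply pos_INR|].
    apply pow_incr; lra.
Qed.

(** The remainder of [z ^ n] is dominated on [|z| <= r] by [2 (r + 1) ^ n |w - z|]. *)
Lemma holo_Cpseries c z : entire c -> holo (Cpseries c) z (Cpseries (PS_derive c) z).
Proof.
intros Hc. apply holo_eps. intros eps.
set (r := (Cmod z + 1)%R). assert (Hz0 := Cmod_ge_0 z).
pose (M := fun n => (2 * (Rabs (c n) * (r + 1) ^ n))%R).
assert (HM : ex_series M).
{ apply (ex_series_scal_R 2%R). apply Hc. unfold r. lra. }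
assert (Near : locally (T := C_UniformSpace) z (fun w => Cmod w <= r)%R).
{ apply locally_C_eps. exists (mkposreal 1 Rlt_0_1). simpl. intros w Hw.
  replace w with (z + (w - z)) by ring. eapply Rle_trans; [apply Cmod_triangle|]. unfold r. lra. }
pose (a := fun n w => RtoC (c n) * (w ^ n - z ^ n - RtoC (INR n) * z ^ pred n * (w - z))).
assert (K : locally (T := C_UniformSpace) z (fun w => Cmod (Cseries (fun n => a n w)) <= eps * Cmod
  (w - z))%R).
{ apply (Cseries_little_o (T := C) (locally (T := C_UniformSpace) z) (fun w => Cmod (w - z)) a M).
  - exact HM.
  - apply filter_forall. intros; apply Cmod_ge_0.
  - revert Near. apply filter_imp. intros w Hw n. unfold a, M. rewrite Cmod_mult, Cmod_R.
    replace (2 * (Rabs (c n) * (r + 1) ^ n) * Cmod (w - z))%R with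
      (Rabs (c n) * (2 * (r + 1) ^ n * Cmod (w - z)))%R by ring.
    apply Rmult_le_compat_l; [apply Rabs_pos|].
    unfold Cminus at 1. eapply Rle_trans; [apply Cmod_triangle|]. rewrite Cmod_opp,
      (Cmod_mult _ (w - z)).
    assert (P1 := Cpow_lipschitz r z w n ltac:(unfold r; lra) Hw).
    assert (P2 := Cpow_derive_bound r z n ltac:(unfold r; lra)).
    apply (Rmult_le_compat_r (Cmod (w - z))) in P2; [|apply Cmod_ge_0]. lra.
  - intros n e. assert (H := holo_mult _ _ _ _ _ (holo_const (RtoC (c n)) z) (holo_pow n z)).
    apply holo_eps with (eps := e) in H. revert H. apply filter_imp. intros w Hw. eapply Rle_trans;
      [|exact Hw].
    right. f_equal. unfold a. ring. }
revert K. apply filter_imp. intros w Hw. eapply Rle_trans; [|exact Hw]. right. f_equal.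
assert (S1 := entire_summable c w Hc). assert (S2 := entire_summable c z Hc).
assert (S3 := entire_summable _ z (entire_PS_derive _ Hc)).
assert (S4 : csummable (fun n => RtoC (c n) * (RtoC (INR n) * z ^ pred n))).
{ apply (ex_series_incr_1 (fun n => Cmod (RtoC (c n) * (RtoC (INR n) * z ^ pred n)))).
  revert S3. apply ex_series_ext. intros n. f_equal. unfold PS_derive. rewrite RtoC_mult.
    simpl pred. ring. }
assert (E3 : Cpseries (PS_derive c) z = Cseries
  (fun n => RtoC (c n) * (RtoC (INR n) * z ^ pred n))).
{ rewrite (Cseries_incr_1 (fun n => RtoC (c n) * (RtoC (INR n) * z ^ pred n))) by assumption.
  unfold Cpseries. rewrite (Cseries_ext _ (fun n => RtoC
    (c (S n)) * (RtoC (INR (S n)) * z ^ pred (S n)))).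
  - simpl. ring.
  - intros n. unfold PS_derive. rewrite RtoC_mult. simpl pred. ring. }
rewrite E3. unfold Cpseries, a.
rewrite (Cseries_ext (fun n => RtoC (c n) * (w ^ n - z ^ n - RtoC (INR n) * z ^ pred n * (w - z)))
  (fun n => RtoC (c n) * w ^ n + (- (1) * (RtoC (c n) * z ^ n) + - (w - z) *
  (RtoC (c n) * (RtoC (INR n) * z ^ pred n))))) by (intros; ring).
rewrite Cseries_plus, Cseries_plus, !Cseries_scal; auto using csummable_scal, csummable_plus. ring.
Qed.

Lemma Cpow_conj z n : Cconj (z ^ n) = (Cconj z) ^ n.
Proof. induction n as [|n IH]; simpl; [apply Ceq; simpl; ring|]. now rewrite Cmult_conj, IH. Qed.

Lemma Cpseries_conj c z : Cconj (Cpseries c z) = Cpseries c (Cconj z).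
Proof.
unfold Cpseries. rewrite Cseries_conj. apply Cseries_ext. intros n. rewrite Cmult_conj, Cpow_conj.
  f_equal. apply Ceq; simpl; ring.
Qed.

Lemma Cpseries_0 c : entire c -> Cpseries c 0 = RtoC (c O).
Proof.
intros H. unfold Cpseries. rewrite Cseries_incr_1 by now apply entire_summable.
rewrite (Cseries_ext _ (fun n => 0 * (RtoC (c (S n)) * 1 ^ S n))).
- rewrite Cseries_scal; [simpl; ring|]. apply (ex_series_incr_1
    (fun n => Cmod (RtoC (c n) * 1 ^ n))). now apply entire_summable.
- intros n. simpl. ring.
Qed.

(** * The integral theorem on a rectangle *)

Local Open Scope R_scope.

(** Nested rectangles: were the property false, it would fail on a sequence of rectangles, each a
    quarter of the previous one, shrinking to a point where it holds by hypothesis. *)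
Lemma bisection_principle (W H : R) (Pr : nat -> R -> R -> Prop) (s0 t0 : R) :
  0 <= W -> 0 <= H ->
  (forall n s t,
     let w := W / 2 ^ S n in let h := H / 2 ^ S n in
     Pr (S n) s t -> Pr (S n) (s + w) t -> Pr (S n) s (t + h) -> Pr (S n) (s + w) (t + h) ->
     Pr n s t) ->
  (forall u v, s0 <= u <= s0 + W -> t0 <= v <= t0 + H ->
     exists N, forall n s t, (N <= n)%nat ->
       s0 <= s -> s + W / 2 ^ n <= s0 + W -> t0 <= t -> t + H / 2 ^ n <= t0 + H ->
       s <= u <= s + W / 2 ^ n -> t <= v <= t + H / 2 ^ n -> Pr n s t) ->
  Pr 0%nat s0 t0.
Proof.
intros HW HH Hsplit Hloc. apply NNPP. intros H0.
assert (P2 : forall n, 0 < 2 ^ n) by (intros; apply pow_lt; lra).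
assert (Hhalf : forall X n, X / 2 ^ n = X / 2 ^ S n + X / 2 ^ S n)
  by (intros X n; simpl; field; apply Rgt_not_eq, P2).
assert (Hpos : forall X n, 0 <= X -> 0 <= X / 2 ^ n)
  by (intros X n HX; apply Rdiv_le_0_compat; [assumption|apply P2]).
assert (step : forall n (p : R * R), ~ Pr n (fst p) (snd p) ->
  exists q : R * R, ~ Pr (S n) (fst q) (snd q) /\
    (fst p <= fst q /\ fst q + W / 2 ^ S n <= fst p + W / 2 ^ n) /\
    (snd p <= snd q /\ snd q + H / 2 ^ S n <= snd p + H / 2 ^ n)).
{ intros n [s t] Hp. simpl in Hp. apply NNPP. intros Hq. apply Hp.
  generalize (Hhalf W n) (Hhalf H n) (Hpos W (S n) HW) (Hpos H (S n) HH).
  intros E1 E2 E3 E4.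
  apply Hsplit; apply NNPP; intros K; apply Hq.
  - exists (s, t); split; [exact K|]. cbn [fst snd]. lra.
  - exists (s + W / 2 ^ S n, t); split; [exact K|]. cbn [fst snd]. lra.
  - exists (s, t + H / 2 ^ S n); split; [exact K|]. cbn [fst snd]. lra.
  - exists (s + W / 2 ^ S n, t + H / 2 ^ S n); split; [exact K|]. cbn [fst snd]. lra. }
pose (nxt := fun n (p : {p : R * R | ~ Pr n (fst p) (snd p)}) =>
  constructive_indefinite_description _ (step n (proj1_sig p) (proj2_sig p))).
pose (sq := fix sq n : {p : R * R | ~ Pr n (fst p) (snd p)} :=
  match n with
  | O => exist _ (s0, t0) H0
  | S k => exist _ (proj1_sig (nxt k (sq k))) (proj1 (proj2_sig (nxt k (sq k))))
  end).
assert (Hs : forall n, let p := proj1_sig (sq n) in let q := proj1_sig (sq (S n)) in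
    (fst p <= fst q /\ fst q + W / 2 ^ S n <= fst p + W / 2 ^ n) /\
    (snd p <= snd q /\ snd q + H / 2 ^ S n <= snd p + H / 2 ^ n)).
{ intros n. exact (proj2 (proj2_sig (nxt n (sq n)))). }
assert (lim : forall (X x0 : R) (x : nat -> R), 0 <= X -> x 0%nat = x0 ->
   (forall n, x n <= x (S n) /\ x (S n) + X / 2 ^ S n <= x n + X / 2 ^ n) ->
   (forall n, x0 <= x n /\ x n + X / 2 ^ n <= x0 + X) /\
   exists u, forall n, x n <= u <= x n + X / 2 ^ n).
{ intros X x0 x HX Hx0 Hx.
  assert (Hmon : forall n k, x n <= x (n + k)%nat /\
    x (n + k)%nat + X / 2 ^ (n + k) <= x n + X / 2 ^ n).
  { intros n k. induction k as [|k IH]; [rewrite Nat.add_0_r; lra|]. rewrite Nat.add_succ_r.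
      generalize (Hx (n + k)%nat). lra. }
  assert (Hin : forall n, x0 <= x n /\ x n + X / 2 ^ n <= x0 + X).
  { intros n. generalize (Hmon 0%nat n). simpl. rewrite Hx0. lra. }
  split; [exact Hin|].
  destruct (ex_finite_lim_seq_incr x (x0 + X)) as [u Hu].
  - intros n; apply Hx.
  - intros n. generalize (Hin n) (Hpos X n HX). lra.
  - exists u. intros n. split.
    + apply (is_lim_seq_incr_compare x u Hu). intros m; apply Hx.
    + assert (L : Rbar_le u (x n + X / 2 ^ n)).
      { apply (is_lim_seq_le_loc x (fun _ => x n + X / 2 ^ n) u (x n + X / 2 ^ n));
          [|exact Hu|apply is_lim_seq_const].
        exists n. intros m Hm. replace m with (n + (m - n))%nat by lia.
        generalize (Hmon n (m - n)%nat) (Hpos X (n + (m - n))%nat HX). lra. }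
      exact L. }
destruct (lim W s0 (fun n => fst (proj1_sig (sq n))) HW eq_refl (fun n => proj1 (Hs n)))
  as [In1 [u Hu]].
destruct (lim H t0 (fun n => snd (proj1_sig (sq n))) HH eq_refl (fun n => proj2 (Hs n)))
  as [In2 [v Hv]].
destruct (Hloc u v) as [N HN].
- generalize (Hu 0%nat). simpl. lra.
- generalize (Hv 0%nat). simpl. lra.
- apply (proj2_sig (sq N)). apply HN; auto; try apply In1; try apply In2.
Qed.

Lemma RInt_diff_approx (f g : R -> R) (a b k E : R) :
  a <= b -> (forall t, continuous f t) -> (forall t, continuous g t) ->
  (forall t, a <= t <= b -> Rabs (f t - g t - k) <= E) ->
  Rabs (RInt f a b - RInt g a b - k * (b - a)) <= E * (b - a).
Proof.
intros Hab Cf Cg HE.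
assert (If : ex_RInt f a b) by (apply (ex_RInt_continuous (V := R_CompleteNormedModule)); auto).
assert (Ig : ex_RInt g a b) by (apply (ex_RInt_continuous (V := R_CompleteNormedModule)); auto).
assert (Ik : ex_RInt (fun _ : R => k) a b) by apply (ex_RInt_const (V := R_CompleteNormedModule)).
assert (Ifg : ex_RInt (fun t => minus (f t) (g t)) a b)
  by (apply (ex_RInt_minus (V := R_CompleteNormedModule)); assumption).
rewrite (Rmult_comm E).
replace (RInt f a b - RInt g a b - k * (b - a)) with
  (RInt (fun t => minus (minus (f t) (g t)) k) a b).
- apply abs_RInt_le_const; [assumption| |exact HE].
  apply (ex_RInt_minus (V := R_CompleteNormedModule)); assumption.
- rewrite (RInt_minus (V := R_CompleteNormedModule)) by assumption.
  rewrite (RInt_minus (V := R_CompleteNormedModule)) by assumption.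
  rewrite (RInt_const (V := R_CompleteNormedModule)).
  unfold minus, plus, opp, scal; simpl; unfold mult; simpl. ring.
Qed.

(** Green's formula for the form [Q ds + P dt] without continuity of the partial derivatives.  On a
    small rectangle the linear parts cancel because the [s]-derivative of [P] is the [t]-derivative
    of [Q], and the remainders contribute [o(size ^ 2)]; this is what bisection needs. *)
Lemma goursat_green (P Q : R -> R -> R) (s1 s2 t1 t2 : R) :
  s1 <= s2 -> t1 <= t2 ->
  (forall s t, continuous (P s) t) -> (forall s t, continuous (fun s => Q s t) s) ->
  (forall s t, s1 <= s <= s2 -> t1 <= t <= t2 ->
     exists a b c, differentiable_pt_lim P s t a b /\ differentiable_pt_lim Q s t c a) ->
  RInt (fun s => Q s t1) s1 s2 - RInt (fun s => Q s t2) s1 s2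
  + RInt (P s2) t1 t2 - RInt (P s1) t1 t2 = 0.
Proof.
intros Hs Ht CP CQ Hd.
set (W := s2 - s1). set (H := t2 - t1).
assert (HW : 0 <= W) by (unfold W; lra). assert (HH : 0 <= H) by (unfold H; lra).
assert (P2 : forall n, 0 < 2 ^ n) by (intros; apply pow_lt; lra).
pose (circ := fun s s' t t' => RInt (fun s => Q s t) s s' - RInt (fun s => Q s t') s s'
  + RInt (P s') t t' - RInt (P s) t t').
change (circ s1 s2 t1 t2 = 0).
assert (IP : forall s a b, ex_RInt (P s) a b) by
  (intros; apply (ex_RInt_continuous (V := R_CompleteNormedModule)); auto).
assert (IQ : forall t a b, ex_RInt (fun s => Q s t) a b)
  by (intros; apply (ex_RInt_continuous (V := R_CompleteNormedModule)); auto).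
assert (ChP : forall s a b c, RInt (P s) a c = RInt (P s) a b + RInt (P s) b c).
{ intros. symmetry. apply (RInt_Chasles (V := R_CompleteNormedModule)); auto. }
assert (ChQ : forall t a b c, RInt (fun s => Q s t) a c = RInt (fun s => Q s t) a b + RInt
  (fun s => Q s t) b c).
{ intros. symmetry. apply (RInt_Chasles (V := R_CompleteNormedModule)); auto. }
assert (Hall : forall eps, 0 < eps -> Rabs (circ s1 s2 t1 t2) <= eps).
{ intros eps Heps.
  pose (Pr := fun n s t => Rabs (circ s (s + W / 2 ^ n) t (t + H / 2 ^ n)) <= eps / 4 ^ n).
  assert (K : Pr 0%nat s1 t1).
  2:{ unfold Pr in K. simpl in K. unfold W, H in K.
      replace (s1 + (s2 - s1) / 1) with s2 in K by field.
      replace (t1 + (t2 - t1) / 1) with t2 in K by field. lra. }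
  apply (bisection_principle W H); auto.
  - intros n s t w h Q1 Q2 Q3 Q4. unfold Pr in *. fold w h in Q1, Q2, Q3, Q4.
    replace (s + W / 2 ^ n) with (s + w + w) by (unfold w; simpl; field; apply Rgt_not_eq, P2).
    replace (t + H / 2 ^ n) with (t + h + h) by (unfold h; simpl; field; apply Rgt_not_eq, P2).
    replace (circ s (s + w + w) t (t + h + h)) with
      (circ s (s + w) t (t + h) + circ (s + w) (s + w + w) t (t + h) +
       (circ s (s + w) (t + h) (t + h + h) + circ (s + w) (s + w + w) (t + h) (t + h + h))).
    2:{ unfold circ. rewrite (ChQ t s (s + w) (s + w + w)), (ChQ (t + h + h) s (s + w) (s + w + w)).
        rewrite (ChP s t (t + h) (t + h + h)), (ChP (s + w + w) t (t + h) (t + h + h)). ring. }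
    replace (eps / 4 ^ n) with (eps / 4 ^ S n + eps / 4 ^ S n + (eps / 4 ^ S n + eps / 4 ^ S n))
      by (simpl; field; apply pow_nonzero; lra).
    eapply Rle_trans; [apply Rabs_triang|]. apply Rplus_le_compat;
      (eapply Rle_trans; [apply Rabs_triang|]; lra).
  - intros u v Hu Hv.
    destruct (Hd u v) as [a [b [c [DP DQ]]]]; [unfold W in Hu; lra|unfold H in Hv; lra|].
    (* summed over [4 ^ n] rectangles of half-perimeter [(W + H) / 2 ^ n] this stays below [eps] *)
    set (e' := eps / (2 * (W + H + 1) ^ 2)).
    assert (Hz : 0 < (W + H + 1) ^ 2) by (apply pow_lt; lra).
    assert (He' : 0 < e') by (apply Rdiv_lt_0_compat; lra).
    destruct (locally_2d_and _ _ _ _ (DP (mkposreal _ He')) (DQ (mkposreal _ He'))) as [d Hd'].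
    assert (HN : exists N, forall n, (N <= n)%nat -> (W + H) / 2 ^ n < d).
    { assert (L : is_lim_seq (fun n => (W + H) * (/ 2) ^ n) 0).
      { replace (Finite 0) with (Rbar_mult (W + H) 0) by (simpl; f_equal; ring).
        apply is_lim_seq_scal_l. apply is_lim_seq_geom. rewrite Rabs_pos_eq; lra. }
      apply is_lim_seq_spec in L. destruct (L d) as [N HN]. exists N. intros n Hn.
      generalize (HN n Hn). rewrite Rminus_0_r, pow_inv. intros K.
      eapply Rle_lt_trans; [apply Rle_abs|exact K]. }
    destruct HN as [N HN]. exists N. intros n s t Hn _ _ _ _ Hsu Htv.
    specialize (HN n Hn). set (w := W / 2 ^ n) in *. set (h := H / 2 ^ n) in *.
    assert (Hwh : (W + H) / 2 ^ n = w + h) by (unfold w, h; field; apply Rgt_not_eq, P2).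
    assert (Hw : 0 <= w) by (apply Rdiv_le_0_compat; auto).
    assert (Hh : 0 <= h) by (apply Rdiv_le_0_compat; auto).
    assert (Hin : forall x y, s <= x <= s + w -> t <= y <= t + h ->
      Rabs (P x y - P u v - (a * (x - u) + b * (y - v))) <= e' * (w + h) /\
      Rabs (Q x y - Q u v - (c * (x - u) + a * (y - v))) <= e' * (w + h)).
    { intros x y Hx Hy.
      assert (Rabs (x - u) <= w) by (apply Rabs_le; lra).
      assert (Rabs (y - v) <= h) by (apply Rabs_le; lra).
      destruct (Hd' x y) as [D1 D2]; try lra.
      assert (e' * Rmax (Rabs (x - u)) (Rabs (y - v)) <= e' * (w + h)).
      { apply Rmult_le_compat_l; [lra|]. apply Rmax_lub; lra. }
      simpl in D1, D2. lra. }
    assert (B1 : Rabs (RInt (fun x => Q x t) s (s + w) - RInt (fun x => Q x (t + h)) s (s + w)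
                 - (- (a * h)) * (s + w - s)) <= (2 * (e' * (w + h))) * (s + w - s)).
    { apply RInt_diff_approx; auto; [lra|]. intros x Hx.
      destruct (Hin x t) as [_ D1]; try lra. destruct (Hin x (t + h)) as [_ D2]; try lra.
      apply Rabs_le_between in D1. apply Rabs_le_between in D2. apply Rabs_le_between. lra. }
    assert (B2 : Rabs (RInt (P (s + w)) t (t + h) - RInt (P s) t (t + h)
                 - (a * w) * (t + h - t)) <= (2 * (e' * (w + h))) * (t + h - t)).
    { apply RInt_diff_approx; auto; [lra|]. intros x Hx.
      destruct (Hin s x) as [D1 _]; try lra. destruct (Hin (s + w) x) as [D2 _]; try lra.
      apply Rabs_le_between in D1. apply Rabs_le_between in D2. apply Rabs_le_between. lra. }
    unfold Pr. fold w h. unfold circ.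
    apply Rle_trans with (2 * e' * (w + h) ^ 2).
    + apply Rabs_le_between in B1. apply Rabs_le_between in B2. apply Rabs_le_between. nra.
    + rewrite <- Hwh. unfold e'.
      replace (2 * (eps / (2 * (W + H + 1) ^ 2)) * ((W + H) / 2 ^ n) ^ 2) with
        (eps / 4 ^ n * ((W + H) ^ 2 / (W + H + 1) ^ 2)).
      * assert (0 < eps / 4 ^ n) by (apply Rdiv_lt_0_compat; [lra|apply pow_lt; lra]).
        rewrite <- (Rmult_1_r (eps / 4 ^ n)) at 2. apply Rmult_le_compat_l; [lra|].
        apply Rmult_le_reg_r with ((W + H + 1) ^ 2); [assumption|].
        unfold Rdiv. rewrite Rmult_assoc, Rinv_l by lra. nra.
      * replace (4 ^ n) with (2 ^ n * 2 ^ n) by (rewrite <- Rpow_mult_distr; f_equal; lra).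
        field. split; [apply Rgt_not_eq, P2|lra]. }
destruct (Req_dec (circ s1 s2 t1 t2) 0) as [E|E]; [exact E|].
assert (0 < Rabs (circ s1 s2 t1 t2)) by now apply Rabs_pos_lt.
specialize (Hall (Rabs (circ s1 s2 t1 t2) / 2)). lra.
Qed.

(** * Means of an analytic function over circles *)

(** The epsilon form of [continuous_on] (see [continuous_on_cont_on]), convenient for products. *)
Definition cont_on (D : C -> Prop) (h : C -> C) : Prop :=
  forall z, D z -> forall eps : posreal, exists d : posreal,
    forall w, D w -> Cmod (w - z) < d -> Cmod (h w - h z) < eps.

Definition analytic_on (U D : C -> Prop) (h : C -> C) : Prop :=
  cont_on D h /\ forall z, U z -> exists l, holo h z l.

Lemma differentiable_mult (x y : R) : differentiable_pt_lim Rmult x y y x.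
Proof.
intros eps. exists eps. intros u v Hu Hv.
replace (u * v - x * y - (y * (u - x) + x * (v - y))) with ((u - x) * (v - y)) by ring.
rewrite Rabs_mult. apply Rmult_le_compat; try apply Rabs_pos; [lra|apply Rmax_r].
Qed.

Lemma differentiable_polar (f g : R -> R) (s t f' g' : R) :
  is_derive f s f' -> is_derive g t g' ->
  differentiable_pt_lim (fun u v => f u * g v) s t (f' * g t) (f s * g').
Proof.
intros Hf Hg.
replace (f' * g t) with (g t * f' + f s * 0) by ring.
replace (f s * g') with (g t * 0 + f s * g') by ring.
apply (differentiable_pt_lim_comp Rmult (fun u _ => f u) (fun _ v => g v)).
- apply differentiable_mult.
- apply differentiable_pt_lim_proj1_0. now apply is_derive_Reals.
- intros eps. apply is_derive_Reals in Hg.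
  destruct (differentiable_pt_lim_proj1_0 g t s g' Hg eps) as [d Hd]. exists d. intros u v Hu Hv.
  specialize (Hd v u Hv Hu). rewrite Rmax_comm.
  replace (0 * (u - s) + g' * (v - t)) with (g' * (v - t) + 0 * (u - s)) by ring. exact Hd.
Qed.

Lemma holo_differentiable (h : C -> C) (x y : R) (l : C) : holo h (x, y) l ->
  differentiable_pt_lim (fun u v => Re (h (u, v))) x y (Re l) (- Im l) /\
  differentiable_pt_lim (fun u v => Im (h (u, v))) x y (Im l) (Re l).
Proof.
intros H.
assert (K : forall eps : posreal, locally_2d (fun u v =>
  Cmod (h (u, v) - h (x, y) - l * ((u, v) - (x, y))) <= eps * Rmax (Rabs (u - x)) (Rabs (v - y))) x
    y).
{ intros eps. assert (He : 0 < eps / 2) by (generalize (cond_pos eps); lra).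
  apply holo_eps with (eps := mkposreal _ He) in H. apply locally_2d_locally. revert H.
    apply filter_imp.
  intros [u v] Hw. simpl fst; simpl snd. eapply Rle_trans; [exact Hw|]. simpl pos.
  assert (L := Cmod_le_Re_Im ((u, v) - (x, y))%C).
  change (Re ((u, v) - (x, y))%C) with (u - x) in L. change (Im ((u, v) - (x, y))%C) with
    (v - y) in L.
  generalize (Rmax_l (Rabs (u - x)) (Rabs (v - y))) (Rmax_r (Rabs (u - x)) (Rabs (v - y))). nra. }
split; intros eps; generalize (K eps); apply locally_2d_impl; apply locally_2d_forall;
  intros u v Huv;
  (eapply Rle_trans; [|exact Huv]).
- replace (Re (h (u, v)) - Re (h (x, y)) - (Re l * (u - x) + - Im l * (v - y))) with
    (Re (h (u, v) - h (x, y) - l * ((u, v) - (x, y)))%C); [apply re_le_Cmod|].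
  destruct (h (u, v)), (h (x, y)), l; simpl; ring.
- replace (Im (h (u, v)) - Im (h (x, y)) - (Im l * (u - x) + Re l * (v - y))) with
    (Im (h (u, v) - h (x, y) - l * ((u, v) - (x, y)))%C); [apply im_le_Cmod|].
  destruct (h (u, v)), (h (x, y)), l; simpl; ring.
Qed.

Lemma Cmod_circle_pt (r t : R) : 0 <= r -> Cmod (circle_pt r t) = r.
Proof.
intros Hr. unfold Cmod, circle_pt. cbn [fst snd].
replace ((r * cos t) ^ 2 + (r * sin t) ^ 2) with (r ^ 2 * ((sin t)² + (cos t)²))
  by (unfold Rsqr; ring).
rewrite sin2_cos2, Rmult_1_r. apply sqrt_pow2; assumption.
Qed.

Lemma continuity_2d_pt_slice_r (P : R -> R -> R) s t : continuity_2d_pt P s t -> continuous (P s) t.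
Proof.
intros H. apply continuity_pt_filterlim. intros e He. destruct (H (mkposreal e He)) as [d Hd].
exists d. split; [apply cond_pos|]. intros u [_ Hu]. apply Hd;
  [rewrite Rminus_eq_0, Rabs_R0; apply cond_pos|exact Hu].
Qed.

Lemma continuity_2d_pt_slice_l (P : R -> R -> R) s t : continuity_2d_pt P s t ->
  continuous (fun u => P u t) s.
Proof.
intros H. apply continuity_pt_filterlim. intros e He. destruct (H (mkposreal e He)) as [d Hd].
exists d. split; [apply cond_pos|]. intros u [_ Hu]. apply Hd;
  [exact Hu|rewrite Rminus_eq_0, Rabs_R0; apply cond_pos].
Qed.

(** In the coordinates [z = exp (s + i t)] the real and imaginary parts of [h] satisfy the
    hypothesis of [goursat_green], and the two sides [t = 0] and [t = 2 pi] of the rectangle cancel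
    by periodicity.  Analyticity is known only in the open annulus; the boundary circles are reached
    by continuity. *)
Lemma circle_integral_Re_annulus (h : C -> C) (r1 r2 : R) : 0 < r1 -> r1 <= r2 ->
  analytic_on (fun z => r1 < Cmod z < r2) (fun z => r1 <= Cmod z <= r2) h ->
  RInt (fun t => Re (h (circle_pt r1 t))) 0 (2 * PI) = RInt (fun t => Re (h (circle_pt r2 t))) 0
    (2 * PI).
Proof.
intros H1 H12 [Hc Hh].
destruct H12 as [H12|<-]; [|reflexivity].
assert (Hln : ln r1 < ln r2) by (apply ln_increasing; lra).
(* the clamped radius makes the integrand continuous on the whole plane *)
pose (cl := fun s => Rmax (ln r1) (Rmin s (ln r2))).
assert (Hcl : forall s, ln r1 <= cl s <= ln r2).
{ intros s. unfold cl. split; [apply Rmax_l|]. apply Rmax_lub; [lra|apply Rmin_r]. }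
assert (Hcl' : forall s, ln r1 <= s <= ln r2 -> cl s = s).
{ intros s Hs. unfold cl. rewrite Rmin_left by lra. apply Rmax_right; lra. }
assert (Hexp : forall s, r1 <= exp (cl s) <= r2).
{ intros s. destruct (Hcl s) as [A B]. rewrite <- (exp_ln r1) at 1 by lra. rewrite <- (exp_ln r2)
    by lra.
  split; [destruct A as [A| <-]|destruct B as [B| ->]]; try (left; apply exp_increasing; lra); lra.
    }
pose (g := fun s t => h (circle_pt (exp (cl s)) t)).
assert (Ccl : forall s, continuity_pt (fun s => exp (cl s)) s).
{ intros s. apply (continuity_pt_comp cl exp); [|apply derivable_continuous_pt, derivable_pt_exp].
  intros e He. exists e. split; [exact He|]. intros u [_ Hu]. unfold dist in *; simpl in *.
    unfold R_dist in *.
  eapply Rle_lt_trans; [|exact Hu]. unfold cl, Rmax, Rmin.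
  repeat destruct Rle_dec; unfold Rabs; repeat destruct Rcase_abs; lra. }
assert (C2 : forall s t, forall eps : posreal,
  locally_2d (fun u v => Cmod (g u v - g s t) < eps) s t).
{ intros s t eps.
  destruct (Hc (circle_pt (exp (cl s)) t)) with (eps := eps) as [d Hd].
  { rewrite Cmod_circle_pt; [apply Hexp|left; apply exp_pos]. }
  assert (Hd2 : 0 < d / 2) by (generalize (cond_pos d); lra).
  assert (K1 : continuity_2d_pt (fun u v => exp (cl u) * cos v) s t).
  { apply continuity_2d_pt_mult.
    - apply (continuity_1d_2d_pt_comp (fun s => exp (cl s)) (fun u _ => u));
        [apply Ccl|apply continuity_2d_pt_id1].
    - apply (continuity_1d_2d_pt_comp cos (fun _ v => v));
        [apply continuity_cos|apply continuity_2d_pt_id2]. }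
  assert (K2 : continuity_2d_pt (fun u v => exp (cl u) * sin v) s t).
  { apply continuity_2d_pt_mult.
    - apply (continuity_1d_2d_pt_comp (fun s => exp (cl s)) (fun u _ => u));
        [apply Ccl|apply continuity_2d_pt_id1].
    - apply (continuity_1d_2d_pt_comp sin (fun _ v => v));
        [apply continuity_sin|apply continuity_2d_pt_id2]. }
  generalize (locally_2d_and _ _ _ _ (K1 (mkposreal _ Hd2)) (K2 (mkposreal _ Hd2))).
  apply locally_2d_impl, locally_2d_forall. simpl. intros u v [L1 L2]. apply Hd.
  - rewrite Cmod_circle_pt; [apply Hexp|left; apply exp_pos].
  - eapply Rle_lt_trans; [apply Cmod_le_Re_Im|]. unfold circle_pt. simpl. unfold Rminus in L1, L2.
      lra. }
pose (P := fun s t => Re (g s t)). pose (Q := fun s t => Im (g s t)).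
assert (CP : forall s t, continuity_2d_pt P s t).
{ intros s t eps. generalize (C2 s t eps). apply locally_2d_impl, locally_2d_forall. intros u v L.
  eapply Rle_lt_trans; [|exact L]. apply (re_le_Cmod (g u v - g s t)). }
assert (CQ : forall s t, continuity_2d_pt Q s t).
{ intros s t eps. generalize (C2 s t eps). apply locally_2d_impl, locally_2d_forall. intros u v L.
  eapply Rle_lt_trans; [|exact L]. apply (im_le_Cmod (g u v - g s t)). }
pose (I := fun s => RInt (P s) 0 (2 * PI)).
assert (HPI := PI_RGT_0).
assert (Icst : forall a b, ln r1 < a -> a <= b -> b < ln r2 -> I a = I b).
{ intros a b Ha Hab Hb.
  assert (G := goursat_green P Q a b 0 (2 * PI)).
  assert (EQ : RInt (fun s => Q s (2 * PI)) a b = RInt (fun s => Q s 0) a b).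
  { apply RInt_ext. intros x _. unfold Q, g, circle_pt. rewrite cos_2PI, sin_2PI, cos_0, sin_0.
      reflexivity. }
  rewrite EQ in G. fold (I a) (I b) in G.
  enough (RInt (fun s => Q s 0) a b - RInt (fun s => Q s 0) a b + I b - I a = 0) by lra.
  apply G; try lra.
  - intros s t. apply continuity_2d_pt_slice_r, CP.
  - intros s t. apply (continuity_2d_pt_slice_l Q), CQ.
  - clear G EQ. intros s t Hs _.
    destruct (Hh (circle_pt (exp s) t)) as [l Hl].
    { rewrite Cmod_circle_pt; [|left; apply exp_pos].
      rewrite <- (exp_ln r1) at 1 by lra. rewrite <- (exp_ln r2) by lra. split;
        apply exp_increasing; lra. }
    apply holo_differentiable in Hl. destruct Hl as [D1 D2].
    assert (E1 := differentiable_polar exp cos s t (exp s) (- sin t)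
      ltac:(apply is_derive_Reals, derivable_pt_lim_exp)
        ltac:(apply is_derive_Reals, derivable_pt_lim_cos)).
    assert (E2 := differentiable_polar exp sin s t (exp s) (cos t)
      ltac:(apply is_derive_Reals, derivable_pt_lim_exp)
        ltac:(apply is_derive_Reals, derivable_pt_lim_sin)).
    assert (F1 := differentiable_pt_lim_comp _ _ _ _ _ _ _ _ _ _ _ D1 E1 E2).
    assert (F2 := differentiable_pt_lim_comp _ _ _ _ _ _ _ _ _ _ _ D2 E1 E2).
    assert (Hm : 0 < Rmin (s - ln r1) (ln r2 - s)) by (apply Rmin_pos; lra).
    assert (near : locally_2d (fun u v => cl u = u) s t).
    { exists (mkposreal _ Hm). simpl. intros u v Hu _. apply Hcl'.
      generalize (Rmin_l (s - ln r1) (ln r2 - s)) (Rmin_r (s - ln r1) (ln r2 - s)).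
      apply Rabs_lt_between in Hu. lra. }
    do 3 eexists. split.
    + eapply differentiable_pt_lim_ext; [|exact F1]. revert near. apply locally_2d_impl,
        locally_2d_forall.
      intros u v E. unfold P, g, circle_pt. rewrite E. reflexivity.
    + replace (Re l * (exp s * cos t) + - Im l * (exp s * sin t)) with
        (Im l * (exp s * - sin t) + Re l * (exp s * cos t)) by ring.
      eapply differentiable_pt_lim_ext; [|exact F2]. revert near. apply locally_2d_impl,
        locally_2d_forall.
      intros u v E. unfold Q, g, circle_pt. rewrite E. reflexivity. }
assert (Icont : forall c (eps : posreal), exists d : posreal, forall s, Rabs (s - c) < d ->
  Rabs (I s - I c) <= eps * (2 * PI)).
{ intros c eps.
  destruct (uniform_continuity_2d_1d' P 0 (2 * PI) c (fun x _ => CP c x) eps) as [d Hd].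
  exists d. intros s Hs.
  assert (K := RInt_diff_approx (P s) (P c) 0 (2 * PI) 0 eps).
  replace (RInt (P s) 0 (2 * PI) - RInt (P c) 0 (2 * PI) - 0 * (2 * PI - 0)) with (I s - I c) in K
    by (unfold I; ring).
  rewrite Rminus_0_r in K. apply K; [lra| | |].
  - intros t; apply continuity_2d_pt_slice_r, CP.
  - intros t; apply continuity_2d_pt_slice_r, CP.
  - intros t Ht. rewrite Rminus_0_r. left. apply Rabs_lt_between in Hs. assert (Hp := cond_pos d).
    apply Hd; try lra. rewrite Rminus_eq_0, Rabs_R0. apply cond_pos. }
pose (m := (ln r1 + ln r2) / 2).
assert (End : forall c, ln r1 <= c <= ln r2 -> I c = I m).
{ intros c Hcc.
  destruct (Req_dec (I c) (I m)) as [E|E]; [exact E|exfalso].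
  assert (Hp : 0 < Rabs (I c - I m)) by (apply Rabs_pos_lt; lra).
  assert (He : 0 < Rabs (I c - I m) / (4 * PI)) by (apply Rdiv_lt_0_compat; lra).
  destruct (Icont c (mkposreal _ He)) as [d Hd]. simpl in Hd.
  pose (e := Rmin (d / 2) ((ln r2 - ln r1) / 4)).
  assert (0 < e) by (apply Rmin_pos; generalize (cond_pos d); lra).
  assert (e <= d / 2) by apply Rmin_l. assert (e <= (ln r2 - ln r1) / 4) by apply Rmin_r.
  assert (Hs : exists s, ln r1 < s < ln r2 /\ Rabs (s - c) < d).
  { destruct (Rle_dec c m) as [L|L]; [exists (c + e)|exists (c - e)]; unfold m in L; split; try lra;
    apply Rabs_lt_between; lra. }
  destruct Hs as [s [Hs1 Hs2]]. specialize (Hd s Hs2).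
  replace (Rabs (I c - I m) / (4 * PI) * (2 * PI)) with (Rabs (I c - I m) / 2) in Hd
    by (field; lra).
  assert (Esm : I s = I m).
  { destruct (Rle_dec s m) as [L|L]; [apply Icst|symmetry; apply Icst]; unfold m in *; lra. }
  rewrite Esm, Rabs_minus_sym in Hd. lra. }
assert (EI : forall r, r1 <= r <= r2 -> RInt (fun t => Re (h (circle_pt r t))) 0 (2 * PI) = I
  (ln r)).
{ intros r Hr. unfold I. apply RInt_ext. intros x _. unfold P, g. rewrite Hcl', exp_ln;
    [reflexivity|lra|].
  split; apply ln_le; lra. }
rewrite !EI by lra. rewrite (End (ln r1)), (End (ln r2)) by lra. reflexivity.
Qed.

Lemma cont_on_sub (D D' : C -> Prop) h : (forall z, D' z -> D z) -> cont_on D h -> cont_on D' h.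
Proof.
intros S H z Hz eps. destruct (H z (S z Hz) eps) as [d Hd]. exists d. intros w Hw; apply Hd; auto.
Qed.

Lemma cont_on_const D (c : C) : cont_on D (fun _ => c).
Proof.
intros z _ eps. exists eps. intros w _ _. replace (c - c)%C with (RtoC 0) by ring. rewrite Cmod_0.
  apply cond_pos.
Qed.

Lemma cont_on_plus D f g : cont_on D f -> cont_on D g -> cont_on D (fun z => f z + g z)%C.
Proof.
intros Hf Hg z Hz eps. assert (He : 0 < eps / 2) by (generalize (cond_pos eps); lra).
destruct (Hf z Hz (mkposreal _ He)) as [d1 K1]. destruct (Hg z Hz (mkposreal _ He)) as [d2 K2].
assert (Hd : 0 < Rmin d1 d2) by (apply Rmin_pos; apply cond_pos).
exists (mkposreal _ Hd). simpl. intros w Hw Hwz.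
assert (Cmod (w - z) < d1) by (eapply Rlt_le_trans; [exact Hwz|apply Rmin_l]).
assert (Cmod (w - z) < d2) by (eapply Rlt_le_trans; [exact Hwz|apply Rmin_r]).
specialize (K1 w Hw H). specialize (K2 w Hw H0). simpl in K1, K2.
replace (f w + g w - (f z + g z))%C with ((f w - f z) + (g w - g z))%C by ring.
eapply Rle_lt_trans; [apply Cmod_triangle|]. lra.
Qed.

Lemma cont_on_mult D f g : cont_on D f -> cont_on D g -> cont_on D (fun z => f z * g z)%C.
Proof.
intros Hf Hg z Hz eps.
set (M := Cmod (f z) + Cmod (g z) + 1).
assert (HM : 0 < M) by (generalize (Cmod_ge_0 (f z)) (Cmod_ge_0 (g z)); unfold M; lra).
assert (He : 0 < Rmin 1 (eps / (2 * M))).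
{ apply Rmin_pos; [lra|]. apply Rdiv_lt_0_compat; [apply cond_pos|lra]. }
destruct (Hf z Hz (mkposreal _ He)) as [d1 K1]. destruct (Hg z Hz (mkposreal _ He)) as [d2 K2].
assert (Hd : 0 < Rmin d1 d2) by (apply Rmin_pos; apply cond_pos).
exists (mkposreal _ Hd). simpl. intros w Hw Hwz.
assert (L1 : Cmod (w - z) < d1) by (eapply Rlt_le_trans; [exact Hwz|apply Rmin_l]).
assert (L2 : Cmod (w - z) < d2) by (eapply Rlt_le_trans; [exact Hwz|apply Rmin_r]).
specialize (K1 w Hw L1). specialize (K2 w Hw L2). simpl in K1, K2.
set (e := Rmin 1 (eps / (2 * M))) in *.
assert (e <= 1) by apply Rmin_l. assert (He2 : e <= eps / (2 * M)) by apply Rmin_r.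
assert (He3 : e * (2 * M) <= eps).
{ apply Rle_trans with (eps / (2 * M) * (2 * M)); [apply Rmult_le_compat_r; lra|right; field; lra].
    }
replace (f w * g w - f z * g z)%C with ((f w - f z) * (g w - g z) +
  ((f w - f z) * g z + f z * (g w - g z)))%C by ring.
eapply Rle_lt_trans; [apply Cmod_triangle|].
eapply Rle_lt_trans; [apply Rplus_le_compat_l, Cmod_triangle|].
rewrite !Cmod_mult.
generalize (Cmod_ge_0 (f z)) (Cmod_ge_0 (g z)) (Cmod_ge_0 (f w - f z)) (Cmod_ge_0 (g w - g z)).
unfold M in *. nra.
Qed.

Lemma analytic_on_sub (U D U' D' : C -> Prop) h : (forall z, D' z -> D z) ->
  (forall z, U' z -> U z) -> analytic_on U D h -> analytic_on U' D' h.
Proof. intros S1 S2 [H1 H2]. split; [eapply cont_on_sub; eassumption|auto]. Qed.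

Lemma analytic_on_const U D (c : C) : analytic_on U D (fun _ => c).
Proof. split; [apply cont_on_const|]. intros z _. eexists. apply holo_const. Qed.

Lemma analytic_on_plus U D f g : analytic_on U D f -> analytic_on U D g ->
  analytic_on U D (fun z => f z + g z)%C.
Proof.
intros [H1 H2] [K1 K2]. split; [now apply cont_on_plus|].
intros z Hz. destruct (H2 z Hz), (K2 z Hz). eexists. apply holo_plus; eassumption.
Qed.

Lemma analytic_on_mult U D f g : analytic_on U D f -> analytic_on U D g ->
  analytic_on U D (fun z => f z * g z)%C.
Proof.
intros [H1 H2] [K1 K2]. split; [now apply cont_on_mult|].
intros z Hz. destruct (H2 z Hz), (K2 z Hz). eexists. apply holo_mult; eassumption.
Qed.

Lemma analytic_on_scale (U D : C -> Prop) h (k : C) : analytic_on U D h -> k <> RtoC 0 ->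
  analytic_on (fun z => U (k * z)%C) (fun z => D (k * z)%C) (fun z => h (k * z)%C).
Proof.
intros [H1 H2] Hk. assert (Hm : 0 < Cmod k) by now apply Cmod_gt_0. split.
- intros z Hz eps. destruct (H1 _ Hz eps) as [d Hd].
  assert (Hdk : 0 < d / Cmod k) by (apply Rdiv_lt_0_compat; [apply cond_pos|assumption]).
  exists (mkposreal _ Hdk). simpl. intros w Hw Hwz. apply Hd; [assumption|].
  replace (k * w - k * z)%C with (k * (w - z))%C by ring. rewrite Cmod_mult.
  apply Rlt_le_trans with (Cmod k * (d / Cmod k)); [apply Rmult_lt_compat_l; assumption|].
  right. field. lra.
- intros z Hz. destruct (H2 _ Hz) as [l Hl]. eexists.
  apply (holo_comp h (fun z => k * z)%C); [exact Hl|]. eapply holo_val;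
    [apply holo_mult; [apply holo_const|apply holo_id]|reflexivity].
Qed.

Lemma cderiv_circle_pt r t : cderiv (circle_pt r) t (Ci * circle_pt r t)%C.
Proof.
split; unfold circle_pt; simpl.
- evar_last; [apply is_derive_scal, is_derive_Reals, derivable_pt_lim_cos|]. simpl. ring.
- evar_last; [apply is_derive_scal, is_derive_Reals, derivable_pt_lim_sin|]. simpl. ring.
Qed.

Lemma circle_pt_continuous D h r : cont_on D h -> 0 <= r -> (forall z, Cmod z = r -> D z) ->
  forall t, (forall eps : posreal, locally t (fun u => Cmod
    (h (circle_pt r u) - h (circle_pt r t)) < eps)).
Proof.
intros Hc Hr HD t eps.
destruct (Hc (circle_pt r t) (HD _ (Cmod_circle_pt _ _ Hr)) eps) as [d Hd].
generalize (cderiv_cont _ _ _ (cderiv_circle_pt r t) d). apply filter_imp. intros u Hu. apply Hd;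
  [|exact Hu].
apply HD, Cmod_circle_pt, Hr.
Qed.

Lemma circle_pt_continuous_Re D h r : cont_on D h -> 0 <= r -> (forall z, Cmod z = r -> D z) ->
  forall t, continuous (fun u => Re (h (circle_pt r u))) t /\
    continuous (fun u => Im (h (circle_pt r u))) t.
Proof.
intros Hc Hr HD t. assert (K := circle_pt_continuous D h r Hc Hr HD t).
split; apply filterlim_locally; intros eps; generalize (K eps); apply filter_imp; intros u Hu;
 (eapply Rle_lt_trans; [|exact Hu]).
- apply (re_le_Cmod (h (circle_pt r u) - h (circle_pt r t))).
- apply (im_le_Cmod (h (circle_pt r u) - h (circle_pt r t))).
Qed.

Definition circle_integral (r : R) (h : C -> C) : C :=
  (RInt (fun t => Re (h (circle_pt r t))) 0 (2 * PI),
    RInt (fun t => Im (h (circle_pt r t))) 0 (2 * PI)).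

Lemma circle_integral_ext r f g : 0 <= r -> (forall z, Cmod z = r -> f z = g z) ->
  circle_integral r f = circle_integral r g.
Proof.
intros Hr H. unfold circle_integral. f_equal; apply RInt_ext; intros t _; rewrite H; auto;
  apply Cmod_circle_pt, Hr.
Qed.

Lemma circle_integral_const r c : circle_integral r (fun _ => c) = (RtoC (2 * PI) * c)%C.
Proof.
unfold circle_integral. rewrite !(RInt_const (V := R_CompleteNormedModule)).
destruct c; apply Ceq; unfold scal; simpl; unfold mult; simpl; ring.
Qed.

Lemma circle_integral_annulus (h : C -> C) (r1 r2 : R) : 0 < r1 -> r1 <= r2 ->
  analytic_on (fun z => r1 < Cmod z < r2) (fun z => r1 <= Cmod z <= r2) h ->
  circle_integral r1 h = circle_integral r2 h.
Proof.
intros H1 H12 Hh. unfold circle_integral. f_equal; [now apply circle_integral_Re_annulus|].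
assert (E : forall r, RInt (fun t => Im (h (circle_pt r t))) 0 (2 * PI) = RInt
  (fun t => Re (- Ci * h (circle_pt r t))%C) 0 (2 * PI)).
{ intros r. apply RInt_ext. intros t _. destruct (h (circle_pt r t)). simpl. ring. }
rewrite !E. apply (circle_integral_Re_annulus (fun z => - Ci * h z)%C); auto.
apply analytic_on_mult; [apply analytic_on_const|assumption].
Qed.

(** The mean over small circles tends to the value at the centre. *)
Lemma circle_integral_disk (h : C -> C) (r : R) : 0 < r ->
  analytic_on (fun z => Cmod z < r) (fun z => Cmod z <= r) h ->
  circle_integral r h = (RtoC (2 * PI) * h (RtoC 0))%C.
Proof.
intros Hr Hh. assert (HPI := PI_RGT_0).
destruct (Ceq_dec (circle_integral r h) (RtoC (2 * PI) * h (RtoC 0))%C) as [E|E]; [exact E|exfalso].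
set (k := Cmod (circle_integral r h - RtoC (2 * PI) * h (RtoC 0))%C).
assert (Hk : 0 < k). { apply Cmod_gt_0. intros K. apply E.
  replace (circle_integral r h) with ((circle_integral r h - RtoC (2 * PI) * h (RtoC 0)) + RtoC
    (2 * PI) * h (RtoC 0))%C by ring.
  rewrite K. ring. }
assert (He : 0 < k / (8 * PI)) by (apply Rdiv_lt_0_compat; lra).
destruct (proj1 Hh (RtoC 0) ltac:(cbv beta; rewrite Cmod_0; lra) (mkposreal _ He)) as [d Hd].
  simpl in Hd.
(* a circle on which [h] is close to its value at the centre *)
set (rho := Rmin r (d / 2)).
assert (Hd0 := cond_pos d).
assert (Hrho : 0 < rho) by (apply Rmin_pos; lra).
assert (L1 : rho <= r) by apply Rmin_l. assert (L2 : rho <= d / 2) by apply Rmin_r.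
assert (EI : circle_integral rho h = circle_integral r h).
{ apply circle_integral_annulus; auto. eapply analytic_on_sub; [| |exact Hh]; simpl; intros; lra. }
assert (B : forall t, Cmod (h (circle_pt rho t) - h (RtoC 0)) <= k / (8 * PI)).
{ intros t. left. apply Hd.
  - rewrite Cmod_circle_pt; lra.
  - replace (circle_pt rho t - RtoC 0)%C with (circle_pt rho t) by ring. rewrite Cmod_circle_pt;
      lra. }
assert (Cont := circle_pt_continuous_Re _ h rho (proj1 Hh) (Rlt_le _ _ Hrho)
  ltac:(simpl; intros; lra)).
assert (A1 := RInt_diff_approx (fun t => Re (h (circle_pt rho t))) (fun _ => Re (h (RtoC 0))) 0
  (2 * PI) 0 (k / (8 * PI))
  ltac:(lra) (fun t => proj1 (Cont t)) (fun t => continuous_const _ _)).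
assert (A2 := RInt_diff_approx (fun t => Im (h (circle_pt rho t))) (fun _ => Im (h (RtoC 0))) 0
  (2 * PI) 0 (k / (8 * PI))
  ltac:(lra) (fun t => proj2 (Cont t)) (fun t => continuous_const _ _)).
assert (F : k <= k / (8 * PI) * (2 * PI - 0) + k / (8 * PI) * (2 * PI - 0)).
{ unfold k at 1. rewrite <- EI, <- (circle_integral_const rho). eapply Rle_trans;
    [apply Cmod_le_Re_Im|].
  apply Rplus_le_compat.
  - eapply Rle_trans; [|apply A1].
    + right. f_equal. unfold circle_integral. simpl. ring.
    + intros t _. rewrite Rminus_0_r. eapply Rle_trans; [|apply B].
        apply (re_le_Cmod (h (circle_pt rho t) - h (RtoC 0))).
  - eapply Rle_trans; [|apply A2].
    + right. f_equal. unfold circle_integral. simpl. ring.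
    + intros t _. rewrite Rminus_0_r. eapply Rle_trans; [|apply B].
        apply (im_le_Cmod (h (circle_pt rho t) - h (RtoC 0))). }
replace (k / (8 * PI) * (2 * PI - 0)) with (k / 4) in F by (field; lra). lra.
Qed.

Lemma circle_pt_surj (z : C) (r : R) : 0 < r -> Cmod z = r -> exists t, 0 <= t <= 2 * PI /\
  z = circle_pt r t.
Proof.
intros Hr Hz. destruct z as [x y]. unfold Cmod in Hz. cbn [fst snd] in Hz.
assert (HPI := PI_RGT_0).
assert (E : x ^ 2 + y ^ 2 = r ^ 2) by (rewrite <- Hz, pow2_sqrt; [reflexivity|nra]).
assert (B : -1 <= x / r <= 1).
{ split; (apply Rmult_le_reg_r with r; [assumption|]); unfold Rdiv; rewrite Rmult_assoc, Rinv_l,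
    Rmult_1_r by lra; nra. }
assert (Hs : sqrt (1 - (x / r)²) = Rabs y / r).
{ replace (1 - (x / r)²) with ((Rabs y / r)²).
  - apply sqrt_Rsqr. apply Rdiv_le_0_compat; [apply Rabs_pos|assumption].
  - unfold Rsqr. assert (Rabs y * Rabs y = y * y) by (rewrite <- Rabs_mult; apply Rabs_pos_eq; nra).
    replace (Rabs y / r * (Rabs y / r)) with (Rabs y * Rabs y / (r * r)) by (field; lra). rewrite H.
    replace (y * y) with (r * r - x * x) by (simpl in E; lra). field; lra. }
assert (A := acos_bound (x / r)).
destruct (Rle_dec 0 y) as [Hy|Hy].
- exists (acos (x / r)). split; [lra|]. unfold circle_pt. rewrite cos_acos by assumption.
  rewrite sin_acos by assumption. rewrite Hs, Rabs_pos_eq by assumption. f_equal; field; lra.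
- exists (2 * PI - acos (x / r)). split; [lra|]. unfold circle_pt.
  rewrite cos_minus, sin_minus, cos_2PI, sin_2PI.
  rewrite cos_acos by assumption. rewrite sin_acos by assumption. rewrite Hs, Rabs_left by lra.
    f_equal; field; lra.
Qed.

Lemma RInt_nonneg_zero (f : R -> R) (b : R) : 0 < b -> (forall t, continuous f t) ->
  (forall t, 0 <= f t) ->
  RInt f 0 b = 0 -> forall t, 0 <= t <= b -> f t = 0.
Proof.
intros Hb Hc Hp HI t Ht.
assert (Ex : forall a b, ex_RInt f a b) by (intros;
  apply (ex_RInt_continuous (V := R_CompleteNormedModule)); auto).
destruct (Req_dec (f t) 0) as [E|E]; [exact E|exfalso].
assert (H0 : 0 < f t) by (generalize (Hp t); lra).
destruct (proj1 (filterlim_locally _ _) (Hc t) (mkposreal (f t / 2) ltac:(lra))) as [d Hd].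
  simpl in Hd.
assert (Hd0 := cond_pos d).
set (e := Rmin (d / 2) (b / 2)).
assert (He : 0 < e) by (apply Rmin_pos; lra).
assert (L1 : e <= d / 2) by apply Rmin_l. assert (L2 : e <= b / 2) by apply Rmin_r.
assert (exists u, 0 <= u /\ u + e <= b /\ (forall x, u <= x <= u + e -> Rabs (x - t) < d))
  as [u [U1 [U2 U3]]].
{ destruct (Rle_dec t (b / 2)) as [K|K]; [exists t|exists (t - e)]; repeat split; try lra; intros;
    apply Rabs_lt_between; lra. }
assert (Ch : RInt f 0 b = RInt f 0 u + (RInt f u (u + e) + RInt f (u + e) b)).
{ rewrite <- (RInt_Chasles f 0 u b), <- (RInt_Chasles f u (u + e) b); auto. }
assert (P1 : 0 <= RInt f 0 u) by (apply RInt_ge_0; auto).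
assert (P2 : 0 <= RInt f (u + e) b) by (apply RInt_ge_0; auto; lra).
assert (P3 : RInt (fun _ => f t / 2) u (u + e) <= RInt f u (u + e)).
{ apply RInt_le; [lra|apply ex_RInt_const|auto|]. intros x Hx.
  assert (K : ball (f t) (f t / 2) (f x)) by (apply Hd, U3; lra).
  apply Rabs_lt_between in K. unfold minus, plus, opp in K. simpl in K. lra. }
rewrite RInt_const in P3. unfold scal in P3; simpl in P3; unfold mult in P3; simpl in P3.
assert (0 < (u + e - u) * (f t / 2)) by (apply Rmult_lt_0_compat; lra). lra.
Qed.

(** On [|z| = r] one has [|f z| ^ 2 = f z * g (z / r ^ 2)].  This product agrees with the function
    [p z * g (z / r ^ 2)], analytic for [r ^ 3 <= |z| <= r], and on [|z| = r ^ 3] with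
    [p z * q (z / r ^ 2)], analytic inside.  Hence its mean over [|z| = r] is the value
    [p 0 * q 0 = 0] at the centre, and a nonnegative continuous function of mean zero vanishes. *)
Lemma reflection_vanish (r : R) (f g p q : C -> C) : 0 < r <= 1 ->
  analytic_on (in_annulus r) (in_closed_annulus r) f ->
    analytic_on (in_annulus r) (in_closed_annulus r) g ->
  analytic_on (in_disk r) (in_closed_disk r) p -> analytic_on (in_disk r) (in_closed_disk r) q ->
  (forall z, Cmod z = r -> f z = p z) -> (forall z, Cmod z = r -> g z = q z) ->
  (forall z, Cmod z = r -> Cconj (f z) = g (RtoC (/ (r * r)) * z)%C) ->
  (p (RtoC 0) * q (RtoC 0) = RtoC 0)%C -> forall z, Cmod z = r -> f z = RtoC 0.
Proof.
intros [Hr Hr1] Hf Hg Hp Hq Efp Egq Hrefl H0.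
assert (HPI := PI_RGT_0).
set (k := RtoC (/ (r * r))).
assert (Hrr : 0 < r * r) by nra.
assert (Hir : 1 <= / r) by (rewrite <- Rinv_1; apply Rinv_le_contravar; lra).
assert (Hk : Cmod k = / (r * r)) by (unfold k; rewrite Cmod_R, Rabs_pos_eq;
  [reflexivity|left; now apply Rinv_0_lt_compat]).
assert (Hk0 : k <> RtoC 0) by (apply Cmod_gt_0; rewrite Hk; now apply Rinv_0_lt_compat).
assert (Hkz : forall z, Cmod (k * z)%C * (r * r) = Cmod z)
  by (intros; rewrite Cmod_mult, Hk; field; lra).
assert (Hri : r * / r = 1) by (apply Rinv_r; lra).
set (r3 := r * (r * r)).
assert (Hr3 : 0 < r3) by (apply Rmult_lt_0_compat; lra).
assert (Hr3r : r3 <= r) by (unfold r3; nra).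
assert (I0 : circle_integral r (fun z => f z * Cconj (f z))%C = RtoC 0).
{ rewrite (circle_integral_ext r _ (fun z => p z * g (k * z)))%C;
    [|lra|intros z Hz; rewrite Hrefl by assumption; rewrite <- Efp by assumption; reflexivity].
  rewrite <- (circle_integral_annulus _ r3 r); [|lra|lra|].
  2:{ apply analytic_on_mult.
      - eapply analytic_on_sub; [| |exact Hp]; unfold in_disk, in_closed_disk; simpl; intros; lra.
      - eapply analytic_on_sub; [| |exact (analytic_on_scale _ _ g k Hg Hk0)]; unfold in_annulus,
          in_closed_annulus; intros z Hz;
        generalize (Hkz z); intros K; unfold r3 in *.
        + split; (apply Rmult_le_reg_r with (r * r); [assumption|]); rewrite K; [lra|].
          replace (/ r * (r * r)) with r by (field; lra). lra.
        + split; (apply Rmult_lt_reg_r with (r * r); [assumption|]); rewrite K; [lra|].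
          replace (/ r * (r * r)) with r by (field; lra). lra. }
  rewrite (circle_integral_ext r3 _ (fun z => p z * q (k * z)))%C; [|lra|].
  2:{ intros z Hz. rewrite Egq; [reflexivity|]. apply Rmult_eq_reg_r with (r * r); [|lra].
    rewrite Hkz, Hz. reflexivity. }
  rewrite circle_integral_disk; [|lra|].
  - rewrite Cmult_0_r, H0. ring.
  - apply analytic_on_mult.
    + eapply analytic_on_sub; [| |exact Hp]; unfold in_disk, in_closed_disk; simpl; intros; lra.
    + eapply analytic_on_sub; [| |exact (analytic_on_scale _ _ q k Hq Hk0)]; unfold in_disk,
        in_closed_disk; intros z Hz;
      generalize (Hkz z); intros K; unfold r3 in *.
      * apply Rmult_le_reg_r with (r * r); [assumption|]; rewrite K; lra.
      * apply Rmult_lt_reg_r with (r * r); [assumption|]; rewrite K; lra. }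
intros z Hz. destruct (circle_pt_surj z r Hr Hz) as [t [Ht ->]].
assert (Cont := circle_pt_continuous_Re _ f r (proj1 Hf) (Rlt_le _ _ Hr)
  ltac:(unfold in_closed_annulus; intros; lra)).
assert (K : (fun t => Re (f (circle_pt r t)) * Re (f (circle_pt r t)) + Im (f (circle_pt r t)) * Im
  (f (circle_pt r t))) t = 0).
{ apply (RInt_nonneg_zero (fun t => Re (f (circle_pt r t)) * Re (f (circle_pt r t)) + Im
    (f (circle_pt r t)) * Im (f (circle_pt r t))) (2 * PI)); auto; try lra.
  - intros u. destruct (Cont u) as [C1 C2]. apply (continuous_plus (V := R_NormedModule));
      apply (continuous_mult (K := R_AbsRing)); assumption.
  - intros u. nra.
  - apply (f_equal Re) in I0. simpl in I0. refine (eq_trans (RInt_ext _ _ _ _ _) I0). intros u _.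
      unfold Re, Im. simpl. ring. }
simpl in K. apply Ceq; simpl; nra.
Qed.

Lemma reflection_const (r : R) (f g p q : C -> C) (c : R) : 0 < r <= 1 ->
  analytic_on (in_annulus r) (in_closed_annulus r) f ->
    analytic_on (in_annulus r) (in_closed_annulus r) g ->
  analytic_on (in_disk r) (in_closed_disk r) p -> analytic_on (in_disk r) (in_closed_disk r) q ->
  (forall z, Cmod z = r -> f z = p z) -> (forall z, Cmod z = r -> g z = q z) ->
  (forall z, Cmod z = r -> Cconj (f z) = g (RtoC (/ (r * r)) * z)%C) ->
  p (RtoC 0) = RtoC c -> forall z, Cmod z = r -> f z = RtoC c.
Proof.
intros Hr Hf Hg Hp Hq Efp Egq Hrefl H0 z Hz.
assert (K : (f z + - RtoC c)%C = RtoC 0).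
{ apply (reflection_vanish r (fun z => f z + - RtoC c)%C (fun z => g z + - RtoC c)%C
    (fun z => p z + - RtoC c)%C (fun z => q z + - RtoC c)%C); auto;
  try (apply analytic_on_plus; [assumption|apply analytic_on_const]).
  - intros w Hw. now rewrite Efp.
  - intros w Hw. now rewrite Egq.
  - intros w Hw. rewrite Cplus_conj, Hrefl by assumption. f_equal. apply Ceq; simpl; ring.
  - rewrite H0. ring. }
replace (f z) with (f z + - RtoC c + RtoC c)%C by ring. rewrite K. ring.
Qed.

(** * Uniqueness of the splitting *)

Local Open Scope C_scope.

Lemma continuous_on_cont_on (D : C -> Prop) (h : C -> C) :
  continuous_on (T := C_UniformSpace) (U := C_UniformSpace) D h <-> cont_on D h.
Proof.
split; intros H z Hz.
- intros eps.
  assert (L : locally (T := C_UniformSpace) (h z) (fun w => (Cmod (w - h z) < eps)%R))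
    by (apply locally_C_eps; exists eps; auto).
  apply (H z Hz) in L. unfold filtermap, within in L. apply locally_C_eps in L.
    destruct L as [d Hd].
  exists d. intros w Hw Hwz. apply Hd; assumption.
- intros P HP. apply locally_C_eps in HP. destruct HP as [e He]. destruct (H z Hz e) as [d Hd].
  unfold filtermap, within. apply locally_C_eps. exists d. intros w Hwz Hw. apply He, Hd;
    assumption.
Qed.

Definition mx_analytic (U D : C -> Prop) (G : C -> M2) : Prop :=
  forall i j, (i < 2)%nat -> (j < 2)%nat -> analytic_on U D (fun z => entry (G z) i j).

Lemma analytic_SL2_mx_analytic U D G : analytic_SL2 U D G <-> (forall z, D z -> mdet (G z) = 1) /\
  mx_analytic U D G.
Proof.
split; intros [H1 H2]; (split; [exact H1|]); intros i j Hi Hj; destruct (H2 i j Hi Hj) as [K1 K2];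
  split.
- now apply continuous_on_cont_on.
- intros z Hz. destruct (K2 z Hz) as [l Hl]. exists l. now apply holo_is_derive.
- now apply continuous_on_cont_on.
- intros z Hz. destruct (K2 z Hz) as [l Hl]. exists l. now apply holo_is_derive.
Qed.

Lemma mx_analytic_adj U D G : mx_analytic U D G -> mx_analytic U D (fun z => adj (G z)).
Proof.
intros H.
assert (N : forall i j, (i < 2)%nat -> (j < 2)%nat -> analytic_on U D (fun z => - entry (G z) i j)).
{ intros i j Hi Hj. assert (K := analytic_on_mult U D _ _ (analytic_on_const U D (-(1)))
    (H i j Hi Hj)).
  destruct K as [K1 K2]. split.
  - intros z Hz eps. destruct (K1 z Hz eps) as [d Hd]. exists d. intros w Hw Hwz.
    specialize (Hd w Hw Hwz). replace (- entry (G w) i j - - entry (G z) i j) with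
      (- (1) * entry (G w) i j - - (1) * entry (G z) i j) by ring. exact Hd.
  - intros z Hz. destruct (proj2 (H i j Hi Hj) z Hz) as [l Hl]. eexists. apply holo_opp, Hl. }
intros i j Hi Hj. destruct i as [|[|i]], j as [|[|j]]; try lia.
- apply (H 1%nat 1%nat); lia.
- apply (N 0%nat 1%nat); lia.
- apply (N 1%nat 0%nat); lia.
- apply (H 0%nat 0%nat); lia.
Qed.

Lemma analytic_on_ext U D f g : (forall z, f z = g z) -> analytic_on U D f -> analytic_on U D g.
Proof.
intros E [H1 H2]. split.
- intros z Hz eps. destruct (H1 z Hz eps) as [d Hd]. exists d. intros w. rewrite <- !E. apply Hd.
- intros z Hz. destruct (H2 z Hz) as [l Hl]. exists l. apply (holo_ext f); assumption.
Qed.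

Lemma mx_analytic_mmul U D G K : mx_analytic U D G -> mx_analytic U D K ->
  mx_analytic U D (fun z => mmul (G z) (K z)).
Proof.
intros HG HK i j Hi Hj.
apply (analytic_on_ext U D (fun z => entry (G z) i 0 * entry (K z) 0 j + entry (G z) i 1 * entry
  (K z) 1 j)).
- intros z. symmetry. now apply entry_mmul.
- apply analytic_on_plus; apply analytic_on_mult; try (apply HG; lia); apply HK; lia.
Qed.

Lemma pos_real_eq z : pos_real z -> exists c, (0 < c)%R /\ z = RtoC c.
Proof. intros [H1 H2]. exists (Re z). split; [assumption|]. apply Ceq; [reflexivity|exact H1]. Qed.

(** [X = F ^ -1 F'] is analytic in the annulus, [Y = B B' ^ -1] in the disk, and they agree on
    [|z| = r].  The relation [X ^* = X ^ -1] exchanges the diagonal entries and the two circles, so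
    [reflection_const] and [reflection_vanish] make the entries of [X] constant on [|z| = r], with
    zeros off the diagonal.  The diagonal constants [c] and [d] are the positive diagonal entries of
    [Y 0]; their product is [1], and they coincide because the mean of the second diagonal entry is
    the same on [|z| = r] and on [|z| = 1 / r].  Hence both are [1]. *)
Lemma iwasawa_unique (r : R) (Phi F B F' B' : C -> M2) : (0 < r <= 1)%R ->
  iwasawa_splitting r Phi F B -> iwasawa_splitting r Phi F' B' ->
  forall z, on_circle r z -> F' z = F z /\ B' z = B z.
Proof.
intros Hr [[[dF _] [G [GF [AG RG]]]] [[[dB _] [H [HB [AH [H10 [H00 H11]]]]]] E1]].
intros [[[dF' _] [G' [GF' [AG' RG']]]] [[[dB' _] [H' [HB' [AH' [H10' [H00' H11']]]]]] E2]].
apply analytic_SL2_mx_analytic in AG. apply analytic_SL2_mx_analytic in AG'.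
  apply analytic_SL2_mx_analytic in AH. apply analytic_SL2_mx_analytic in AH'.
destruct AG as [dG AG], AG' as [dG' AG'], AH as [dH AH], AH' as [dH' AH'].
pose (X := fun z => mmul (adj (G z)) (G' z)). pose (Y := fun z => mmul (H z) (adj (H' z))).
assert (AX : mx_analytic (in_annulus r) (in_closed_annulus r) X)
  by exact (mx_analytic_mmul _ _ _ _ (mx_analytic_adj _ _ _ AG) AG').
assert (AY : mx_analytic (in_disk r) (in_closed_disk r) Y)
  by exact (mx_analytic_mmul _ _ _ _ AH (mx_analytic_adj _ _ _ AH')).
assert (Hr1 : (r <= / r)%R).
{ apply Rle_trans with 1%R; [lra|]. rewrite <- Rinv_1. apply Rinv_le_contravar; lra. }
assert (XY : forall z, Cmod z = r -> X z = Y z).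
{ intros z Hz. unfold X, Y. rewrite GF, GF', HB, HB' by assumption.
  assert (K : mmul (F z) (B z) = mmul (F' z) (B' z)) by (rewrite <- E1, <- E2; auto).
  rewrite <- (mmul_1_r (F' z)), <- (mmul_adj_r (B' z)) by auto.
  rewrite <- (mmul_assoc (F' z)), <- K, <- mmul_assoc, <- mmul_assoc, mmul_adj_l, mmul_1_l; auto. }
assert (Hrr : (0 < r * r)%R) by nra.
set (k := RtoC (/ (r * r))).
assert (dX : forall z, Cmod z = r -> mdet (X z) = 1).
{ intros z Hz. unfold X. rewrite mdet_mmul, mdet_adj, dG, dG'; [ring| |]; unfold in_closed_annulus;
    lra. }
assert (Refl : forall z, Cmod z = r -> mconjT (X z) = adj (X (k * z))).
{ intros z Hz.
  assert (Hz0 : z <> 0) by (apply Cmod_gt_0; lra).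
  assert (Hc : Cconj z <> 0) by (apply Cmod_gt_0; rewrite Cmod_conj; lra).
  assert (Hkz : k * z = / Cconj z).
  { unfold k. rewrite RtoC_inv by lra. rewrite RtoC_mult, <- Hz.
    assert (M := Cmod2_conj z). simpl in M. rewrite Rmult_1_r, RtoC_mult in M. rewrite M. field.
      auto. }
  assert (Hin : in_closed_annulus r (k * z)).
  { rewrite Hkz. unfold in_closed_annulus. rewrite Cmod_inv, Cmod_conj, Hz by assumption. lra. }
  assert (Hback : / Cconj (k * z) = z) by (rewrite Hkz, Cinv_conj, Cconj_conj by assumption; field;
    assumption).
  assert (R1 := RG _ Hin). assert (R2 := RG' _ Hin). unfold mstar in R1, R2. rewrite Hback in R1,
    R2.
  rewrite minv_adj in R1, R2 by auto.
  unfold X. rewrite mconjT_mmul, mconjT_adj, R1, R2, adj_mmul. reflexivity. }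
destruct (pos_real_eq _ H00) as [h0 [Ph0 Eh0]]. destruct (pos_real_eq _ H11) as [h1 [Ph1 Eh1]].
destruct (pos_real_eq _ H00') as [h0' [Ph0' Eh0']].
  destruct (pos_real_eq _ H11') as [h1' [Ph1' Eh1']].
set (c := (h0 * h1')%R). set (d := (h1 * h0')%R).
assert (Hc : (0 < c)%R) by now apply Rmult_lt_0_compat. assert (Hd : (0 < d)%R)
  by now apply Rmult_lt_0_compat.
assert (Y00 : entry (Y 0) 0 0 = RtoC c).
{ unfold Y. rewrite entry_mmul by lia. destruct (entry_adj (H' 0)) as [-> [_ [-> _]]].
  rewrite Eh0, Eh1', H10'. unfold c. rewrite RtoC_mult. ring. }
assert (Y11 : entry (Y 0) 1 1 = RtoC d).
{ unfold Y. rewrite entry_mmul by lia. destruct (entry_adj (H' 0)) as [_ [-> [_ ->]]].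
  rewrite Eh0', Eh1, H10. unfold d. rewrite RtoC_mult. ring. }
assert (Y10 : entry (Y 0) 1 0 = 0).
{ unfold Y. rewrite entry_mmul by lia. destruct (entry_adj (H' 0)) as [-> [_ [-> _]]].
  rewrite H10, H10'. ring. }
assert (Ref4 : forall z, Cmod z = r -> Cconj (entry (X z) 0 0) = entry (X (k * z)) 1 1 /\
   Cconj (entry (X z) 1 0) = - entry (X (k * z)) 0 1 /\
     Cconj (entry (X z) 0 1) = - entry (X (k * z)) 1 0 /\
   Cconj (entry (X z) 1 1) = entry (X (k * z)) 0 0).
{ intros z Hz. apply Refl in Hz. apply mat2_inj in Hz. tauto. }
assert (X00 : forall z, Cmod z = r -> entry (X z) 0 0 = RtoC c).
{ apply (reflection_const r _ (fun z => entry (X z) 1 1) (fun z => entry (Y z) 0 0)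
    (fun z => entry (Y z) 1 1)); auto;
    try (apply AX; lia); try (apply AY; lia); try (intros w Hw; now rewrite XY).
  intros w Hw. apply (Ref4 w Hw). }
assert (X11 : forall z, Cmod z = r -> entry (X z) 1 1 = RtoC d).
{ apply (reflection_const r _ (fun z => entry (X z) 0 0) (fun z => entry (Y z) 1 1)
    (fun z => entry (Y z) 0 0)); auto;
    try (apply AX; lia); try (apply AY; lia); try (intros w Hw; now rewrite XY).
  intros w Hw. apply (Ref4 w Hw). }
assert (X10 : forall z, Cmod z = r -> entry (X z) 1 0 = 0).
{ apply (reflection_const r _ (fun z => - (1) * entry (X z) 0 1) (fun z => entry (Y z) 1 0)
    (fun z => - (1) * entry (Y z) 0 1) 0); auto;
    try (apply analytic_on_mult; [apply analytic_on_const|]); try (apply AX; lia);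
      try (apply AY; lia); try (intros w Hw; now rewrite XY).
  intros w Hw. destruct (Ref4 w Hw) as [_ [-> _]]. fold k. ring. }
assert (X01 : forall z, Cmod z = r -> entry (X z) 0 1 = 0).
{ apply (reflection_vanish r (fun z => entry (X z) 0 1) (fun z => - (1) * entry (X z) 1 0)
      (fun z => entry (Y z) 0 1) (fun z => - (1) * entry (Y z) 1 0)); auto;
    try (apply analytic_on_mult; [apply analytic_on_const|]); try (apply AX; lia);
      try (apply AY; lia).
    - intros w Hw; now rewrite XY.
    - intros w Hw; now rewrite XY.
    - intros w Hw. destruct (Ref4 w Hw) as [_ [_ [-> _]]]. fold k. ring.
    - rewrite Y10. ring. }
assert (HPI := PI_RGT_0).
assert (cd : c = d).
{ assert (I1 : circle_integral r (fun z => entry (X z) 1 1) = circle_integral (/ r)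
    (fun z => entry (X z) 1 1)).
  { apply circle_integral_annulus; [lra|assumption|]. apply (AX 1%nat 1%nat); lia. }
  rewrite (circle_integral_ext r _ (fun _ => RtoC d)) in I1; [|lra|assumption].
  rewrite (circle_integral_ext (/ r) _ (fun _ => RtoC c)) in I1.
  - rewrite !circle_integral_const, <- !RtoC_mult in I1. apply RtoC_inj in I1.
    apply Rmult_eq_reg_l in I1; lra.
  - lra.
  - intros z Hz. assert (Hz' : Cmod (RtoC (r * r) * z) = r).
    { rewrite Cmod_mult, Cmod_R, Rabs_pos_eq, Hz by lra. field. lra. }
    destruct (Ref4 _ Hz') as [K _]. rewrite X00 in K by assumption.
    replace (k * (RtoC (r * r) * z)) with z in K.
    + rewrite <- K. apply Ceq; simpl; ring.
    + unfold k. rewrite RtoC_inv by lra. field. intros N. apply RtoC_inj in N. lra. }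
assert (Xid : forall z, Cmod z = r -> X z = Mid).
{ intros z Hz. rewrite (M2_eta (X z)), X00, X01, X10, X11 by assumption. rewrite <- cd.
  assert (D := dX z Hz). unfold mdet in D. rewrite X00, X01, X10, X11, <- cd, Cmult_0_l in D
    by assumption.
  replace (RtoC c * RtoC c - 0) with (RtoC (c * c)) in D by (rewrite RtoC_mult; ring).
    apply RtoC_inj in D.
  assert (c = 1%R) as -> by nra. reflexivity. }
intros z Hz. assert (K := Xid z Hz).
assert (KY := K). rewrite XY in KY by assumption. unfold X in K. unfold Y in KY.
rewrite GF, GF' in K by assumption. rewrite HB, HB' in KY by assumption. split.
- rewrite <- (mmul_1_l (F' z)), <- (mmul_adj_r (F z)) by auto. rewrite mmul_assoc, K, mmul_1_r.
    reflexivity.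
- rewrite <- (mmul_1_r (B z)), <- (mmul_adj_l (B' z)) by auto. rewrite <- mmul_assoc, KY, mmul_1_l.
    reflexivity.
Qed.

(** * Iterated integrals and antidiagonal linear systems *)

(** The coefficients of the Peano-Baker series of the system [p' = g q], [q' = z h p]: the two
    weights alternate, the outermost being [g]. *)
Fixpoint iter_int (g h : R -> R) (k : nat) (x : R) : R :=
  match k with
  | O => 1
  | S k => RInt (fun t => g t * iter_int h g k t)%R 0 x
  end.

Definition iter_int' (g h : R -> R) (k : nat) (x : R) : R :=
  match k with O => 0 | S k => (g x * iter_int h g k x)%R end.

Lemma is_derive_iter_int g h k x : (forall t, continuous g t) -> (forall t, continuous h t) ->
  is_derive (iter_int g h k) x (iter_int' g h k x).
Proof.
revert g h x. induction k as [|k IH]; intros g h x Cg Ch; simpl.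
- apply (is_derive_const (V := R_NormedModule)).
- assert (Cc : forall t, continuous (fun t => g t * iter_int h g k t)%R t).
  { intros t. apply (continuous_mult (K := R_AbsRing)); [apply Cg|].
    apply (ex_derive_continuous (V := R_NormedModule)). eexists. apply IH; assumption. }
  apply (is_derive_RInt (V := R_NormedModule) (fun t => g t * iter_int h g k t)%R _ 0%R x).
  + apply filter_forall. intros y. apply (RInt_correct (V := R_CompleteNormedModule)).
    apply (ex_RInt_continuous (V := R_CompleteNormedModule)). intros; apply Cc.
  + apply Cc.
Qed.

Lemma iter_int_0 g h k : iter_int g h k 0 = match k with O => 1%R | S _ => 0%R end.
Proof. destruct k; simpl; [reflexivity|]. apply (RInt_point (V := R_CompleteNormedModule)). Qed.

(** Keeps the factor [1 / (k + 1)] of each integration; without it the bound on the iterated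
    integrals would be geometric, which does not give an entire series in [z]. *)
Lemma derive_pow_bound (f f' : R -> R) (K : R) (k : nat) (x : R) : f 0 = 0%R -> (0 <= K)%R ->
  (forall t, is_derive f t (f' t)) -> (forall t, Rabs (f' t) <= K * Rabs t ^ k)%R ->
  (Rabs (f x) <= K * Rabs x ^ S k / INR (S k))%R.
Proof.
intros H0 HK Hd Hb.
assert (pos : forall (f f' : R -> R) x, f 0 = 0%R -> (forall t, is_derive f t (f' t)) ->
  (forall t, Rabs (f' t) <= K * Rabs t ^ k)%R ->
  (0 <= x)%R -> (f x <= K * x ^ S k / INR (S k))%R).
{ clear. intros f f' x H0 Hd Hb Hx.
  destruct (MVT_gen (fun t => K * t ^ S k / INR (S k) - f t)%R 0 x (fun t => K * t ^ k - f' t)%R)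
    as [c [Hc E]].
  - intros t _. apply (is_derive_minus (V := R_NormedModule)); [|apply Hd].
    assert (INR (S k) <> 0%R) by (apply not_0_INR; lia).
    auto_derive; [exact I|]. change (match k with O => 1 | S _ => INR k + 1 end)%R with (INR (S k)).
      simpl pred. field. assumption.
  - intros t _. apply continuity_pt_filterlim.
    apply (continuous_minus (V := R_NormedModule) (fun t => K * t ^ S k / INR (S k))%R f).
    + apply (ex_derive_continuous (fun t => K * t ^ S k / INR (S k))%R). auto_derive. exact I.
    + apply (ex_derive_continuous f). eexists; apply Hd.
  - rewrite H0 in E. rewrite Rmin_left, Rmax_right in Hc by lra.
    specialize (Hb c). rewrite (Rabs_pos_eq c) in Hb by lra. apply Rabs_le_between in Hb.
    replace (K * 0 ^ S k / INR (S k))%R with 0%R in E by (simpl pow; unfold Rdiv; ring).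
    assert (0 <= (K * c ^ k - f' c) * (x - 0))%R by (apply Rmult_le_pos; lra). lra. }
assert (both : forall (f f' : R -> R) x, f 0 = 0%R -> (forall t, is_derive f t (f' t)) ->
  (forall t, Rabs (f' t) <= K * Rabs t ^ k)%R ->
  (0 <= x)%R -> (Rabs (f x) <= K * x ^ S k / INR (S k))%R).
{ intros f1 f1' y E D B Hy. apply Rabs_le. split.
  - assert (P := pos (fun t => - f1 t)%R (fun t => - f1' t)%R y). simpl in P. rewrite E in P.
    enough (- f1 y <= K * y ^ S k / INR (S k))%R by (simpl in *; lra). apply P; auto; try lra.
    + intros t. apply (is_derive_opp (V := R_NormedModule)). apply D.
    + intros t. rewrite Rabs_Ropp. apply B.
  - apply (pos f1 f1'); auto. }
destruct (Rle_dec 0 x) as [Hx|Hx].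
- rewrite (Rabs_pos_eq x) by assumption. apply (both f f'); auto.
- rewrite (Rabs_left x) by lra. rewrite <- (Ropp_involutive x) at 1.
  apply (both (fun t => f (- t))%R (fun t => - f' (- t))%R); try lra.
  + now rewrite Ropp_0.
  + intros t. evar_last. apply (is_derive_comp (V := R_NormedModule) f (fun t => - t)%R);
      [apply Hd|].
    apply (is_derive_opp (V := R_NormedModule)), (is_derive_id (K := R_AbsRing)).
    unfold scal, opp, one; simpl; unfold mult; simpl. ring.
  + intros t. rewrite Rabs_Ropp, <- (Rabs_Ropp t). apply Hb.
Qed.

Lemma iter_int_bound g h M k x : (forall t, continuous g t) -> (forall t, continuous h t) ->
  (forall t, Rabs (g t) <= M)%R -> (forall t, Rabs (h t) <= M)%R ->
  (Rabs (iter_int g h k x) <= (M * Rabs x) ^ k / INR (fact k))%R.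
Proof.
intros Cg Ch Bg Bh.
assert (HM : (0 <= M)%R) by (generalize (Bg 0%R) (Rabs_pos (g 0%R)); lra).
revert g h x Cg Ch Bg Bh. induction k as [|k IH]; intros g h x Cg Ch Bg Bh.
- simpl. rewrite Rabs_R1. lra.
- assert (HF : (0 < INR (fact k))%R) by apply INR_fact_lt_0.
  assert (HS : (0 < INR (S k))%R) by (apply lt_0_INR; lia).
  replace ((M * Rabs x) ^ S k / INR (fact (S k)))%R with
    ((M * M ^ k / INR (fact k)) * Rabs x ^ S k / INR (S k))%R.
  2:{ rewrite fact_simpl, mult_INR, Rpow_mult_distr. simpl pow. field. lra. }
  apply (derive_pow_bound (iter_int g h (S k)) (iter_int' g h (S k))).
  + apply iter_int_0.
  + apply Rdiv_le_0_compat; [|assumption]. apply Rmult_le_pos; [assumption|now apply pow_le].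
  + intros t. now apply is_derive_iter_int.
  + intros t. simpl iter_int'. rewrite Rabs_mult.
    replace (M * M ^ k / INR (fact k) * Rabs t ^ k)%R with (M * ((M * Rabs t) ^ k / INR (fact k)))%R
      by (rewrite Rpow_mult_distr; field; lra).
    apply Rmult_le_compat; auto; apply Rabs_pos.
Qed.

Lemma ex_series_pow_fact (y : R) : ex_series (fun n => y ^ n / INR (fact n))%R.
Proof.
exists (exp y). assert (H := is_exp_Reals y). apply is_pseries_R in H. revert H.
  apply is_series_ext.
intros n. change (/ INR (fact n) * y ^ n = y ^ n * / INR (fact n))%R. ring.
Qed.

(** One bound for both parities [k = 2 n] and [k = 2 n + 1], and for [k - 1] in place of [k] after a
    differentiation. *)
Lemma pow_fact_le (Y : R) (n k : nat) : (1 <= Y)%R -> (n <= k <= 2 * n + 1)%nat ->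
  (Y ^ k / INR (fact k) <= Y * ((Y * Y) ^ n / INR (fact n)))%R.
Proof.
intros HY Hk.
assert (Hn := INR_fact_lt_0 n). assert (Hk' := INR_fact_lt_0 k).
assert (P1 : (Y ^ k <= Y * (Y * Y) ^ n)%R).
{ replace (Y * (Y * Y) ^ n)%R with (Y ^ (2 * n + 1))%R.
  - apply Rle_pow; [assumption|lia].
  - rewrite pow_add, pow_mult. simpl. rewrite Rmult_1_r. ring. }
assert (P2 : (INR (fact n) <= INR (fact k))%R) by (apply le_INR, fact_le; lia).
assert (0 <= Y ^ k)%R by (apply pow_le; lra).
replace (Y * ((Y * Y) ^ n / INR (fact n)))%R with ((Y * (Y * Y) ^ n) * / INR (fact n))%R
  by (unfold Rdiv; ring).
apply Rmult_le_compat; [assumption|left; now apply Rinv_0_lt_compat|assumption|].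
apply Rinv_le_contravar; assumption.
Qed.

Definition bounded_cont (M : R) (g : R -> R) : Prop := (forall t, continuous g t) /\
  (forall t, Rabs (g t) <= M)%R.

Lemma iter_int_parity_bound g h M X n e x : bounded_cont M g -> bounded_cont M h ->
  (Rabs x <= X)%R -> (e <= 1)%nat ->
  let Y := (M * X + 1)%R in
  (Rabs (iter_int g h (2 * n + e) x) <= Y * ((Y * Y) ^ n / INR (fact n)))%R /\
  (Rabs (iter_int' g h (2 * n + e) x) <= M * (Y * ((Y * Y) ^ n / INR (fact n))))%R.
Proof.
intros [Cg Bg] [Ch Bh] Hx He Y.
assert (HM : (0 <= M)%R) by (generalize (Bg 0%R) (Rabs_pos (g 0%R)); lra).
assert (HX : (0 <= M * X)%R) by (apply Rmult_le_pos; [assumption|generalize (Rabs_pos x); lra]).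
assert (HY : (1 <= Y)%R) by (unfold Y; lra).
assert (K : forall k, ((M * Rabs x) ^ k / INR (fact k) <= Y ^ k / INR (fact k))%R).
{ intros k. apply Rmult_le_compat_r; [left; apply Rinv_0_lt_compat, INR_fact_lt_0|]. apply pow_incr.
  split; [apply Rmult_le_pos; [assumption|apply Rabs_pos]|]. unfold Y.
  assert (M * Rabs x <= M * X)%R by now apply Rmult_le_compat_l. lra. }
assert (P0 : (0 <= Y * ((Y * Y) ^ n / INR (fact n)))%R).
{ apply Rmult_le_pos; [lra|]. apply Rdiv_le_0_compat; [apply pow_le; nra|apply INR_fact_lt_0]. }
split.
- eapply Rle_trans; [apply (iter_int_bound g h M); assumption|]. eapply Rle_trans; [apply K|].
    apply pow_fact_le; [assumption|lia].
- assert (Hk : (2 * n + e = 0 \/ exists k, 2 * n + e = S k)%nat)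
    by (destruct (2 * n + e)%nat as [|k]; [left|right; exists k]; reflexivity).
  destruct Hk as [->|[k Hk]].
  + simpl iter_int'. rewrite Rabs_R0. apply Rmult_le_pos; assumption.
  + rewrite Hk. simpl iter_int'. rewrite Rabs_mult. apply Rmult_le_compat; try apply Rabs_pos;
      [apply Bg|].
    eapply Rle_trans; [apply (iter_int_bound h g M); assumption|]. eapply Rle_trans; [apply K|].
      apply pow_fact_le; [assumption|lia].
Qed.

(** The power of [z] counts the weights [h]; the parity [e] tells whether the innermost weight is
    the same as the outermost one. *)
Definition iter_series (e : nat) (g h : R -> R) (x : R) (z : C) : C :=
  Cpseries (fun n => iter_int g h (2 * n + e) x) z.

Lemma ex_series_bound_Y (Y r : R) : (0 <= r)%R ->
  ex_series (fun n => Y * ((Y * Y) ^ n / INR (fact n)) * r ^ n)%R.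
Proof.
intros Hr. apply (ex_series_ext (fun n => Y * ((Y * Y * r) ^ n / INR (fact n)))%R).
- intros n. rewrite (Rpow_mult_distr (Y * Y) r). unfold Rdiv. simpl. ring.
- apply ex_series_scal_R, ex_series_pow_fact.
Qed.

Lemma entire_iter_int M g h e x : bounded_cont M g -> bounded_cont M h -> (e <= 1)%nat ->
  entire (fun n => iter_int g h (2 * n + e) x).
Proof.
intros Hg Hh He r Hr.
apply ex_series_le_R with (2 := ex_series_bound_Y (M * Rabs x + 1) r Hr).
intros n. assert (0 <= r ^ n)%R by now apply pow_le.
rewrite Rabs_pos_eq by (apply Rmult_le_pos; [apply Rabs_pos|assumption]).
apply Rmult_le_compat_r; [assumption|]. apply (iter_int_parity_bound g h M); auto. lra.
Qed.

Lemma cderiv_iter_series M g h e t z : bounded_cont M g -> bounded_cont M h -> (e <= 1)%nat ->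
  cderiv (fun x => iter_series e g h x z) t (Cseries
    (fun n => RtoC (iter_int' g h (2 * n + e) t) * z ^ n)).
Proof.
intros Hg Hh He. (* bounds valid on a neighbourhood of [t] *)
pose (X := (Rabs t + 1)%R). pose (Y := (M * X + 1)%R).
apply (cderiv_Cseries (fun n x => RtoC (iter_int g h (2 * n + e) x) * z ^ n) _
  (fun n => M * (Y * ((Y * Y) ^ n / INR (fact n)) * Cmod z ^ n))%R).
- apply (ex_series_scal_R M), ex_series_bound_Y, Cmod_ge_0.
- apply filter_forall. intros u. apply (entire_summable (fun n => iter_int g h (2 * n + e) u)).
    now apply (entire_iter_int M).
- intros n. eapply cderiv_val.
  + apply cderiv_mult; [|apply cderiv_const]. apply cderiv_RtoC, is_derive_iter_int;
      [apply Hg|apply Hh].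
  + cbv beta. ring.
- intros n. rewrite Cmod_mult, Cmod_R, Cmod_pow, <- Rmult_assoc. apply Rmult_le_compat_r;
    [apply pow_le, Cmod_ge_0|].
  apply (iter_int_parity_bound g h M X n e t Hg Hh); [unfold X; lra|assumption].
- exists (mkposreal 1 Rlt_0_1). intros u Hu n. change (Rabs (u - t) < 1)%R in Hu.
  replace (RtoC (iter_int g h (2 * n + e) u) * z ^ n - RtoC (iter_int g h (2 * n + e) t) * z ^ n)
    with
    (RtoC (iter_int g h (2 * n + e) u - iter_int g h (2 * n + e) t) * z ^ n)
      by (rewrite RtoC_minus; ring).
  rewrite Cmod_mult, Cmod_R, Cmod_pow.
  assert (B : (Rabs (iter_int g h (2 * n + e) u - iter_int g h (2 * n + e) t) <=
    (M * (Y * ((Y * Y) ^ n / INR (fact n)))) * Rabs (u - t))%R).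
  { apply (bounded_variation _ (iter_int' g h (2 * n + e))). intros s Hs. split.
    - apply is_derive_iter_int; [apply Hg|apply Hh].
    - apply (iter_int_parity_bound g h M X n e s Hg Hh); [|assumption].
      replace s with (t + (s - t))%R by ring. eapply Rle_trans; [apply Rabs_triang|]. unfold X. lra.
        }
  apply (Rmult_le_compat_r (Cmod z ^ n)) in B; [|apply pow_le, Cmod_ge_0]. lra.
Qed.

(** The shift of parity produces no factor [z] here, and one factor [z] in [cderiv_iter_series_0]:
    this is the system [p' = g q], [q' = z h p]. *)
Lemma cderiv_iter_series_1 M g h t z : bounded_cont M g -> bounded_cont M h ->
  cderiv (fun x => iter_series 1 g h x z) t (RtoC (g t) * iter_series 0 h g t z).
Proof.
intros Hg Hh. eapply cderiv_val; [now apply (cderiv_iter_series M)|].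
unfold iter_series, Cpseries. rewrite <- Cseries_scal
  by (apply (entire_summable (fun n => iter_int h g (2 * n + 0) t)); now apply (entire_iter_int M);
  auto).
apply Cseries_ext. intros n. replace (2 * n + 1)%nat with (S (2 * n + 0)) by lia.
  change (iter_int' g h (S (2 * n + 0)) t) with (g t * iter_int h g (2 * n + 0) t)%R.
    rewrite RtoC_mult. ring.
Qed.

Lemma cderiv_iter_series_0 M g h t z : bounded_cont M g -> bounded_cont M h ->
  cderiv (fun x => iter_series 0 g h x z) t (RtoC (g t) * z * iter_series 1 h g t z).
Proof.
intros Hg Hh. eapply cderiv_val; [apply (cderiv_iter_series M); auto|].
assert (E : forall n, RtoC (iter_int' g h (2 * S n + 0) t) * z ^ S n = RtoC
  (g t) * z * (RtoC (iter_int h g (2 * n + 1) t) * z ^ n)).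
{ intros n. replace (2 * S n + 0)%nat with (S (2 * n + 1)) by lia. change (z ^ S n) with
    (z * z ^ n).
  change (iter_int' g h (S (2 * n + 1)) t) with (g t * iter_int h g (2 * n + 1) t)%R.
    rewrite RtoC_mult. ring. }
assert (Hs : csummable (fun n => RtoC (iter_int h g (2 * n + 1) t) * z ^ n)) by
  (apply (entire_summable (fun n => iter_int h g (2 * n + 1) t)); now apply (entire_iter_int M);
    auto).
rewrite Cseries_incr_1.
- rewrite (Cseries_ext _ _ E), Cseries_scal by assumption. change (iter_int' g h (2 * 0 + 0) t) with
    0%R. unfold iter_series, Cpseries. ring.
- apply (ex_series_incr_1 (fun n => Cmod (RtoC (iter_int' g h (2 * n + 0) t) * z ^ n))).
  apply (ex_series_ext (fun n => Cmod (RtoC (g t) * z *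
    (RtoC (iter_int h g (2 * n + 1) t) * z ^ n)))).
  + intros n. f_equal. symmetry. apply E.
  + now apply csummable_scal.
Qed.

Lemma iter_series_at_0 M g h e z : bounded_cont M g -> bounded_cont M h -> (e <= 1)%nat ->
  iter_series e g h 0 z = if Nat.eqb e 0 then 1 else 0.
Proof.
intros Hg Hh He. unfold iter_series, Cpseries. rewrite Cseries_incr_1
  by (apply (entire_summable (fun n => iter_int g h (2 * n + e) 0)); now apply (entire_iter_int M)).
rewrite (Cseries_ext _ (fun n => 0 * (RtoC (iter_int g h (2 * n + e) 0) * z ^ n))).
- rewrite Cseries_scal by (apply (entire_summable (fun n => iter_int g h (2 * n + e) 0));
    now apply (entire_iter_int M)).
  rewrite iter_int_0. destruct e as [|[|e]]; [| |lia]; simpl; ring.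
- intros n. replace (iter_int g h (2 * S n + e) 0) with 0%R; [ring|].
  replace (2 * S n + e)%nat with (S (2 * n + 1 + e)) by lia. now rewrite iter_int_0.
Qed.

(** * Smooth loops *)

(** [g] is [n] times differentiable; stated for all [n] this is smoothness, and products and
    compositions are handled by induction on [n]. *)
Fixpoint Ck (n : nat) (g : R -> C) : Prop :=
  match n with
  | O => True
  | S n => exists g' : R -> C, (forall t, cderiv g t (g' t)) /\ Ck n g'
  end.

Lemma Ck_ext n f g : (forall t, f t = g t) -> Ck n f -> Ck n g.
Proof.
destruct n as [|n]; simpl; [auto|]. intros E [f' [H1 H2]]. exists f'. split; [|exact H2].
intros t. now apply (cderiv_ext f).
Qed.

Lemma Ck_pred n f : Ck (S n) f -> Ck n f.
Proof.
revert f. induction n as [|n IH]; intros f; [simpl; auto|].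
intros [f' [H1 H2]]. exists f'. split; [exact H1|]. now apply IH.
Qed.

Lemma Ck_const n c : Ck n (fun _ => c).
Proof.
revert c. induction n as [|n IH]; intros c; simpl; [auto|]. exists (fun _ => 0). split; [|apply IH].
intros t. apply cderiv_const.
Qed.

Lemma Ck_plus n f g : Ck n f -> Ck n g -> Ck n (fun t => f t + g t).
Proof.
revert f g. induction n as [|n IH]; intros f g; simpl; [auto|].
intros [f' [F1 F2]] [g' [G1 G2]]. exists (fun t => f' t + g' t). split; [|now apply IH].
intros t. now apply cderiv_plus.
Qed.

Lemma Ck_mult n f g : Ck n f -> Ck n g -> Ck n (fun t => f t * g t).
Proof.
revert f g. induction n as [|n IH]; intros f g Hf Hg; [exact I|].
assert (Hf' := Ck_pred _ _ Hf). assert (Hg' := Ck_pred _ _ Hg).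
destruct Hf as [f' [F1 F2]]. destruct Hg as [g' [G1 G2]].
exists (fun t => f' t * g t + f t * g' t). split; [|apply Ck_plus; now apply IH].
intros t. now apply cderiv_mult.
Qed.

(** The induction runs over all coefficient sequences at once, since the derivative of an entire
    series is the entire series [PS_derive c]. *)
Lemma Ck_Cpseries n c g : entire c -> Ck n g -> Ck n (fun t => Cpseries c (g t)).
Proof.
revert c g. induction n as [|n IH]; intros c g Hc Hg; [exact I|].
assert (Hg' := Ck_pred _ _ Hg). destruct Hg as [g' [G1 G2]].
exists (fun t => Cpseries (PS_derive c) (g t) * g' t). split.
- intros t. apply (cderiv_holo_comp (Cpseries c)); [now apply holo_Cpseries|apply G1].
- apply Ck_mult; [|exact G2]. apply IH; [now apply entire_PS_derive|exact Hg'].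
Qed.

Lemma Ck_circle_pt n r : Ck n (circle_pt r).
Proof.
induction n as [|n IH]; [exact I|]. exists (fun t => Ci * circle_pt r t). split;
  [apply cderiv_circle_pt|].
apply Ck_mult; [apply Ck_const|exact IH].
Qed.

Lemma circle_pt_neq_0 r t : (0 < r)%R -> circle_pt r t <> 0.
Proof. intros Hr. apply Cmod_gt_0. rewrite Cmod_circle_pt; lra. Qed.

Lemma Ck_inv_circle_pt n r : (0 < r)%R -> Ck n (fun t => / circle_pt r t).
Proof.
intros Hr. induction n as [|n IH]; [exact I|]. exists (fun t => - Ci * / circle_pt r t). split.
- intros t. assert (H0 := circle_pt_neq_0 r t Hr).
  eapply cderiv_val; [apply cderiv_inv; [apply cderiv_circle_pt|exact H0]|]. field. exact H0.
- apply Ck_mult; [apply Ck_const|exact IH].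
Qed.

Lemma Ck_smooth g : (forall n, Ck n g) -> smooth (fun t => Re (g t)) /\ smooth (fun t => Im (g t)).
Proof.
intros H.
assert (K : forall k n, Ck (k + n) g -> exists h, Ck n h /\ forall t,
   Derive_n (fun t => Re (g t)) k t = Re (h t) /\ Derive_n (fun t => Im (g t)) k t = Im (h t)).
{ induction k as [|k IH]; intros n Hn.
  - exists g. split; [exact Hn|]. intros t; split; reflexivity.
  - destruct (IH (S n)) as [h [[h' [D C]] E]].
    + replace (k + S n)%nat with (S k + n)%nat by lia. exact Hn.
    + exists h'. split; [exact C|]. intros t. simpl. split.
      * rewrite (Derive_ext _ (fun t => Re (h t))) by (intros u; apply E). apply is_derive_unique,
          D.
      * rewrite (Derive_ext _ (fun t => Im (h t))) by (intros u; apply E). apply is_derive_unique,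
          D. }
split; intros [|n] t; simpl; auto; destruct (K n 1%nat (H _)) as [h [[h' [D _]] E]].
- apply (ex_derive_ext (fun t => Re (h t))); [intros u; symmetry; apply E|]. exists (Re (h' t)).
    exact (proj1 (D t)).
- apply (ex_derive_ext (fun t => Im (h t))); [intros u; symmetry; apply E|]. exists (Im (h' t)).
    exact (proj2 (D t)).
Qed.

(** * The exponential of an antidiagonal matrix *)

(** [cosq w] is [cosh (sqrt w)] and [sinq w] is [sinh (sqrt w) / sqrt w]: entire functions of [w],
    which avoids choosing a square root of the eigenvalue. *)
Definition cosq_coef (n : nat) : R := (/ INR (fact (2 * n)))%R.
Definition sinq_coef (n : nat) : R := (/ INR (fact (2 * n + 1)))%R.
Definition cosq : C -> C := Cpseries cosq_coef.
Definition sinq : C -> C := Cpseries sinq_coef.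

Lemma entire_inv_fact (k : nat -> nat) : (forall n, (n <= k n)%nat) ->
  entire (fun n => / INR (fact (k n)))%R.
Proof.
intros Hk r Hr. apply ex_series_le_R with (2 := ex_series_pow_fact r).
intros n. unfold norm; simpl; unfold abs; simpl.
assert (Hn := INR_fact_lt_0 n). assert (Hkn := INR_fact_lt_0 (k n)).
assert (0 <= / INR (fact (k n)))%R by (left; now apply Rinv_0_lt_compat).
assert (0 <= r ^ n)%R by now apply pow_le.
rewrite (Rabs_pos_eq (/ _)) by assumption. rewrite Rabs_pos_eq by now apply Rmult_le_pos.
unfold Rdiv. rewrite Rmult_comm. apply Rmult_le_compat_l; [assumption|].
apply Rinv_le_contravar; [assumption|]. apply le_INR, fact_le, Hk.
Qed.

Lemma entire_cosq : entire cosq_coef.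
Proof. apply (entire_inv_fact (fun n => 2 * n)%nat). intros; lia. Qed.

Lemma entire_sinq : entire sinq_coef.
Proof. apply (entire_inv_fact (fun n => 2 * n + 1)%nat). intros; lia. Qed.

Lemma holo_cosq w : holo cosq w (sinq w / 2).
Proof.
eapply holo_val; [apply holo_Cpseries, entire_cosq|].
replace (sinq w / 2) with (RtoC (/ 2) * sinq w)
  by (rewrite RtoC_inv by lra; field; intros N; apply RtoC_inj in N; lra).
unfold sinq, Cpseries at 2. rewrite <- Cseries_scal by apply entire_summable, entire_sinq.
  unfold Cpseries. apply Cseries_ext. intros n.
unfold PS_derive, cosq_coef, sinq_coef. rewrite Cmult_assoc, <- RtoC_mult. f_equal. f_equal.
replace (2 * S n)%nat with (S (2 * n + 1)) by lia. rewrite fact_simpl, mult_INR.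
replace (S (2 * n + 1)) with (2 * S n)%nat by lia. rewrite mult_INR. simpl (INR 2).
field. split; [apply INR_fact_neq_0|]. apply not_0_INR. lia.
Qed.

Lemma holo_sinq w : exists l, holo sinq w l /\ 2 * w * l + sinq w = cosq w.
Proof.
exists (Cpseries (PS_derive sinq_coef) w). split; [apply holo_Cpseries, entire_sinq|].
assert (S1 := entire_summable _ w entire_sinq). assert (S2 := entire_summable _ w entire_cosq).
assert (S3 := entire_summable _ w (entire_PS_derive _ entire_sinq)).
unfold sinq, cosq, Cpseries. rewrite (Cseries_incr_1 _ S1), (Cseries_incr_1 _ S2), <- Cseries_scal
  by assumption.
assert (S1' : csummable (fun n => RtoC (sinq_coef (S n)) * w ^ S n))
  by (apply (ex_series_incr_1 (fun n => Cmod (RtoC (sinq_coef n) * w ^ n))); exact S1).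
replace (RtoC (sinq_coef 0)) with (RtoC (cosq_coef 0)) by reflexivity.
rewrite (Cseries_ext (fun n => RtoC (cosq_coef (S n)) * w ^ S n)
  (fun n => 2 * w * (RtoC (PS_derive sinq_coef n) * w ^ n) + RtoC (sinq_coef (S n)) * w ^ S n)).
- rewrite Cseries_plus; [ring|now apply csummable_scal|assumption].
- intros n. unfold PS_derive, sinq_coef, cosq_coef.
  replace (2 * S n + 1)%nat with (S (2 * S n)) by lia. rewrite fact_simpl, mult_INR.
  assert (E : (/ INR (fact (2 * S n)) = 2 * (INR
    (S n) * / (INR (S (2 * S n)) * INR (fact (2 * S n)))) + /
    (INR (S (2 * S n)) * INR (fact (2 * S n))))%R).
  { rewrite (S_INR (2 * S n)), mult_INR. simpl (INR 2). assert (0 <= INR (S n))%R by apply pos_INR.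
      field. split; [apply INR_fact_neq_0|lra]. }
  rewrite E at 1. rewrite RtoC_plus, RtoC_mult. simpl (w ^ S n). ring.
Qed.

Lemma Series_even_odd (f e o : nat -> R) : (forall n, f (2 * n)%nat = e n) ->
  (forall n, f (2 * n + 1)%nat = o n) ->
  ex_series e -> ex_series o -> Series f = (Series e + Series o)%R.
Proof.
intros He Ho Se So. apply is_series_unique.
assert (K : forall g : nat -> R, (forall n, g n * 1 ^ n = g n)%R) by (intros; rewrite pow1; ring).
apply (is_series_ext (fun n => scal (pow_n (K := R_Ring) 1%R n) (f n))).
{ intros n. rewrite pow_n_pow, pow1. apply Rmult_1_l. }
replace (Series e + Series o)%R with (Series e + 1 * Series o)%R by ring.
apply (is_pseries_odd_even f 1%R).
- apply is_pseries_R. apply (is_series_ext e); [intros n; now rewrite !pow1, He, Rmult_1_r|].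
    now apply Series_correct.
- apply is_pseries_R. apply (is_series_ext o); [intros n; now rewrite !pow1, Ho, Rmult_1_r|].
    now apply Series_correct.
Qed.

Definition mpow (M : M2) (n : nat) : M2 :=
  pow_n (K := matrix_Ring (T := C_Ring) (n := 2)) M n.

Lemma mpow_antidiag (p q : C) n :
  mpow (mat2 0 p q 0) (2 * n) = mat2 ((p * q) ^ n) 0 0 ((p * q) ^ n) /\
  mpow (mat2 0 p q 0) (2 * n + 1) = mat2 0 (p * (p * q) ^ n) (q * (p * q) ^ n) 0.
Proof.
assert (step : forall k M, mpow (mat2 0 p q 0) k = M ->
   mpow (mat2 0 p q 0) (S k) = mmul (mat2 0 p q 0) M) by (intros k M <-; reflexivity).
assert (odd : forall k, mpow (mat2 0 p q 0) (2 * k) = mat2 ((p * q) ^ k) 0 0 ((p * q) ^ k) ->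
   mpow (mat2 0 p q 0) (2 * k + 1) = mat2 0 (p * (p * q) ^ k) (q * (p * q) ^ k) 0).
{ intros k H. replace (2 * k + 1)%nat with (S (2 * k)) by lia. rewrite (step _ _ H), mmul_mat2.
    apply mat2_eq; ring. }
induction n as [|n [IH1 IH2]].
- split; [reflexivity|apply odd; reflexivity].
- assert (H : mpow (mat2 0 p q 0) (2 * S n) = mat2 ((p * q) ^ S n) 0 0 ((p * q) ^ S n)).
  { replace (2 * S n)%nat with (S (2 * n + 1)) by lia. rewrite (step _ _ IH2), mmul_mat2. simpl.
      apply mat2_eq; ring. }
  split; [exact H|now apply odd].
Qed.

(** The square of the matrix is [p q] times the identity, so even and odd powers separate. *)
Lemma mexp_antidiag (p q : C) :
  mexp (mat2 0 p q 0) = mat2 (cosq (p * q)) (p * sinq (p * q)) (q * sinq (p * q)) (cosq (p * q)).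
Proof.
assert (Z : forall k : nat, (0 / INR (fact k) = 0)%R) by (intros; unfold Rdiv; ring).
assert (IS : is_series (fun _ : nat => 0%R) 0%R).
{ apply (is_lim_seq_ext (fun _ => 0%R) (sum_n (fun _ : nat => 0%R)) 0%R); [|apply is_lim_seq_const].
  intros n. rewrite sum_n_const, Rmult_0_r. reflexivity. }
assert (S0 : ex_series (fun _ : nat => 0%R)) by (exists 0%R; exact IS).
assert (SZ : Series (fun _ : nat => 0%R) = 0%R) by (apply is_series_unique, IS).
assert (Sc := entire_summable _ (p * q) entire_cosq).
  assert (Ss := entire_summable _ (p * q) entire_sinq).
assert (Diag : forall F : nat -> C, (forall n, F (2 * n)%nat = (p * q) ^ n) ->
  (forall n, F (2 * n + 1)%nat = 0) ->
  (Series (fun n => Re (F n) / INR (fact n))%R, Series (fun n => Im (F n) / INR (fact n))%R) = cosq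
    (p * q)).
{ intros F F1 F2. unfold cosq, Cpseries, Cseries. f_equal.
  - rewrite (Series_even_odd _ (fun n => Re (RtoC (cosq_coef n) * (p * q) ^ n)) (fun _ => 0%R));
      auto using csummable_Re.
    + rewrite SZ. ring.
    + intros n. rewrite F1. unfold cosq_coef. destruct ((p * q) ^ n). simpl. unfold Rdiv. ring.
    + intros n. rewrite F2. apply Z.
  - rewrite (Series_even_odd _ (fun n => Im (RtoC (cosq_coef n) * (p * q) ^ n)) (fun _ => 0%R));
      auto using csummable_Im.
    + rewrite SZ. ring.
    + intros n. rewrite F1. unfold cosq_coef. destruct ((p * q) ^ n). simpl. unfold Rdiv. ring.
    + intros n. rewrite F2. apply Z. }
assert (Off : forall (F : nat -> C) c, (forall n, F (2 * n)%nat = 0) ->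
  (forall n, F (2 * n + 1)%nat = c * (p * q) ^ n) ->
  (Series (fun n => Re (F n) / INR (fact n))%R, Series (fun n => Im (F n) / INR (fact n))%R) = c *
    sinq (p * q)).
{ intros F c F1 F2. unfold sinq, Cpseries. rewrite <- Cseries_scal by assumption.
    assert (Ss' := csummable_scal c _ Ss). unfold Cseries. f_equal.
  - rewrite (Series_even_odd _ (fun _ => 0%R) (fun n => Re
      (c * (RtoC (sinq_coef n) * (p * q) ^ n)))); auto.
    + rewrite SZ. ring.
    + intros n. rewrite F1. apply Z.
    + intros n. rewrite F2. unfold sinq_coef. destruct c, ((p * q) ^ n). simpl. unfold Rdiv. ring.
    + apply (csummable_Re _ Ss').
  - rewrite (Series_even_odd _ (fun _ => 0%R) (fun n => Im
      (c * (RtoC (sinq_coef n) * (p * q) ^ n)))); auto.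
    + rewrite SZ. ring.
    + intros n. rewrite F1. apply Z.
    + intros n. rewrite F2. unfold sinq_coef. destruct c, ((p * q) ^ n). simpl. unfold Rdiv. ring.
    + apply (csummable_Im _ Ss'). }
pose (e := fun i j n => entry (mpow (mat2 0 p q 0) n) i j).
pose (ser := fun i j => (Series (fun n => Re (e i j n) / INR (fact n))%R,
  Series (fun n => Im (e i j n) / INR (fact n))%R) : C).
change (mexp (mat2 0 p q 0)) with (mat2 (ser 0%nat 0%nat) (ser 0%nat 1%nat) (ser 1%nat 0%nat)
  (ser 1%nat 1%nat)).
apply mat2_eq; [apply Diag|apply Off|apply Off|apply Diag]; intros n; unfold e;
  destruct (mpow_antidiag p q n) as [E1 E2]; [rewrite E1|rewrite E2|rewrite E1|rewrite E2|rewrite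
    E1|rewrite E2|rewrite E1|rewrite E2]; reflexivity.
Qed.

(** * Profile functions *)

Local Open Scope R_scope.

(** [sn ^ 2 + cn ^ 2] and [m sn ^ 2 + dn ^ 2] have derivative zero. *)
Lemma jacobi_squares m sn cn dn : jacobi_triple m sn cn dn ->
  forall u, cn u * cn u = 1 - sn u * sn u /\ dn u * dn u = 1 - m * (sn u * sn u).
Proof.
intros (S0 & C0 & D0 & dS & dC & dD) u.
assert (K : forall f : R -> R, (forall t, is_derive f t 0) -> f u = f 0).
{ intros f Hf. destruct (MVT_gen f 0 u (fun _ => 0)) as [c [_ E]].
  - intros t _; apply Hf.
  - intros t _. apply continuity_pt_filterlim, (ex_derive_continuous (V := R_NormedModule)).
      eexists; apply Hf.
  - lra. }
assert (K1 := K (fun u => sn u * sn u + cn u * cn u)).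
  assert (K2 := K (fun u => m * (sn u * sn u) + dn u * dn u)).
simpl in K1, K2. rewrite S0, C0 in K1. rewrite S0, D0 in K2. split.
- enough (sn u * sn u + cn u * cn u = 0 * 0 + 1 * 1) by lra. apply K1. intros t.
  evar_last; [exact (is_derive_plus (V := R_NormedModule) _ _ t _ _
    (is_derive_Rmult _ _ _ _ _ (dS t) (dS t)) (is_derive_Rmult _ _ _ _ _ (dC t) (dC t)))|].
  unfold plus; simpl. ring.
- enough (m * (sn u * sn u) + dn u * dn u = m * (0 * 0) + 1 * 1) by lra. apply K2. intros t.
  evar_last; [exact (is_derive_plus (V := R_NormedModule) _ _ t _ _
    (is_derive_scal _ t m _ (is_derive_Rmult _ _ _ _ _ (dS t) (dS t)))
    (is_derive_Rmult _ _ _ _ _ (dD t) (dD t)))|].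
  unfold plus; simpl. ring.
Qed.

(** [w' ^ 2] is an even quartic in [w], together with the equation [w'' = be w + 2 ga w ^ 3], which
    follows from it only where [w' <> 0] and is therefore recorded separately. *)
Definition quartic_ode (al be ga : R) (w : R -> R) (u : R) : Prop :=
  exists w1 : R -> R, locally u (fun t => is_derive w t (w1 t)) /\
    w1 u * w1 u = al + be * w u ^ 2 + ga * w u ^ 4 /\
    is_derive w1 u (be * w u + 2 * ga * w u ^ 3).

Lemma quotient_ode (p p1 p2 q q1 q2 : R -> R) al be ga :
  (forall u, is_derive p u (p1 u)) -> (forall u, is_derive p1 u (p2 u)) ->
  (forall u, is_derive q u (q1 u)) -> (forall u, is_derive q1 u (q2 u)) ->
  (forall u, (p1 u * q u - p u * q1 u) ^ 2 = al * q u ^ 4 + be * p u ^ 2 * q u ^ 2 + ga * p u ^ 4)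
    ->
  (forall u, (p2 u * q u - p u * q2 u) * q u - 2 * (p1 u * q u - p u * q1 u) * q1 u =
     be * p u * q u ^ 2 + 2 * ga * p u ^ 3) ->
  forall u, q u <> 0 -> quartic_ode al be ga (fun t => p t / q t) u.
Proof.
intros Hp Hp1 Hq Hq1 E1 E2 u Hu.
exists (fun t => (p1 t * q t - p t * q1 t) / q t ^ 2). split; [|split].
- assert (Cq : continuous q u) by (apply (ex_derive_continuous (V := R_NormedModule)); eexists;
    apply Hq).
  assert (L : locally (q u) (fun y => y <> 0)).
  { exists (mkposreal _ (Rabs_pos_lt _ Hu)). intros y Hy ->.
      change (Rabs (0 - q u) < Rabs (q u)) in Hy.
    replace (0 - q u) with (- q u) in Hy by ring. rewrite Rabs_Ropp in Hy. lra. }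
  generalize (Cq _ L : locally u (fun t => q t <> 0)). apply filter_imp. intros t Ht.
    apply is_derive_div; auto.
- cbv beta. specialize (E1 u).
  replace ((p1 u * q u - p u * q1 u) / q u ^ 2 * ((p1 u * q u - p u * q1 u) / q u ^ 2)) with
    ((p1 u * q u - p u * q1 u) ^ 2 / q u ^ 4) by (field; assumption).
  rewrite E1. field. assumption.
- evar_last.
  + apply (is_derive_div (fun t => p1 t * q t - p t * q1 t) (fun t => q t ^ 2)).
    * apply (is_derive_minus (V := R_NormedModule)); apply is_derive_Rmult; auto.
    * apply is_derive_pow, Hq.
    * now apply pow_nonzero.
  + specialize (E2 u). unfold minus, plus, opp; simpl.
    transitivity (((p2 u * q u - p u * q2 u) * q u - 2 * (p1 u * q u - p u * q1 u) * q1 u) / q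
      u ^ 3); [field; assumption|].
    rewrite E2. field. assumption.
Qed.

(** The coefficients are the classical ones of the twelve functions of Glaisher; they are zero for
    the quotients [p / p]. *)
Lemma jacobi_quotient_ode m sn cn dn p q : jacobi_triple m sn cn dn ->
  In p (sn :: cn :: dn :: (fun _ => 1) :: nil) -> In q (sn :: cn :: dn :: (fun _ => 1) :: nil) ->
  exists al be ga, forall u, q u <> 0 -> quartic_ode al be ga (fun t => p t / q t) u.
Proof.
intros HJ Hp Hq. assert (Sq := jacobi_squares _ _ _ _ HJ).
  destruct HJ as (_ & _ & _ & dS & dC & dD).
set (s2 := fun u => - (sn u * dn u * dn u) - m * sn u * cn u * cn u).
set (c2 := fun u => - (cn u * dn u * dn u) + m * sn u * sn u * cn u).
set (d2 := fun u => - m * (cn u * cn u * dn u) + m * (sn u * sn u * dn u)).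
assert (ddS : forall u, is_derive (fun u => cn u * dn u) u (s2 u)).
{ intros u. evar_last; [apply is_derive_Rmult; [apply dC|apply dD]|]. unfold s2. ring. }
assert (ddC : forall u, is_derive (fun u => - (sn u * dn u)) u (c2 u)).
{ intros u. evar_last; [apply (is_derive_opp (V := R_NormedModule)), is_derive_Rmult;
    [apply dS|apply dD]|]. unfold c2, opp; simpl. ring. }
assert (ddD : forall u, is_derive (fun u => - (m * sn u * cn u)) u (d2 u)).
{ intros u. evar_last; [apply (is_derive_opp (V := R_NormedModule)), is_derive_Rmult;
    [apply is_derive_scal, dS|apply dC]|]. unfold d2, opp; simpl. ring. }
assert (d1 : forall u, is_derive (fun _ : R => 1) u 0)
  by (intros; apply (is_derive_const (V := R_NormedModule))).
assert (dd1 : forall u, is_derive (fun _ : R => 0) u 0)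
  by (intros; apply (is_derive_const (V := R_NormedModule))).
assert (Hself : forall f f1 f2 : R -> R, (forall u, is_derive f u (f1 u)) ->
  (forall u, is_derive f1 u (f2 u)) ->
   exists al be ga, forall u, f u <> 0 -> quartic_ode al be ga (fun t => f t / f t) u).
{ intros f f1 f2 H1 H2. exists 0, 0, 0. apply (quotient_ode f f1 f2 f f1 f2); auto; intros; ring. }
Ltac fin Sq := intros u; cbv beta; destruct (Sq u) as [HC HD];
  match type of HC with ?c * ?c = 1 - ?s * ?s =>
  match type of HD with ?d * ?d = _ =>
    generalize dependent c; generalize dependent d; generalize dependent s; intros S D HD C HC;
      ring [HC HD] end end.
destruct Hp as [<-|[<-|[<-|[<-|[]]]]]; destruct Hq as [<-|[<-|[<-|[<-|[]]]]];
 try (eapply Hself; [first [exact dS|exact dC|exact dD|exact d1]|first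
   [exact ddS|exact ddC|exact ddD|exact dd1]]; fail).
- exists 1, (2 - m), (1 - m). apply (quotient_ode sn (fun u => cn u * dn u) s2 cn
    (fun u => - (sn u * dn u)) c2); auto; unfold s2, c2; fin Sq.
- exists 1, (2 * m - 1), (- m * (1 - m)). apply (quotient_ode sn (fun u => cn u * dn u) s2 dn
    (fun u => - (m * sn u * cn u)) d2); auto; unfold s2, d2; fin Sq.
- exists 1, (- (1 + m)), m. apply (quotient_ode sn (fun u => cn u * dn u) s2 (fun _ => 1)
    (fun _ => 0) (fun _ => 0)); auto; unfold s2; fin Sq.
- exists (1 - m), (2 - m), 1. apply (quotient_ode cn (fun u => - (sn u * dn u)) c2 sn
    (fun u => cn u * dn u) s2); auto; unfold s2, c2; fin Sq.
- exists 1, (- (1 + m)), m. apply (quotient_ode cn (fun u => - (sn u * dn u)) c2 dn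
    (fun u => - (m * sn u * cn u)) d2); auto; unfold d2, c2; fin Sq.
- exists (1 - m), (2 * m - 1), (- m). apply (quotient_ode cn (fun u => - (sn u * dn u)) c2
    (fun _ => 1) (fun _ => 0) (fun _ => 0)); auto; unfold c2; fin Sq.
- exists (- m * (1 - m)), (2 * m - 1), 1. apply (quotient_ode dn (fun u => - (m * sn u * cn u)) d2
    sn (fun u => cn u * dn u) s2); auto; unfold s2, d2; fin Sq.
- exists m, (- (1 + m)), 1. apply (quotient_ode dn (fun u => - (m * sn u * cn u)) d2 cn
    (fun u => - (sn u * dn u)) c2); auto; unfold d2, c2; fin Sq.
- exists (m - 1), (2 - m), (-1). apply (quotient_ode dn (fun u => - (m * sn u * cn u)) d2
    (fun _ => 1) (fun _ => 0) (fun _ => 0)); auto; unfold d2; fin Sq.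
- exists m, (- (1 + m)), 1. apply (quotient_ode (fun _ => 1) (fun _ => 0) (fun _ => 0) sn
    (fun u => cn u * dn u) s2); auto; unfold s2; fin Sq.
- exists (- m), (2 * m - 1), (1 - m). apply (quotient_ode (fun _ => 1) (fun _ => 0) (fun _ => 0) cn
    (fun u => - (sn u * dn u)) c2); auto; unfold c2; fin Sq.
- exists (-1), (2 - m), (m - 1). apply (quotient_ode (fun _ => 1) (fun _ => 0) (fun _ => 0) dn
    (fun u => - (m * sn u * cn u)) d2); auto; unfold d2; fin Sq.
Qed.

Lemma jacobian_elliptic_ode v : jacobian_elliptic v -> v 0 <> 0 ->
  exists A B G, (forall x, is_derive v x (Derive v x)) /\
    (forall x, Derive v x ^ 2 = A + B * v x ^ 2 + G * v x ^ 4) /\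
    (forall x, is_derive (Derive v) x (B * v x + 2 * G * v x ^ 3)).
Proof.
intros (m & sn & cn & dn & p & q & c & k & u0 & HJ & Hp & Hq & Hq0 & Hv) Hv0.
assert (Hc : c <> 0) by (intros ->; apply Hv0; rewrite Hv; ring).
destruct (jacobi_quotient_ode m sn cn dn p q HJ Hp Hq) as (al & be & ga & H).
set (w := fun t => p t / q t) in *.
assert (Hw : forall x, w (k * x + u0) = v x / c)
  by (intros x; rewrite Hv; unfold w; field; split; [apply Hq0|exact Hc]).
assert (dlin : forall x, is_derive (fun x => k * x + u0) x k)
  by (intros; auto_derive; [exact I|ring]).
assert (dv : forall x d, is_derive w (k * x + u0) d -> is_derive v x (c * (k * d))).
{ intros x d Hd. apply (is_derive_ext (fun x => c * w (k * x + u0))); [intros t; now rewrite Hv|].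
  apply is_derive_scal. apply (is_derive_comp (V := R_NormedModule) w (fun x => k * x + u0));
    [exact Hd|apply dlin]. }
assert (pt : forall x, exists w1 : R -> R, locally x
  (fun t => Derive v t = c * (k * w1 (k * t + u0)) /\ ex_derive v t) /\
   w1 (k * x + u0) * w1 (k * x + u0) = al + be * (v x / c) ^ 2 + ga * (v x / c) ^ 4 /\
   is_derive w1 (k * x + u0) (be * (v x / c) + 2 * ga * (v x / c) ^ 3)).
{ intros x. destruct (H (k * x + u0) (Hq0 x)) as (w1 & L & E & D). exists w1. rewrite !Hw in E.
    rewrite !Hw in D.
  split; [|split; [exact E|exact D]].
  assert (Cl : continuous (fun x => k * x + u0) x)
    by (apply (ex_derive_continuous (V := R_NormedModule)); eexists; apply dlin).
  generalize (Cl _ L : locally x (fun t => is_derive w (k * t + u0) (w1 (k * t + u0)))).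
    apply filter_imp. intros t Ht. assert (K := dv t _ Ht). split;
    [now apply is_derive_unique|eexists; exact K]. }
exists (c ^ 2 * k ^ 2 * al), (k ^ 2 * be), (k ^ 2 * ga / c ^ 2). split; [|split]; intros x;
  destruct (pt x) as (w1 & L & E & D).
- apply Derive_correct. exact (proj2 (locally_singleton _ _ L)).
- rewrite (proj1 (locally_singleton _ _ L)).
  transitivity (c ^ 2 * k ^ 2 * (w1 (k * x + u0) * w1 (k * x + u0))); [ring|]. rewrite E. field.
    exact Hc.
- apply (is_derive_ext_loc (fun t => c * (k * w1 (k * t + u0)))).
  + revert L. apply filter_imp. intros t [Ht _]. now rewrite Ht.
  + evar_last; [apply is_derive_scal, is_derive_scal;
      apply (is_derive_comp (V := R_NormedModule) w1 (fun x => k * x + u0)); [exact D|apply dlin]|].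
    unfold scal; simpl; unfold mult; simpl. field. exact Hc.
Qed.

Lemma quadratic_three_roots (e0 e1 e2 s1 s2 s3 : R) : s1 <> s2 -> s1 <> s3 -> s2 <> s3 ->
  e0 + e1 * s1 + e2 * s1 ^ 2 = 0 -> e0 + e1 * s2 + e2 * s2 ^ 2 = 0 ->
    e0 + e1 * s3 + e2 * s3 ^ 2 = 0 ->
  e1 = 0 /\ e2 = 0.
Proof.
intros H12 H13 H23 E1 E2 E3.
assert (K1 : e1 + e2 * (s1 + s2) = 0) by (apply Rmult_eq_reg_l with (s1 - s2); [|lra];
  ring_simplify; lra).
assert (K2 : e1 + e2 * (s1 + s3) = 0) by (apply Rmult_eq_reg_l with (s1 - s3); [|lra];
  ring_simplify; lra).
assert (K3 : e2 = 0) by (apply Rmult_eq_reg_l with (s2 - s3); [|lra]; ring_simplify; lra).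
subst e2. lra.
Qed.

Record profile_facts (a b : R) (v : R -> R) : Prop := {
  pf_0 : v 0 = 2 * b;
  pf_derive : forall x, is_derive v x (Derive v x);
  pf_first : forall x, Derive v x ^ 2 = - ((v x ^ 2 - 4 * a ^ 2) * (v x ^ 2 - 4 * b ^ 2));
  pf_second : forall x, is_derive (Derive v) x (4 * (a ^ 2 + b ^ 2) * v x - 2 * v x ^ 3);
  pf_sign : forall x, 0 < v x / (2 * b);
  pf_low : forall x, Rmin (4 * a ^ 2) (4 * b ^ 2) <= v x ^ 2;
  pf_high : forall x, v x ^ 2 <= Rmax (4 * a ^ 2) (4 * b ^ 2) }.

(** The prescribed first-order equation does not determine [v''] at the zeros of [v'].  The quartic
    of the Jacobian function supplies it: a nonconstant [v] takes three values with distinct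
    squares, so that quartic is the prescribed one.  If [a ^ 2 = b ^ 2], then [v] is constant.  Finally [v] has
    no zero, since there [v' ^ 2] would be negative. *)
Lemma profile_has_facts a b v : a <> 0 -> b <> 0 -> profile a b v -> profile_facts a b v.
Proof.
intros Ha Hb (HJ & Hnc & Hv1 & Hv0).
destruct (jacobian_elliptic_ode v HJ) as (A & B & G & D1 & E & D2); [rewrite Hv0; lra|].
assert (Ha2 : 0 < a ^ 2) by (apply pow2_gt_0; assumption). assert (Hb2 : 0 < b ^ 2)
  by (apply pow2_gt_0; assumption).
assert (Cv : continuity v).
{ intros x. apply continuity_pt_filterlim, (ex_derive_continuous (V := R_NormedModule)). eexists;
    apply D1. }
assert (Hsq : forall x, (v x ^ 2 - 4 * a ^ 2) * (v x ^ 2 - 4 * b ^ 2) <= 0).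
{ intros x. generalize (pow2_ge_0 (Derive v x)). rewrite Hv1. lra. }
assert (Hlow : forall x, Rmin (4 * a ^ 2) (4 * b ^ 2) <= v x ^ 2).
{ intros x. apply Rnot_lt_le. intros K. generalize (Rmin_l (4 * a ^ 2) (4 * b ^ 2))
    (Rmin_r (4 * a ^ 2) (4 * b ^ 2)) (Hsq x). intros. nra. }
assert (Hhigh : forall x, v x ^ 2 <= Rmax (4 * a ^ 2) (4 * b ^ 2)).
{ intros x. apply Rnot_lt_le. intros K. generalize (Rmax_l (4 * a ^ 2) (4 * b ^ 2))
    (Rmax_r (4 * a ^ 2) (4 * b ^ 2)) (Hsq x). intros. nra. }
assert (Hmin : 0 < Rmin (4 * a ^ 2) (4 * b ^ 2)) by (apply Rmin_pos; lra).
assert (Hne : forall x, v x <> 0) by (intros x K; specialize (Hlow x); rewrite K, pow_i in Hlow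
  by lia; lra).
(* intermediate values: a change of sign would produce a zero of [v] *)
assert (Hsame : forall x y, 0 < v x * v y).
{ intros x y. apply Rnot_le_lt. intros K.
  destruct (IVT_gen v x y 0 Cv) as [z [_ Hz]]; [|now apply (Hne z)].
  generalize (Hne x) (Hne y). intros. unfold Rmin, Rmax. destruct Rle_dec as [L|L];
    [|apply Rnot_le_lt in L]; split; apply Rnot_lt_le; intros; nra. }
assert (Hsign : forall x, 0 < v x / (2 * b)).
{ intros x. specialize (Hsame x 0). rewrite Hv0 in Hsame.
  replace (v x / (2 * b)) with (v x * (2 * b) * / (4 * b ^ 2)) by (field; assumption).
  apply Rmult_lt_0_compat; [assumption|]. apply Rinv_0_lt_compat. lra. }
constructor; auto.
intros x. destruct (Req_dec (a ^ 2) (b ^ 2)) as [Eab|Nab].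
- assert (Hc : forall t, v t = 2 * b).
  { intros t. generalize (Hsq t) (Hsign t). rewrite Eab. intros K1 K2.
    assert (K3 : v t ^ 2 - 4 * b ^ 2 = 0) by nra.
    assert (K4 : (v t - 2 * b) * (v t + 2 * b) = 0) by lra.
    apply Rmult_integral in K4. destruct K4 as [K4|K4]; [lra|]. exfalso.
    assert (v t = - (2 * b)) as K5 by lra. rewrite K5 in K2. replace (- (2 * b) / (2 * b)) with
      (-1) in K2 by (field; assumption). lra. }
  evar_last.
  + apply (is_derive_ext (fun _ => 0)); [|apply (is_derive_const (V := R_NormedModule))].
    intros t. symmetry. rewrite (Derive_ext v (fun _ => 2 * b)) by assumption. apply Derive_const.
  + rewrite Hc, Eab. unfold zero; simpl. ring.
- destruct (Hnc Nab) as (x1 & x3 & H13).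
  destruct (IVT_gen v x1 x3 ((v x1 + v x3) / 2) Cv) as [x2 [_ H2]].
  { unfold Rmin, Rmax. destruct Rle_dec; lra. }
  assert (Hpoly : forall t, (A + 16 * a ^ 2 * b ^ 2) + (B - 4 * (a ^ 2 + b ^ 2)) * v
    t ^ 2 + (G + 1) * (v t ^ 2) ^ 2 = 0).
  { intros t. assert (K := E t). rewrite Hv1 in K. ring_simplify. ring_simplify in K. lra. }
  assert (Hinj : forall s t, v s <> v t -> v s ^ 2 <> v t ^ 2).
  { intros s t Hst K. assert (K' : (v s - v t) * (v s + v t) = 0) by lra.
      apply Rmult_integral in K'.
    destruct K' as [K'|K']; [lra|]. generalize (Hsame s t). replace (v s) with (- v t) by lra. nra.
      }
  destruct (quadratic_three_roots _ _ _ _ _ _ (Hinj x1 x2 ltac:(lra)) (Hinj x1 x3 H13)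
    (Hinj x2 x3 ltac:(lra)) (Hpoly x1) (Hpoly x2) (Hpoly x3)) as [KB KG].
  evar_last; [apply D2|]. replace B with (4 * (a ^ 2 + b ^ 2)) by lra. replace G with (-1) by lra.
    ring.
Qed.

(** * The plus factor and the real factor *)

Local Open Scope C_scope.

Lemma mscal_antidiag s p q : mscal s (mat2 0 p q 0) = mat2 0 (s * p) (s * q) 0.
Proof. rewrite mscal_mat2. apply mat2_eq; ring. Qed.

Lemma mexp_mscal_antidiag s p q : mexp (mscal s (mat2 0 p q 0)) =
  mat2 (cosq (s * s * (p * q))) (s * p * sinq (s * s * (p * q))) (s * q * sinq (s * s * (p * q)))
    (cosq (s * s * (p * q))).
Proof.
rewrite mscal_antidiag, mexp_antidiag. replace (s * p * (s * q)) with (s * s * (p * q)) by ring.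
  reflexivity.
Qed.

(** Uses [sinq' (w) * 2 w + sinq w = cosq w] ([holo_sinq]). *)
Lemma mderiv_mexp (sg : R -> C) t sg' p q : cderiv sg t sg' ->
  mderiv (fun u => mexp (mscal (sg u) (mat2 0 p q 0))) t
    (mscal sg' (mmul (mat2 0 p q 0) (mexp (mscal (sg t) (mat2 0 p q 0))))).
Proof.
intros Hs. apply (mderiv_ext _ _ _ _ (fun u => eq_sym (mexp_mscal_antidiag (sg u) p q))).
rewrite mexp_mscal_antidiag, mmul_mat2, mscal_mat2.
assert (Hw : cderiv (fun u => sg u * sg u * (p * q)) t (2 * sg t * sg' * (p * q))).
{ eapply cderiv_val; [apply cderiv_mult; [apply cderiv_mult; exact Hs|apply cderiv_const]|].
    cbv beta; ring. }
set (w := sg t * sg t * (p * q)) in *.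
assert (Hc : cderiv (fun u => cosq (sg u * sg u * (p * q))) t
  (sinq w / 2 * (2 * sg t * sg' * (p * q))))
  by (apply (cderiv_holo_comp cosq); [apply holo_cosq|exact Hw]).
destruct (holo_sinq w) as [l [Hl El]].
assert (H2 : cderiv (fun u => sinq (sg u * sg u * (p * q))) t (l * (2 * sg t * sg' * (p * q))))
  by (apply (cderiv_holo_comp sinq); [exact Hl|exact Hw]).
assert (N2 : RtoC 2 <> 0) by (intros N; apply RtoC_inj in N; lra).
apply mderiv_mat2.
- eapply cderiv_val; [exact Hc|]. cbv beta; field.
- eapply cderiv_val; [apply cderiv_mult; [apply cderiv_mult;
    [exact Hs|apply cderiv_const]|exact H2]|].
  fold w. rewrite <- El. unfold w. ring.
- eapply cderiv_val; [apply cderiv_mult; [apply cderiv_mult;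
    [exact Hs|apply cderiv_const]|exact H2]|].
  fold w. rewrite <- El. unfold w. ring.
- eapply cderiv_val; [exact Hc|]. cbv beta; field.
Qed.

(** Liouville's formula when the trace vanishes. *)
Lemma cderiv_mdet F t W : mderiv F t (mmul W (F t)) -> entry W 0 0 + entry W 1 1 = 0 ->
  cderiv (fun u => mdet (F u)) t 0.
Proof.
intros (H1 & H2 & H3 & H4) HW. unfold mdet.
eapply cderiv_val; [apply cderiv_minus; apply cderiv_mult; eassumption|].
rewrite !entry_mmul by lia.
replace (entry W 1 1) with (- entry W 0 0); [ring|].
replace (entry W 1 1) with (entry W 0 0 + entry W 1 1 + - entry W 0 0) by ring. rewrite HW. ring.
Qed.

Lemma mexp_0 p q : mexp (mscal 0 (mat2 0 p q 0)) = Mid.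
Proof.
rewrite mexp_mscal_antidiag. replace (0 * 0 * (p * q)) with (RtoC 0) by ring.
assert (E : cosq 0 = 1).
{ unfold cosq. rewrite Cpseries_0 by apply entire_cosq. unfold cosq_coef. simpl. now rewrite Rinv_1.
    }
rewrite E. apply mat2_eq; ring.
Qed.

Lemma mdet_mexp s p q : mdet (mexp (mscal s (mat2 0 p q 0))) = 1.
Proof.
transitivity (mdet (mexp (mscal (RtoC 1 * s) (mat2 0 p q 0)))); [now rewrite Cmult_1_l|].
transitivity (mdet (mexp (mscal (RtoC 0 * s) (mat2 0 p q 0)))).
- apply (cderiv_zero_const (fun u => mdet (mexp (mscal (RtoC u * s) (mat2 0 p q 0)))) 0%R 1%R).
    intros t _.
  apply (cderiv_mdet _ _ (mscal s (mat2 0 p q 0))).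
  + assert (Hs : cderiv (fun u => RtoC u * s) t s).
    { eapply cderiv_val; [apply cderiv_mult; [apply (cderiv_RtoC (fun u => u) t 1%R),
        (is_derive_id (K := R_AbsRing))|apply cderiv_const]|]. cbv beta; ring. }
    eapply mderiv_val; [apply (mderiv_mexp _ _ _ _ _ Hs)|].
    generalize (mexp (mscal (RtoC t * s) (mat2 0 p q 0))). intros M. mat_ring.
  + rewrite mscal_antidiag. unfold entry, coeff_mat. simpl. ring.
- rewrite Cmult_0_l, mexp_0. unfold Mid. rewrite mdet_mat2. ring.
Qed.

Lemma mexp_opp s p q : mexp (mscal (- s) (mat2 0 p q 0)) = adj (mexp (mscal s (mat2 0 p q 0))).
Proof.
rewrite !mexp_mscal_antidiag, adj_mat2. replace (- s * - s * (p * q)) with (s * s * (p * q))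
  by ring. apply mat2_eq; ring.
Qed.

Lemma mexp_conj s p q : mconjT (mexp (mscal s (mat2 0 p q 0))) = mexp
  (mscal (Cconj s) (mat2 0 (Cconj q) (Cconj p) 0)).
Proof.
rewrite !mexp_mscal_antidiag, mconjT_mat2, !Cmult_conj. unfold cosq, sinq. rewrite !Cpseries_conj,
  !Cmult_conj.
replace (Cconj q * Cconj p) with (Cconj p * Cconj q) by ring. reflexivity.
Qed.

Lemma mexp_comm s p q : mmul (mat2 0 p q 0) (mexp (mscal s (mat2 0 p q 0))) = mmul
  (mexp (mscal s (mat2 0 p q 0))) (mat2 0 p q 0).
Proof. rewrite mexp_mscal_antidiag, !mmul_mat2. apply mat2_eq; ring. Qed.

(** [alpha] and [z * beta] are the entries of the connection of the plus factor after the gauge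
    transformation [diag (1 / d, d)] with [d = sqrt (v / (2 b))]. *)
Definition alpha (b : R) (v : R -> R) (x : R) : R := (v x ^ 2 / (2 * b))%R.
Definition beta (a b : R) (v : R -> R) (x : R) : R := (8 * a * b ^ 2 / v x ^ 2)%R.

Definition gauge (b : R) (v : R -> R) (x : R) : M2 :=
  mat2 (RtoC (/ sqrt (v x / (2 * b)))) 0 0 (RtoC (sqrt (v x / (2 * b)))).

(** The fundamental solution of the antidiagonal system with entries [g] and [z h]. *)
Definition transfer (g h : R -> R) (x : R) (z : C) : M2 :=
  mat2 (iter_series 0 g h x z) (iter_series 1 g h x z) (z * iter_series 1 h g x z)
    (iter_series 0 h g x z).

Definition plus_factor (a b : R) (v : R -> R) (x : R) (z : C) : M2 :=
  mmul (gauge b v x) (transfer (alpha b v) (beta a b v) x z).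

(** The matrix [W] with [B' = W B]: polynomial in [z], and upper triangular with real diagonal at
    [z = 0]. *)
Definition plus_connection (a b : R) (v : R -> R) (x : R) (z : C) : M2 :=
  mat2 (RtoC (- (Derive v x / (2 * v x)))) (RtoC (v x)) (RtoC (4 * a * b / v x) * z)
    (RtoC (Derive v x / (2 * v x))).

(** The matrix [V = B A B ^ -1], selfadjoint with respect to [z -> 1 / conj z]. *)
Definition lax_matrix (a b : R) (v : R -> R) (x : R) (z : C) : M2 :=
  mat2 (RtoC (- (Derive v x / (2 * v x)))) (RtoC (v x / 2) + RtoC (2 * a * b / v x) * / z)
       (RtoC (v x / 2) + RtoC (2 * a * b / v x) * z) (RtoC (Derive v x / (2 * v x))).

Lemma mderiv_transfer M g h x z : bounded_cont M g -> bounded_cont M h ->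
  mderiv (fun x => transfer g h x z) x (mmul (mat2 0 (RtoC (g x)) (z * RtoC (h x)) 0)
    (transfer g h x z)).
Proof.
intros Hg Hh. unfold transfer. rewrite mmul_mat2. apply mderiv_mat2.
- eapply cderiv_val; [now apply (cderiv_iter_series_0 M)|]. ring.
- eapply cderiv_val; [now apply (cderiv_iter_series_1 M)|]. ring.
- eapply cderiv_val; [apply cderiv_mult; [apply cderiv_const|now apply (cderiv_iter_series_1 M)]|].
    cbv beta; ring.
- eapply cderiv_val; [now apply (cderiv_iter_series_0 M)|]. ring.
Qed.

Lemma transfer_0 M g h z : bounded_cont M g -> bounded_cont M h -> transfer g h 0 z = Mid.
Proof.
intros Hg Hh. unfold transfer. rewrite !(iter_series_at_0 M) by auto. apply mat2_eq; simpl; ring.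
Qed.

Local Open Scope R_scope.

Lemma profile_neq_0 a b v x : profile_facts a b v -> b <> 0 -> v x <> 0.
Proof.
intros H Hb K. assert (L := pf_sign _ _ _ H x). rewrite K in L. unfold Rdiv in L.
  rewrite Rmult_0_l in L. lra.
Qed.

Lemma bounded_cont_alpha_beta a b v : profile_facts a b v -> a <> 0 -> b <> 0 ->
  exists M, bounded_cont M (alpha b v) /\ bounded_cont M (beta a b v).
Proof.
intros H Ha Hb.
assert (Hn := fun x => profile_neq_0 a b v x H Hb).
assert (Ha2 : 0 < a ^ 2) by (apply pow2_gt_0; assumption). assert (Hb2 : 0 < b ^ 2)
  by (apply pow2_gt_0; assumption).
set (lo := Rmin (4 * a ^ 2) (4 * b ^ 2)). set (hi := Rmax (4 * a ^ 2) (4 * b ^ 2)).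
assert (Hlo : 0 < lo) by (apply Rmin_pos; lra).
assert (Hhi : 0 < hi) by (apply Rlt_le_trans with (4 * a ^ 2); [lra|apply Rmax_l]).
assert (Hab : 0 < Rabs (/ (2 * b))) by (apply Rabs_pos_lt, Rinv_neq_0_compat; lra).
assert (Hpos : 0 <= Rabs (8 * a * b ^ 2)) by apply Rabs_pos.
assert (Hil : 0 < / lo) by now apply Rinv_0_lt_compat.
exists (hi * Rabs (/ (2 * b)) + Rabs (8 * a * b ^ 2) * / lo).
assert (P1 : 0 <= hi * Rabs (/ (2 * b))) by (apply Rmult_le_pos; lra).
assert (P2 : 0 <= Rabs (8 * a * b ^ 2) * / lo) by (apply Rmult_le_pos; lra).
split; split.
- intros t. apply (ex_derive_continuous (V := R_NormedModule)). unfold alpha. auto_derive. eexists;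
    apply (pf_derive _ _ _ H).
- intros t. unfold alpha, Rdiv. rewrite Rabs_mult, (Rabs_pos_eq (v t ^ 2)) by apply pow2_ge_0.
  assert (v t ^ 2 * Rabs (/ (2 * b)) <= hi * Rabs (/ (2 * b)))
    by (apply Rmult_le_compat_r; [lra|apply (pf_high _ _ _ H)]). lra.
- intros t. apply (ex_derive_continuous (V := R_NormedModule)). unfold beta. auto_derive.
  split; [eexists; apply (pf_derive _ _ _ H)|]. split; [|exact I]. specialize (Hn t). intros K.
  assert (v t * v t <> 0) by (apply Rmult_integral_contrapositive; auto). apply H0. simpl in K. lra.
- intros t. unfold beta, Rdiv. rewrite Rabs_mult.
  assert (L := pf_low _ _ _ H t). fold lo in L.
  assert (Rabs (/ v t ^ 2) <= / lo).
  { rewrite Rabs_pos_eq; [apply Rinv_le_contravar; lra|]. left; apply Rinv_0_lt_compat; lra. }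
  assert (Rabs (8 * a * b ^ 2) * Rabs (/ v t ^ 2) <= Rabs (8 * a * b ^ 2) * / lo)
    by (apply Rmult_le_compat_l; lra). lra.
Qed.

Lemma sqrt_profile a b v : profile_facts a b v -> b <> 0 -> forall x,
  let d := sqrt (v x / (2 * b)) in
  0 < d /\ v x = 2 * b * (d * d) /\ is_derive (fun t => sqrt (v t / (2 * b))) x
    (Derive v x / (4 * b * d)).
Proof.
intros H Hb x d. assert (Hp := pf_sign _ _ _ H x).
assert (Hd : 0 < d) by now apply sqrt_lt_R0.
assert (E : d * d = v x / (2 * b)) by (apply sqrt_sqrt; lra).
split; [exact Hd|split].
- rewrite E. field. assumption.
- evar_last.
  + apply (is_derive_sqrt (fun t => v t / (2 * b)) x (/ (2 * b) * Derive v x)); [|exact Hp].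
    apply (is_derive_ext (fun t => / (2 * b) * v t)); [intros; unfold Rdiv; apply Rmult_comm|].
    apply is_derive_scal, (pf_derive _ _ _ H).
  + fold d. field. lra.
Qed.
Local Open Scope C_scope.

Lemma RtoC_neq_0 x : x <> 0%R -> RtoC x <> 0.
Proof. intros H N. apply RtoC_inj in N. auto. Qed.

Lemma mderiv_gauge a b v x : profile_facts a b v -> b <> 0%R ->
  mderiv (gauge b v) x (mat2 (RtoC (- (Derive v x / (4 * b * sqrt (v x / (2 * b))) /
    (sqrt (v x / (2 * b)) * sqrt (v x / (2 * b)))))) 0 0
    (RtoC (Derive v x / (4 * b * sqrt (v x / (2 * b)))))).
Proof.
intros H Hb. destruct (sqrt_profile a b v H Hb x) as [Hd [_ D]].
unfold gauge. apply mderiv_mat2; try apply cderiv_const.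
- apply (cderiv_RtoC (fun u => / sqrt (v u / (2 * b)))%R). evar_last;
    [apply is_derive_inv; [exact D|cbv beta; lra]|]. cbv beta. field. lra.
- apply (cderiv_RtoC (fun u => sqrt (v u / (2 * b)))%R). exact D.
Qed.

(** Since [v = 2 b d ^ 2], all the coefficients are rational in [d] and [v']. *)
Lemma mderiv_plus_factor a b v x (z : C) : profile_facts a b v -> a <> 0%R -> b <> 0%R ->
  mderiv (fun x => plus_factor a b v x z) x (mmul (plus_connection a b v x z)
    (plus_factor a b v x z)).
Proof.
intros H Ha Hb. destruct (bounded_cont_alpha_beta a b v H Ha Hb) as (M & Hal & Hbe).
unfold plus_factor. eapply mderiv_val; [apply mderiv_mmul;
  [now apply (mderiv_gauge a)|now apply (mderiv_transfer M)]|].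
destruct (sqrt_profile a b v H Hb x) as [Hd [Hv _]].
generalize (transfer (alpha b v) (beta a b v) x z). intros T. unfold gauge, plus_connection, alpha,
  beta.
set (d := sqrt (v x / (2 * b))) in *. set (p := Derive v x). clearbody d p. rewrite Hv.
assert (E00 : (- (p / (2 * (2 * b * (d * d)))) * / d = - (p / (4 * b * d) / (d * d)))%R)
  by (field; lra).
assert (E01 : (2 * b * (d * d) * d = / d * ((2 * b * (d * d)) ^ 2 / (2 * b)))%R) by (field; lra).
assert (E10 : (4 * a * b / (2 * b * (d * d)) * / d = d * (8 * a * b ^ 2 / (2 * b * (d * d)) ^ 2))%R)
  by (field; lra).
assert (E11 : (p / (2 * (2 * b * (d * d))) * d = p / (4 * b * d))%R) by (field; lra).
apply (f_equal RtoC) in E00, E01, E10, E11. rewrite RtoC_mult in E00, E11.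
rewrite !(RtoC_mult _ (/ d)), !(RtoC_mult d) in E10. rewrite (RtoC_mult (/ d)),
  (RtoC_mult _ d) in E01.
transitivity (mmul (mmul (mat2 (RtoC (- (p / (2 * (2 * b * (d * d)))))) (RtoC (2 * b * (d * d)))
   (RtoC (4 * a * b / (2 * b * (d * d))) * z) (RtoC (p / (2 * (2 * b * (d * d))))))
     (mat2 (RtoC (/ d)) 0 0 (RtoC d))) T); [|now rewrite mmul_assoc].
rewrite (mmul_mat2 (RtoC (- (p / (2 * (2 * b * (d * d))))))).
replace (RtoC (- (p / (2 * (2 * b * (d * d))))) * RtoC (/ d) + RtoC (2 * b * (d * d)) * 0) with
  (RtoC (- (p / (4 * b * d) / (d * d)))) by (rewrite <- E00; ring).
replace (RtoC (- (p / (2 * (2 * b * (d * d))))) * 0 + RtoC (2 * b * (d * d)) * RtoC d) with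
  (RtoC (/ d) * RtoC ((2 * b * (d * d)) ^ 2 / (2 * b))) by (rewrite <- E01; ring).
replace (RtoC (4 * a * b / (2 * b * (d * d))) * z * RtoC (/ d) + RtoC
  (p / (2 * (2 * b * (d * d)))) * 0) with (RtoC d * RtoC
  (8 * a * b ^ 2 / (2 * b * (d * d)) ^ 2) * z) by (rewrite <- E10; ring).
replace (RtoC (4 * a * b / (2 * b * (d * d))) * z * 0 + RtoC (p / (2 * (2 * b * (d * d)))) * RtoC d)
  with (RtoC (p / (4 * b * d))) by (rewrite <- E11; ring).
revert T. refine (M2_destruct _ _). intros t1 t2 t3 t4. rewrite !mmul_mat2, madd_mat2.
  apply mat2_eq; ring.
Qed.

Lemma plus_factor_0 a b v z : profile_facts a b v -> a <> 0%R -> b <> 0%R ->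
  plus_factor a b v 0 z = Mid.
Proof.
intros H Ha Hb. destruct (bounded_cont_alpha_beta a b v H Ha Hb) as (M & Hal & Hbe).
unfold plus_factor. rewrite (transfer_0 M), mmul_1_r by assumption. unfold gauge.
rewrite (pf_0 _ _ _ H). replace (2 * b / (2 * b))%R with 1%R by (field; assumption).
rewrite sqrt_1, Rinv_1. reflexivity.
Qed.

Lemma mdet_plus_factor a b v x (z : C) : profile_facts a b v -> a <> 0%R -> b <> 0%R ->
  mdet (plus_factor a b v x z) = 1.
Proof.
intros H Ha Hb. transitivity (mdet (plus_factor a b v 0 z)).
- apply (cderiv_zero_const (fun u => mdet (plus_factor a b v u z))). intros t _.
  apply (cderiv_mdet _ _ (plus_connection a b v t z)); [now apply mderiv_plus_factor|].
  unfold plus_connection, entry, coeff_mat. simpl. rewrite RtoC_opp. ring.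
- rewrite plus_factor_0 by assumption. unfold Mid. rewrite mdet_mat2. ring.
Qed.

Lemma RtoC_halves a b u : u <> 0%R ->
  RtoC (u / 2) = RtoC u / 2 /\ RtoC (2 * a * b / u) = 2 * RtoC a * RtoC b / RtoC u /\
  RtoC (4 * a * b / u) = 4 * RtoC a * RtoC b / RtoC u.
Proof.
intros Hu. rewrite !RtoC_div, !RtoC_mult by (assumption || lra). auto.
Qed.

(** The Lax equation [V' = W V - V W], written with [adj W = - W]; the diagonal uses the
    second-order equation of [v] and its first integral. *)
Lemma mderiv_lax_matrix a b v x (z : C) : profile_facts a b v -> a <> 0%R -> b <> 0%R -> z <> 0 ->
  mderiv (fun x => lax_matrix a b v x z) x
    (madd (mmul (plus_connection a b v x z) (lax_matrix a b v x z))
      (mmul (lax_matrix a b v x z) (adj (plus_connection a b v x z)))).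
Proof.
intros H Ha Hb Hz. assert (Hv := profile_neq_0 a b v x H Hb).
assert (D := pf_derive _ _ _ H x). assert (D2 := pf_second _ _ _ H x).
  assert (P2 := pf_first _ _ _ H x).
assert (Dv : is_derive (fun t => v t / 2)%R x (Derive v x / 2)%R).
{ apply (is_derive_ext (fun t => / 2 * v t)%R); [intros; unfold Rdiv; apply Rmult_comm|].
  evar_last; [apply is_derive_scal; exact D|]. unfold Rdiv. apply Rmult_comm. }
assert (Dk : is_derive (fun t => 2 * a * b / v t)%R x (- (2 * a * b * Derive v x / (v x * v x)))%R).
{ apply (is_derive_ext (fun t => 2 * a * b * / v t)%R); [reflexivity|].
  evar_last; [apply is_derive_scal, is_derive_inv; [exact D|exact Hv]|]. cbv beta. field. exact Hv.
    }
assert (Dw : is_derive (fun t => Derive v t / (2 * v t))%R x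
  ((16 * a ^ 2 * b ^ 2 - v x ^ 4) / (2 * (v x * v x)))%R).
{ evar_last; [apply is_derive_div; [exact D2|apply is_derive_scal; exact D|lra]|]. cbv beta.
  replace ((4 * (a ^ 2 + b ^ 2) * v x - 2 * v x ^ 3) * (2 * v x) - (2 * Derive v x) * Derive v x)%R
    with
     ((4 * (a ^ 2 + b ^ 2) * v x - 2 * v x ^ 3) * (2 * v x) - 2 * (Derive v x ^ 2))%R by ring.
  replace (Derive v x * (2 * Derive v x))%R with (2 * (Derive v x ^ 2))%R by ring.
  rewrite P2. field. exact Hv. }
destruct (RtoC_halves a b (v x) Hv) as (R1 & R2 & R3).
assert (Hcv := RtoC_neq_0 _ Hv).
unfold lax_matrix at 1. eapply mderiv_val.
- apply mderiv_mat2.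
  + apply (cderiv_RtoC (fun t => - (Derive v t / (2 * v t)))%R).
      apply (is_derive_opp (V := R_NormedModule)). exact Dw.
  + apply cderiv_plus; [apply (cderiv_RtoC (fun t => v t / 2)%R); exact Dv|].
    apply cderiv_mult; [apply (cderiv_RtoC (fun t => 2 * a * b / v t)%R);
      exact Dk|apply cderiv_const].
  + apply cderiv_plus; [apply (cderiv_RtoC (fun t => v t / 2)%R); exact Dv|].
    apply cderiv_mult; [apply (cderiv_RtoC (fun t => 2 * a * b / v t)%R);
      exact Dk|apply cderiv_const].
  + apply (cderiv_RtoC (fun t => Derive v t / (2 * v t))%R). exact Dw.
- cbv beta. unfold plus_connection, lax_matrix. rewrite adj_mat2, !mmul_mat2, madd_mat2, R1, R2, R3.
  set (p := Derive v x) in *. clearbody p.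
  assert (Hvv : (v x * v x)%R <> 0%R) by now apply Rmult_integral_contrapositive.
  unfold opp; simpl.
  rewrite !RtoC_opp, !RtoC_div, !RtoC_minus, !RtoC_mult, ?RtoC_pow by (assumption || lra).
  apply mat2_eq; field; try split; assumption.
Qed.

(** The derivative of the left-hand side vanishes by the Lax equation, and at [x = 0] it is [V],
    which is [A] because [v = 2 b] and [v' = 0] there. *)
Lemma conj_A_plus_factor a b v x (z : C) : profile_facts a b v -> a <> 0%R -> b <> 0%R -> z <> 0 ->
  mmul (adj (plus_factor a b v x z)) (mmul (lax_matrix a b v x z) (plus_factor a b v x z)) = A_mat a
    b z.
Proof.
intros H Ha Hb Hz.
transitivity (mmul (adj (plus_factor a b v 0 z))
  (mmul (lax_matrix a b v 0 z) (plus_factor a b v 0 z))).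
- apply (mderiv_zero_const (fun x => mmul (adj (plus_factor a b v x z))
    (mmul (lax_matrix a b v x z) (plus_factor a b v x z)))). intros t _.
  assert (DB := mderiv_plus_factor a b v t z H Ha Hb).
    assert (DV := mderiv_lax_matrix a b v t z H Ha Hb Hz).
  eapply mderiv_val; [apply mderiv_mmul; [apply mderiv_adj, DB|apply mderiv_mmul;
    [exact DV|exact DB]]|].
  assert (HW : exists w1 w2 w3, plus_connection a b v t z = mat2 w1 w2 w3 (- w1)).
  { exists (entry (plus_connection a b v t z) 0 0), (entry (plus_connection a b v t z) 0 1),
      (entry (plus_connection a b v t z) 1 0).
    apply mat2_eq; try reflexivity. change (RtoC (Derive v t / (2 * v t)) = - RtoC
      (- (Derive v t / (2 * v t)))).
    rewrite RtoC_opp. ring. }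
  destruct HW as (w1 & w2 & w3 & ->).
  generalize (plus_factor a b v t z) (lax_matrix a b v t z).
  refine (M2_destruct _ _); intros b1 b2 b3 b4; refine (M2_destruct _ _); intros v1 v2 v3 v4.
  mat_norm. apply mat2_eq; ring.
- rewrite plus_factor_0 by assumption. rewrite mmul_1_r. replace (adj Mid) with Mid
    by (unfold Mid; rewrite adj_mat2; apply mat2_eq; ring).
  rewrite mmul_1_l. unfold lax_matrix, A_mat.
  assert (P2 := pf_first _ _ _ H 0%R). rewrite (pf_0 _ _ _ H) in *.
  assert (P0 : Derive v 0 = 0%R) by nra. rewrite P0.
  replace (0 / (2 * (2 * b)))%R with 0%R by (field; assumption). rewrite Ropp_0.
  replace (2 * b / 2)%R with b by field. replace (2 * a * b / (2 * b))%R with a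
    by (field; assumption).
  apply mat2_eq; ring.
Qed.

Definition real_factor (a b : R) (v : R -> R) (x y : R) (z : C) : M2 :=
  mmul (Phi_mat a b x y z) (adj (plus_factor a b v x z)).

(** [Omega = V - W], since [adj W = - W]. *)
Definition real_connection (a b : R) (v : R -> R) (x : R) (z : C) : M2 :=
  madd (lax_matrix a b v x z) (adj (plus_connection a b v x z)).

Lemma mderiv_real_factor a b v x y (z : C) : profile_facts a b v -> a <> 0%R -> b <> 0%R ->
  z <> 0 ->
  mderiv (fun x => real_factor a b v x y z) x (mmul (real_factor a b v x y z)
    (real_connection a b v x z)).
Proof.
intros H Ha Hb Hz.
assert (Hs : cderiv (fun t => (t, y) : C) x 1).
{ split; simpl; [apply (is_derive_id (K := R_AbsRing))|apply (is_derive_const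
    (V := R_NormedModule))]. }
unfold real_factor, Phi_mat. eapply mderiv_val.
- apply mderiv_mmul; [unfold A_mat; apply (mderiv_mexp (fun t => (t, y) : C)), Hs|apply mderiv_adj,
    mderiv_plus_factor; assumption].
- cbv beta. rewrite mexp_comm.
  replace (mscal 1 (mmul (mexp (mscal (x, y) (mat2 0 (a * / z + b) (a * z + b) 0)))
    (mat2 0 (a * / z + b) (a * z + b) 0))) with
    (mmul (mexp (mscal (x, y) (mat2 0 (a * / z + b) (a * z + b) 0))) (A_mat a b z))
      by (unfold A_mat; generalize (mexp (mscal (x, y) (mat2 0 (a * / z + b) (a * z + b) 0)));
      intros M; mat_ring).
  assert (E : mmul (A_mat a b z) (adj (plus_factor a b v x z)) = mmul (adj (plus_factor a b v x z))
    (lax_matrix a b v x z)).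
  { rewrite <- (conj_A_plus_factor a b v x z) by assumption. rewrite !mmul_assoc, mmul_adj_r,
      mmul_1_r by now apply mdet_plus_factor. reflexivity. }
  rewrite mmul_assoc, E, adj_mmul. unfold real_connection, A_mat.
  generalize (mexp (mscal (x, y) (mat2 0 (a * / z + b) (a * z + b) 0)))
    (adj (plus_factor a b v x z)) (lax_matrix a b v x z) (adj (plus_connection a b v x z)).
  do 4 (refine (M2_destruct _ _); intros ? ? ? ?). mat_norm. apply mat2_eq; ring.
Qed.

Lemma Cconj_RtoC x : Cconj (RtoC x) = RtoC x.
Proof. apply Ceq; simpl; ring. Qed.

Lemma real_connection_skew a b v x (z : C) : v x <> 0%R -> z <> 0 ->
  mconjT (real_connection a b v x (/ Cconj z)) = mscal (- (1)) (real_connection a b v x z).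
Proof.
intros Hv Hz. assert (Hc : Cconj z <> 0) by (apply Cmod_gt_0; rewrite Cmod_conj;
  now apply Cmod_gt_0).
destruct (RtoC_halves a b (v x) Hv) as (R1 & R2 & R3). assert (Hcv := RtoC_neq_0 _ Hv).
unfold real_connection, lax_matrix, plus_connection. rewrite !adj_mat2, !madd_mat2, mscal_mat2,
  mconjT_mat2, R1, R2, R3, RtoC_opp.
assert (I1 : / / Cconj z = Cconj z) by (field; exact Hc).
assert (N2 : RtoC 2 <> 0) by (apply RtoC_neq_0; lra).
assert (E : Cconj (/ Cconj z) = / z) by (rewrite Cinv_conj, Cconj_conj by exact Hc; reflexivity).
rewrite I1. unfold Cdiv.
repeat first [rewrite Cplus_conj|rewrite Copp_conj|rewrite Cmult_conj|rewrite Cinv_conj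
  by assumption|rewrite Cconj_conj|rewrite Cconj_RtoC].
apply mat2_eq; field; auto.
Qed.

(** The derivative of [F F ^*] vanishes because [Omega ^* = - Omega]; at [x = 0] the
    factor is [exp (i y A)], which is unitary because [A ^* = A]. *)
Lemma real_factor_real a b v x y (z : C) : profile_facts a b v -> a <> 0%R -> b <> 0%R -> z <> 0 ->
  mmul (real_factor a b v x y z) (mconjT (real_factor a b v x y (/ Cconj z))) = Mid.
Proof.
intros H Ha Hb Hz. assert (Hc : Cconj z <> 0) by
  (apply Cmod_gt_0; rewrite Cmod_conj; now apply Cmod_gt_0).
assert (Hc' : / Cconj z <> 0). { intros N. apply (Cmult_neq_0 (Cconj z) (/ Cconj z)) in Hc as K;
  [|intros N'; apply C1_nz; rewrite <- (Cinv_r (Cconj z)), N' by assumption; ring]. apply K.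
  rewrite N. ring. }
transitivity (mmul (real_factor a b v 0 y z) (mconjT (real_factor a b v 0 y (/ Cconj z)))).
- apply (mderiv_zero_const (fun x => mmul (real_factor a b v x y z)
    (mconjT (real_factor a b v x y (/ Cconj z))))). intros t _.
  eapply mderiv_val; [apply mderiv_mmul; [now apply mderiv_real_factor|apply mderiv_mconjT;
    now apply mderiv_real_factor]|].
  cbv beta. rewrite mconjT_mmul, real_connection_skew
    by (try assumption; now apply (profile_neq_0 a b)).
  generalize (real_factor a b v t y z) (mconjT (real_factor a b v t y (/ Cconj z)))
    (real_connection a b v t z).
  do 3 (refine (M2_destruct _ _); intros ? ? ? ?). mat_norm. apply mat2_eq; ring.
- unfold real_factor. rewrite !plus_factor_0 by assumption.
  replace (adj Mid) with Mid by (unfold Mid; rewrite adj_mat2; apply mat2_eq; ring).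
    rewrite !mmul_1_r.
  unfold Phi_mat, A_mat. rewrite mexp_conj.
  assert (E : Cconj (/ Cconj z) = / z) by (rewrite Cinv_conj, Cconj_conj by exact Hc; reflexivity).
  replace (Cconj (a * / Cconj z + b)) with (a * / z + b)
    by (rewrite Cplus_conj, Cmult_conj, E, !Cconj_RtoC; reflexivity).
  replace (Cconj (a * / / Cconj z + b)) with (a * z + b).
  2:{ replace (/ / Cconj z) with (Cconj z) by (field; exact Hc). rewrite Cplus_conj, Cmult_conj,
    Cconj_conj, !Cconj_RtoC; reflexivity. }
  replace (Cconj (0, y)) with (- (0, y)) by (apply Ceq; simpl; ring).
  rewrite mexp_opp. apply mmul_adj_r, mdet_mexp.
Qed.

(** * The explicit formulas *)

Lemma continuous_C_eps (h : R -> C) t :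
  (forall eps : posreal, locally t (fun u => Cmod (h u - h t) < eps)%R) ->
  continuous (T := R_UniformSpace) (U := C_UniformSpace) h t.
Proof.
intros H P HP. apply locally_C_eps in HP. destruct HP as [e He]. unfold filtermap. generalize (H e).
  apply filter_imp.
intros u Hu. apply He, Hu.
Qed.

Lemma cderiv_RInt (h : R -> C) t : (forall u, continuous (T := R_UniformSpace) (U := C_UniformSpace)
  h u) ->
  cderiv (fun t => RInt (V := C_R_CompleteNormedModule) h 0 t) t (h t).
Proof.
intros Hc.
assert (D : is_derive (K := R_AbsRing) (V := C_R_NormedModule)
  (fun t => RInt (V := C_R_CompleteNormedModule) h 0 t) t (h t)).
{ apply (is_derive_RInt (V := C_R_NormedModule) h _ 0%R t); [|apply Hc].
  apply filter_forall. intros y. apply (RInt_correct (V := C_R_CompleteNormedModule)).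
  apply (ex_RInt_continuous (V := C_R_CompleteNormedModule)). intros; apply Hc. }
apply cderiv_eps. intros eps. destruct D as [_ D]. generalize (D t (fun P HP => HP) eps).
  apply filter_imp.
intros u Hu. refine (Rle_trans _ _ _ _ Hu). right. rewrite Cmod_norm.
match goal with |- norm ?p = norm ?q => replace p with q; [reflexivity|] end.
generalize (RInt (V := C_R_CompleteNormedModule) h 0 u) (RInt (V := C_R_CompleteNormedModule) h 0 t)
  (h t).
intros [p1 p2] [q1 q2] [l1 l2].
apply Ceq; unfold minus, plus, opp, scal; simpl; unfold scal, mult, plus, opp; simpl; unfold mult;
  simpl; ring.
Qed.

(** Replacing [t] by [clamp x t] extends the integrand of [f_int] continuously beyond the segment
    from [0] to [x], so that its primitive has two-sided derivatives at the end points. *)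
Definition clamp (x t : R) : R := Rmax (Rmin 0 x) (Rmin t (Rmax 0 x)).

Lemma clamp_between x t : between x (clamp x t).
Proof.
unfold between, clamp. assert (Rmin 0 x <= Rmax 0 x)%R
  by (eapply Rle_trans; [apply Rmin_l|apply Rmax_l]).
split; [apply Rmax_l|]. apply Rmax_lub; [assumption|apply Rmin_r].
Qed.

Lemma clamp_id x t : between x t -> clamp x t = t.
Proof.
intros [H1 H2]. unfold clamp. rewrite (Rmin_left t) by assumption. apply Rmax_right; assumption.
Qed.

Lemma clamp_lipschitz x t u : (Rabs (clamp x u - clamp x t) <= Rabs (u - t))%R.
Proof.
unfold clamp, Rmax, Rmin. repeat destruct Rle_dec; unfold Rabs; repeat destruct Rcase_abs; lra.
Qed.

Lemma between_trans x t u : between x t -> (Rmin 0 t <= u <= Rmax 0 t)%R -> between x u.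
Proof. unfold between, Rmin, Rmax. repeat destruct Rle_dec; lra. Qed.

Lemma between_0 x : between x 0.
Proof. unfold between. split; [apply Rmin_l|apply Rmax_l]. Qed.

Lemma between_self x : between x x.
Proof. unfold between. split; [apply Rmin_r|apply Rmax_r]. Qed.

Lemma f_int_primitive a b v x (z : C) : profile_facts a b v -> a <> 0%R -> b <> 0%R -> z <> 0 ->
  regular_pt a b v x z ->
  exists f : R -> C, f 0%R = 0 /\ f x = f_int a b v x z /\
    forall t, between x t -> cderiv f t (2 / (1 + / (4 * a * b * z) * v t ^ 2)).
Proof.
intros H Ha Hb Hz Hreg.
set (h := fun t : R => 2 / (1 + / (4 * a * b * z) * v t ^ 2)).
assert (Hk : 4 * a * b * z <> 0) by (repeat apply Cmult_neq_0; try assumption; apply RtoC_neq_0;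
  (assumption || lra)).
assert (Hden : forall t, between x t -> 1 + / (4 * a * b * z) * v t ^ 2 <> 0).
{ intros t Ht N. apply (Hreg t Ht). replace (4 * a * b * z + v t ^ 2) with
    (4 * a * b * z * (1 + / (4 * a * b * z) * v t ^ 2))
    by (field; repeat split; try assumption; apply RtoC_neq_0; assumption).
  rewrite N. ring. }
assert (Dh : forall t, between x t -> exists l, cderiv h t l).
{ intros t Ht. eexists. unfold h, Cdiv. apply cderiv_mult; [apply cderiv_const|]. apply cderiv_inv;
    [|now apply Hden].
  apply cderiv_plus; [apply cderiv_const|]. apply cderiv_mult; [apply cderiv_const|].
  apply (cderiv_ext (fun t => RtoC (v t ^ 2))); [intros; apply RtoC_pow|]. apply cderiv_RtoC.
  apply is_derive_pow, (pf_derive _ _ _ H). }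
assert (Ch : forall t, continuous (T := R_UniformSpace) (U := C_UniformSpace)
  (fun t => h (clamp x t)) t).
{ intros t. apply continuous_C_eps. intros eps. destruct (Dh _ (clamp_between x t)) as [l Hl].
  destruct (cderiv_cont _ _ _ Hl eps) as [d Hd]. exists d. intros u Hu. apply Hd.
  change (Rabs (clamp x u - clamp x t) < d)%R. eapply Rle_lt_trans;
    [apply clamp_lipschitz|exact Hu]. }
exists (fun t => RInt (V := C_R_CompleteNormedModule) (fun t => h (clamp x t)) 0 t). split;
  [|split].
- apply (RInt_point (V := C_R_CompleteNormedModule)).
- unfold f_int. apply (RInt_ext (V := C_R_CompleteNormedModule)). intros t Ht. unfold h.
    rewrite clamp_id; [reflexivity|]. unfold between. lra.
- intros t Ht. eapply cderiv_val; [apply cderiv_RInt, Ch|]. cbv beta. rewrite clamp_id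
    by assumption. reflexivity.
Qed.

(** With [Z = B ^ -1 B_0 exp (f A)] these identities say [Z' = sg Z], where [2 sg] is the
    logarithmic derivative of [det B_0]. *)
Lemma B0_mat_ode a b v t (z : C) : profile_facts a b v -> a <> 0%R -> b <> 0%R -> z <> 0 ->
  4 * a * b * z + v t ^ 2 <> 0 ->
  let sg := Derive v t / (2 * v t) + v t * Derive v t / (4 * a * b * z + v t ^ 2) in
  exists L, mderiv (fun t => B0_mat a b v t z) t L /\
   madd (madd (mmul (adj (plus_connection a b v t z)) (B0_mat a b v t z)) L)
        (mmul (B0_mat a b v t z) (mscal (2 / (1 + / (4 * a * b * z) * v t ^ 2)) (A_mat a b z))) =
          mscal sg (B0_mat a b v t z) /\
   cderiv (fun t => mdet (B0_mat a b v t z)) t (2 * sg * mdet (B0_mat a b v t z)).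
Proof.
intros H Ha Hb Hz Hw sg. assert (Hv := profile_neq_0 a b v t H Hb). assert (Hcv := RtoC_neq_0 _ Hv).
assert (Hca := RtoC_neq_0 _ Ha). assert (Hcb := RtoC_neq_0 _ Hb).
assert (N2 : RtoC 2 <> 0) by (apply RtoC_neq_0; lra). assert (N4 : RtoC 4 <> 0)
  by (apply RtoC_neq_0; lra).
assert (D := pf_derive _ _ _ H t). assert (D2 := pf_second _ _ _ H t).
  assert (P2 := pf_first _ _ _ H t).
assert (Dc : cderiv (fun t => RtoC (v t)) t (RtoC (Derive v t))) by (apply cderiv_RtoC, D).
assert (Dp : cderiv (fun t => RtoC (Derive v t)) t (RtoC (4 * (a ^ 2 + b ^ 2) * v t - 2 * v t ^ 3)))
  by (apply cderiv_RtoC, D2).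
assert (D11 : cderiv (fun t => 4 * a * b * z + v t ^ 2) t (2 * v t * Derive v t)).
{ eapply cderiv_val; [apply cderiv_plus; [apply cderiv_const|];
    apply (cderiv_ext (fun t => RtoC (v t) * RtoC (v t))); [intros u; simpl; ring|];
    apply cderiv_mult; exact Dc|].
  cbv beta. ring. }
assert (D00 : cderiv (fun t => 2 * v t * (b + a * z)) t (2 * Derive v t * (b + a * z))).
{ eapply cderiv_val; [apply cderiv_mult; [apply cderiv_mult;
    [apply cderiv_const|exact Dc]|apply cderiv_const]|]. cbv beta. ring. }
exists (mat2 (2 * Derive v t * (b + a * z)) (- RtoC (4 * (a ^ 2 + b ^ 2) * v t - 2 * v t ^ 3)) 0
  (2 * v t * Derive v t)).
split; [|split].
- unfold B0_mat. apply mderiv_mat2; [exact D00|now apply cderiv_opp|apply cderiv_const|exact D11].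
- unfold B0_mat, plus_connection, A_mat, sg. clear D D2 Dc Dp D11 D00. mat_norm.
  destruct (RtoC_halves a b (v t) Hv) as (_ & _ & R3). rewrite R3.
  set (p := Derive v t) in *. clearbody p.
  apply (f_equal RtoC) in P2.
  rewrite !RtoC_opp, !RtoC_div, !RtoC_minus, !RtoC_mult, ?RtoC_plus, ?RtoC_pow by lra.
  rewrite RtoC_opp, RtoC_mult, !RtoC_minus, !RtoC_mult, !RtoC_pow in P2.
  generalize dependent (RtoC (v t)). intros V Hw sg HV PP R3. clear R3.
  assert (Hd : 1 + / (4 * a * b * z) * V ^ 2 <> 0).
  { intros N. apply Hw. replace (4 * a * b * z + V ^ 2) with
      (4 * a * b * z * (1 + / (4 * a * b * z) * V ^ 2)) by (field; auto). rewrite N. ring. }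
  assert (Ef : 2 / (1 + / (4 * a * b * z) * V ^ 2) = 8 * a * b * z / (4 * a * b * z + V ^ 2)).
  { field. repeat split; auto. }
  rewrite Ef. apply mat2_eq.
  + field. auto.
  + transitivity (- (p ^ 2 / (2 * V)) - V * - ((V ^ 2 - 4 * a ^ 2) * (V ^ 2 - 4 * b ^ 2)) /
      (4 * a * b * z + V ^ 2)).
    * field. auto.
    * rewrite <- PP. field. auto.
  + field. auto.
  + field. auto.
- unfold B0_mat. eapply cderiv_val.
  + apply (cderiv_ext (fun t => 2 * v t * (b + a * z) * (4 * a * b * z + v t ^ 2)));
      [intros u; rewrite mdet_mat2; ring|].
    apply cderiv_mult; [exact D00|exact D11].
  + cbv beta. rewrite mdet_mat2. unfold sg. field. auto.
Qed.

Lemma cderiv_ratio_const (f g D : R -> C) t sg : cderiv f t (sg * f t) -> cderiv g t (sg * g t) ->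
  cderiv D t (2 * sg * D t) -> D t <> 0 -> cderiv (fun u => f u * g u / D u) t 0.
Proof.
intros Hf Hg HD H0. unfold Cdiv. eapply cderiv_val.
- apply cderiv_mult; [apply cderiv_mult; eassumption|apply cderiv_inv; eassumption].
- cbv beta. field. exact H0.
Qed.

(** For [Z = B ^ -1 B_0 exp (f A)] every product of two entries is a constant multiple of [det B_0],
    as both have the same logarithmic derivative.  At [x = 0] the matrix [Z] is scalar, so it stays
    scalar, and its diagonal entry is the continuous branch of [sqrt (det B_0)]. *)
Lemma explicit_factor a b v x (z : C) : profile_facts a b v -> a <> 0%R -> b <> 0%R -> z <> 0 ->
  regular_pt a b v x z ->
  exists s : R -> C, sqrt_det_branch a b v x z s /\ s x <> 0 /\
    plus_factor a b v x z = B_formula a b v s x z.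
Proof.
intros H Ha Hb Hz Hreg.
destruct (f_int_primitive a b v x z H Ha Hb Hz Hreg) as (f & f0 & fx & Df).
assert (Hca := RtoC_neq_0 _ Ha). assert (Hcb := RtoC_neq_0 _ Hb).
assert (N2 : RtoC 2 <> 0) by (apply RtoC_neq_0; lra). assert (N4 : RtoC 4 <> 0)
  by (apply RtoC_neq_0; lra).
assert (H0 : b + a * z <> 0).
{ intros N. apply (Hreg 0%R (between_0 x)). rewrite (pf_0 _ _ _ H), RtoC_mult.
  replace (4 * a * b * z + (2 * b) ^ 2) with (4 * b * (b + a * z)) by ring. rewrite N. ring. }
pose (E := fun t => mexp (mscal (f t) (A_mat a b z))).
pose (Z := fun t => mmul (adj (plus_factor a b v t z)) (mmul (B0_mat a b v t z) (E t))).
pose (D := fun t => mdet (B0_mat a b v t z)).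
pose (sg := fun t => Derive v t / (2 * v t) + v t * Derive v t / (4 * a * b * z + v t ^ 2)).
assert (ODE : forall t, between x t -> mderiv Z t (mscal (sg t) (Z t)) /\
  cderiv D t (2 * sg t * D t)).
{ intros t Ht. destruct (B0_mat_ode a b v t z H Ha Hb Hz (Hreg t Ht)) as (L & D1 & EL & D2). split;
    [|exact D2].
  assert (DE := mderiv_mexp f t _ (a * / z + b) (a * z + b) (Df t Ht)).
  unfold Z, E. eapply mderiv_val.
  - apply mderiv_mmul; [apply mderiv_adj; now apply mderiv_plus_factor|apply mderiv_mmul;
      [exact D1|exact DE]].
  - cbv beta. change (mat2 0 (a * / z + b) (a * z + b) 0) with (A_mat a b z). rewrite adj_mmul.
    fold (sg t) in EL.
    transitivity (mmul (adj (plus_factor a b v t z))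
      (mmul (mscal (sg t) (B0_mat a b v t z)) (mexp (mscal (f t) (A_mat a b z)))));
      [rewrite <- EL|now rewrite mmul_mscal_l, mmul_mscal_r].
    generalize (adj (plus_factor a b v t z)) (adj (plus_connection a b v t z)) (B0_mat a b v t z)
      (A_mat a b z) (mexp (mscal (f t) (A_mat a b z)))
      (2 / (1 + / (4 * a * b * z) * v t ^ 2)) L. clear.
    do 5 (refine (M2_destruct _ _); intros ? ? ? ?). intros k. refine (M2_destruct _ _). intros.
      mat_norm. apply mat2_eq; ring. }
assert (Dne : forall t, between x t -> D t <> 0).
{ intros t Ht. unfold D, B0_mat. rewrite mdet_mat2.
    assert (Hv := RtoC_neq_0 _ (profile_neq_0 a b v t H Hb)).
  replace (2 * v t * (b + a * z) * (4 * a * b * z + v t ^ 2) - - Derive v t * 0) with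
    (2 * v t * (b + a * z) * (4 * a * b * z + v t ^ 2)) by ring.
  repeat apply Cmult_neq_0; auto. }
assert (Z0 : Z 0%R = mscal (4 * b * (b + a * z)) Mid).
{ unfold Z, E. rewrite plus_factor_0, f0 by assumption. unfold A_mat. rewrite mexp_0, mmul_1_r.
  replace (adj Mid) with Mid by (unfold Mid; rewrite adj_mat2; apply mat2_eq; ring).
    rewrite mmul_1_l.
  assert (P2 := pf_first _ _ _ H 0%R). unfold B0_mat. rewrite (pf_0 _ _ _ H) in *.
  assert (P0 : Derive v 0 = 0%R) by nra. rewrite P0, RtoC_mult. unfold Mid. rewrite mscal_mat2.
    apply mat2_eq; ring. }
assert (D0 : D 0%R = (4 * b * (b + a * z)) * (4 * b * (b + a * z))).
{ unfold D, B0_mat. rewrite mdet_mat2, (pf_0 _ _ _ H), RtoC_mult. ring. }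
set (s0 := 4 * b * (b + a * z)) in *.
assert (Hs0 : s0 <> 0) by (unfold s0; repeat apply Cmult_neq_0; auto).
assert (Z0e : entry (Z 0%R) 0 0 = s0 /\ entry (Z 0%R) 0 1 = 0 /\ entry (Z 0%R) 1 0 = 0 /\
  entry (Z 0%R) 1 1 = s0).
{ rewrite Z0. change (s0 * 1 = s0 /\ s0 * 0 = 0 /\ s0 * 0 = 0 /\ s0 * 1 = s0). repeat split; ring. }
destruct Z0e as (Z00 & Z01 & Z10 & Z11).
assert (ratio : forall e1 e2 : M2 -> C,
  (forall t, between x t -> cderiv (fun u => e1 (Z u)) t (sg t * e1 (Z t))) ->
  (forall t, between x t -> cderiv (fun u => e2 (Z u)) t (sg t * e2 (Z t))) ->
  forall t, between x t -> e1 (Z t) * e2 (Z t) / D t = e1 (Z 0%R) * e2 (Z 0%R) / (s0 * s0)).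
{ intros e1 e2 H1 H2 t Ht. rewrite <- D0.
  apply (cderiv_zero_const (fun u => e1 (Z u) * e2 (Z u) / D u) 0%R t). intros u Hu.
  assert (Hxu := between_trans x t u Ht Hu).
  exact (cderiv_ratio_const _ _ _ _ (sg u) (H1 u Hxu) (H2 u Hxu) (proj2 (ODE u Hxu)) (Dne u Hxu)). }
assert (Zent : forall t, between x t ->
  entry (Z t) 0 0 * entry (Z t) 0 0 / D t = 1 /\ entry (Z t) 0 1 * entry (Z t) 0 1 / D t = 0 /\
  entry (Z t) 1 0 * entry (Z t) 1 0 / D t = 0 /\ entry (Z t) 0 0 * entry (Z t) 1 1 / D t = 1).
{ intros t Ht.
  assert (d00 := fun u Hu => proj1 (proj1 (ODE u Hu))).
  assert (d01 := fun u Hu => proj1 (proj2 (proj1 (ODE u Hu)))).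
  assert (d10 := fun u Hu => proj1 (proj2 (proj2 (proj1 (ODE u Hu))))).
  assert (d11 := fun u Hu => proj2 (proj2 (proj2 (proj1 (ODE u Hu))))).
  rewrite (ratio (fun M => entry M 0 0) (fun M => entry M 0 0) d00 d00 t Ht).
  rewrite (ratio (fun M => entry M 0 1) (fun M => entry M 0 1) d01 d01 t Ht).
  rewrite (ratio (fun M => entry M 1 0) (fun M => entry M 1 0) d10 d10 t Ht).
  rewrite (ratio (fun M => entry M 0 0) (fun M => entry M 1 1) d00 d11 t Ht).
  rewrite Z00, Z01, Z10, Z11. repeat split; field; exact Hs0. }
assert (Zsq : forall t, between x t -> entry (Z t) 0 0 * entry (Z t) 0 0 = D t).
{ intros t Ht. destruct (Zent t Ht) as (K & _).
  replace (entry (Z t) 0 0 * entry (Z t) 0 0) with (entry (Z t) 0 0 * entry (Z t) 0 0 / D t * D t)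
    by (field; auto).
  rewrite K. ring. }
set (s := fun t => entry (Z t) 0 0).
assert (Hs : s x <> 0). { intros N. apply (Dne x (between_self x)). rewrite <- Zsq
  by apply between_self. fold (s x). rewrite N. ring. }
assert (sq0 : forall c d : C, d <> 0 -> c * c / d = 0 -> c = 0).
{ intros c d Hd K. assert (K' : c * c = 0).
  { transitivity (c * c / d * d); [field; exact Hd|]. rewrite K. ring. }
  destruct (Ceq_dec c 0) as [|N]; [assumption|]. exfalso. exact (Cmult_neq_0 _ _ N N K'). }
assert (Zx : Z x = mscal (s x) Mid).
{ assert (Hx := between_self x). destruct (Zent x Hx) as (_ & K2 & K3 & K4). apply sq0 in K2;
    [|auto]. apply sq0 in K3; [|auto].
  rewrite (M2_eta (Z x)), K2, K3. fold (s x). unfold Mid. rewrite mscal_mat2. apply mat2_eq;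
    try ring.
  rewrite <- (Zsq x Hx) in K4. fold (s x) in K4.
  replace (entry (Z x) 1 1) with (s x * entry (Z x) 1 1 / (s x * s x) * s x) by (field; exact Hs).
    rewrite K4. ring. }
exists s. split; [|split; [exact Hs|]].
- split; [|split].
  + intros t Ht. assert (Cs : continuous (T := R_UniformSpace) (U := C_UniformSpace) s t).
    { apply continuous_C_eps. apply (cderiv_cont s t (entry (mscal (sg t) (Z t)) 0 0)).
        apply (proj1 (ODE t Ht)). }
    apply filterlim_within_ext with s; [reflexivity|]. apply filterlim_filter_le_1 with (2 := Cs).
      apply filter_le_within.
  + intros t Ht. exact (Zsq t Ht).
  + exact Z00.
- unfold B_formula, B1_mat. rewrite mmul_mscal_l, <- fx. fold (E x).
  assert (K : mmul (B0_mat a b v x z) (E x) = mscal (s x) (plus_factor a b v x z)).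
  { transitivity (mmul (plus_factor a b v x z) (Z x)).
    - unfold Z. rewrite <- mmul_assoc, mmul_adj_r, mmul_1_l by now apply mdet_plus_factor.
        reflexivity.
    - rewrite Zx. unfold Mid. generalize (plus_factor a b v x z). intros M. mat_ring. }
  rewrite K. generalize dependent (s x). intros c Hc _ _. generalize (plus_factor a b v x z).
    refine (M2_destruct _ _). intros. mat_norm.
  apply mat2_eq; field; exact Hc.
Qed.

(** * The factorization *)

Definition mx_Ck (n : nat) (G : R -> M2) : Prop :=
  forall i j, (i < 2)%nat -> (j < 2)%nat -> Ck n (fun t => entry (G t) i j).

Lemma mx_Ck_mat2 n p q u w : Ck n p -> Ck n q -> Ck n u -> Ck n w ->
  mx_Ck n (fun t => mat2 (p t) (q t) (u t) (w t)).
Proof. intros Hp Hq Hu Hw i j Hi Hj. destruct i as [|[|i]], j as [|[|j]]; try lia; assumption. Qed.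

Lemma mx_Ck_mmul n G K : mx_Ck n G -> mx_Ck n K -> mx_Ck n (fun t => mmul (G t) (K t)).
Proof.
intros HG HK i j Hi Hj.
apply (Ck_ext n (fun t => entry (G t) i 0 * entry (K t) 0 j + entry (G t) i 1 * entry (K t) 1 j)).
- intros t. symmetry. now apply entry_mmul.
- apply Ck_plus; apply Ck_mult; try (apply HG; lia); apply HK; lia.
Qed.

Lemma mx_Ck_adj n G : mx_Ck n G -> mx_Ck n (fun t => adj (G t)).
Proof.
intros HG. assert (N : forall i j, (i < 2)%nat -> (j < 2)%nat -> Ck n (fun t => - entry (G t) i j)).
{ intros i j Hi Hj. apply (Ck_ext n (fun t => - (1) * entry (G t) i j)); [intros; ring|].
    apply Ck_mult; [apply Ck_const|now apply HG]. }
apply mx_Ck_mat2; try (apply HG; lia); apply N; lia.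
Qed.

Lemma loop_of_mx_Ck r F : (forall z, on_circle r z -> mdet (F z) = 1) ->
  (forall n, mx_Ck n (fun t => F (circle_pt r t))) -> loop r F.
Proof.
intros HF Hk. split; [exact HF|]. intros i j Hi Hj.
  apply (Ck_smooth (fun t => entry (F (circle_pt r t)) i j)). intros n. now apply Hk.
Qed.

Lemma analytic_on_holo (U D : C -> Prop) f : (forall z, D z -> exists l, holo f z l) ->
  (forall z, U z -> D z) -> analytic_on U D f.
Proof.
intros Hf HUD. split; [|auto]. intros z Hz eps. destruct (Hf z Hz) as [l Hl].
destruct (proj1 (locally_C_eps _ _) (holo_cont _ _ _ Hl eps)) as [d Hd]. exists d. auto.
Qed.

Lemma analytic_on_Cpseries U D c f : entire c -> (forall z, U z -> D z) ->
  (forall z, D z -> exists l, holo f z l) ->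
  analytic_on U D (fun z => Cpseries c (f z)).
Proof.
intros Hc HUD Hf. apply analytic_on_holo; [|exact HUD]. intros z Hz. destruct (Hf z Hz) as [l Hl].
  eexists.
apply (holo_comp (Cpseries c)); [now apply holo_Cpseries|exact Hl].
Qed.

Lemma mx_analytic_mat2 U D p q u w : analytic_on U D p -> analytic_on U D q -> analytic_on U D u ->
  analytic_on U D w -> mx_analytic U D (fun z => mat2 (p z) (q z) (u z) (w z)).
Proof. intros Hp Hq Hu Hw i j Hi Hj. destruct i as [|[|i]], j as [|[|j]]; try lia; assumption. Qed.

Lemma mx_analytic_ext U D F G : (forall z, F z = G z) -> mx_analytic U D F -> mx_analytic U D G.
Proof.
intros E H i j Hi Hj. apply (analytic_on_ext U D (fun z => entry (F z) i j));
  [intros z; now rewrite E|now apply H].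
Qed.

Lemma mx_analytic_plus_factor U D a b v x : profile_facts a b v -> a <> 0%R -> b <> 0%R ->
  (forall z, U z -> D z) ->
  mx_analytic U D (fun z => plus_factor a b v x z).
Proof.
intros H Ha Hb HUD. destruct (bounded_cont_alpha_beta a b v H Ha Hb) as (M & Hal & Hbe).
assert (Hid : forall z : C, D z -> exists l, holo (fun w => w) z l)
  by (intros; eexists; apply holo_id).
apply mx_analytic_mmul; [apply mx_analytic_mat2; apply analytic_on_const|].
apply mx_analytic_mat2; [|  |apply analytic_on_mult; [now apply analytic_on_holo|]|];
  unfold iter_series;
 apply (analytic_on_Cpseries U D _ (fun w => w)); auto; apply (entire_iter_int M); auto.
Qed.

Lemma mx_Ck_plus_factor n a b v x r : profile_facts a b v -> a <> 0%R -> b <> 0%R ->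
  mx_Ck n (fun t => plus_factor a b v x (circle_pt r t)).
Proof.
intros H Ha Hb. destruct (bounded_cont_alpha_beta a b v H Ha Hb) as (M & Hal & Hbe).
apply mx_Ck_mmul; [apply mx_Ck_mat2; apply Ck_const|].
apply mx_Ck_mat2; [|  |apply Ck_mult; [apply Ck_circle_pt|]|]; unfold iter_series;
 (apply (Ck_Cpseries n); [apply (entire_iter_int M); auto|apply Ck_circle_pt]).
Qed.

Lemma mx_analytic_Phi_mat (U D : C -> Prop) (a b x y : R) : (forall z, U z -> D z) ->
  (forall z, D z -> z <> 0) -> mx_analytic U D (fun z => Phi_mat a b x y z).
Proof.
intros HUD HD0.
assert (Hp : forall z, D z -> exists l, holo (fun z => a * / z + b) z l).
{ intros z Hz. eexists. apply holo_plus; [apply holo_mult;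
    [apply holo_const|apply holo_inv; auto]|apply holo_const]. }
assert (Hq : forall z, D z -> exists l, holo (fun z => a * z + b) z l).
{ intros z Hz. eexists. apply holo_plus; [apply holo_mult;
    [apply holo_const|apply holo_id]|apply holo_const]. }
assert (Hpq : forall z, D z -> exists l, holo (fun z =>
  (x, y) * (x, y) * ((a * / z + b) * (a * z + b))) z l).
{ intros z Hz. destruct (Hp z Hz), (Hq z Hz). eexists. apply holo_mult;
    [apply holo_const|apply holo_mult; eassumption]. }
apply (mx_analytic_ext U D _ _ (fun z => eq_sym
  (mexp_mscal_antidiag (x, y) (a * / z + b) (a * z + b)))).
assert (Ac := analytic_on_Cpseries U D _ _ entire_cosq HUD Hpq).
  assert (As := analytic_on_Cpseries U D _ _ entire_sinq HUD Hpq).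
apply mx_analytic_mat2; [exact Ac| | |exact Ac]; (apply analytic_on_mult; [|exact As]);
 (apply analytic_on_mult; [apply analytic_on_const|]); now apply analytic_on_holo.
Qed.

Lemma mx_Ck_Phi_mat n a b x y r : (0 < r)%R -> mx_Ck n (fun t => Phi_mat a b x y (circle_pt r t)).
Proof.
intros Hr.
assert (Hp : Ck n (fun t => a * / circle_pt r t + b))
  by (apply Ck_plus; [apply Ck_mult; [apply Ck_const|now apply Ck_inv_circle_pt]|apply Ck_const]).
assert (Hq : Ck n (fun t => a * circle_pt r t + b))
  by (apply Ck_plus; [apply Ck_mult; [apply Ck_const|apply Ck_circle_pt]|apply Ck_const]).
assert (Hpq : Ck n (fun t => (x, y) * (x, y) *
  ((a * / circle_pt r t + b) * (a * circle_pt r t + b))))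
  by (apply Ck_mult; [apply Ck_const|now apply Ck_mult]).
assert (Cc := Ck_Cpseries n _ _ entire_cosq Hpq). assert (Cs := Ck_Cpseries n _ _ entire_sinq Hpq).
assert (K : mx_Ck n (fun t => let p := a * / circle_pt r t + b in let q :=
  a * circle_pt r t + b in let w := (x, y) * (x, y) * (p * q) in
  mat2 (cosq w) ((x, y) * p * sinq w) ((x, y) * q * sinq w) (cosq w))).
{ apply mx_Ck_mat2; [exact Cc| | |exact Cc]; (apply Ck_mult; [|exact Cs]);
    (apply Ck_mult; [apply Ck_const|assumption]). }
intros i j Hi Hj. eapply Ck_ext; [|exact (K i j Hi Hj)].
intros t. unfold Phi_mat, A_mat. now rewrite mexp_mscal_antidiag.
Qed.

Lemma iwasawa_splitting_real_factor_plus_factor a b v x y r : profile_facts a b v -> a <> 0%R ->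
  b <> 0%R -> (0 < r <= 1)%R ->
  iwasawa_splitting r (Phi_mat a b x y) (real_factor a b v x y) (plus_factor a b v x).
Proof.
intros H Ha Hb Hr.
assert (dB : forall z, mdet (plus_factor a b v x z) = 1) by (intros; now apply mdet_plus_factor).
assert (dF : forall z, mdet (real_factor a b v x y z) = 1).
{ intros z. unfold real_factor. rewrite mdet_mmul, mdet_adj, dB. unfold Phi_mat, A_mat.
    rewrite mdet_mexp. ring. }
assert (Hnz : forall z, in_closed_annulus r z -> z <> 0).
{ intros z [Hz _]. apply Cmod_gt_0. lra. }
split; [|split].
- split.
  + apply loop_of_mx_Ck; [auto|]. intros n. apply mx_Ck_mmul;
      [apply mx_Ck_Phi_mat; lra|now apply mx_Ck_adj, mx_Ck_plus_factor].
  + exists (real_factor a b v x y). split; [auto|split].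
    * apply analytic_SL2_mx_analytic. split; [auto|].
      assert (HS : forall z, in_annulus r z -> in_closed_annulus r z)
        by (unfold in_annulus, in_closed_annulus; intros; lra).
      apply mx_analytic_mmul; [now apply mx_analytic_Phi_mat|now apply mx_analytic_adj,
        mx_analytic_plus_factor].
    * intros z Hz. rewrite minv_adj by auto. unfold mstar.
      rewrite <- (mmul_1_l (mconjT _)), <- (mmul_adj_l (real_factor a b v x y z)) by auto.
      rewrite mmul_assoc, real_factor_real, mmul_1_r by auto. reflexivity.
- split.
  + apply loop_of_mx_Ck; [auto|]. intros n. now apply mx_Ck_plus_factor.
  + exists (plus_factor a b v x). split; [auto|split].
    * apply analytic_SL2_mx_analytic. split; [auto|]. apply mx_analytic_plus_factor; auto.
        unfold in_disk, in_closed_disk. intros; lra.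
    * destruct (bounded_cont_alpha_beta a b v H Ha Hb) as (M & Hal & Hbe).
      destruct (sqrt_profile a b v H Hb x) as [Hd _].
      assert (E0 : forall g h, bounded_cont M g -> bounded_cont M h -> iter_series 0 g h x 0 = 1).
      { intros g h Hg Hh. unfold iter_series. rewrite Cpseries_0; [reflexivity|].
          apply (entire_iter_int M); auto. }
      unfold plus_factor, gauge, transfer. rewrite mmul_mat2, !E0 by assumption.
      split; [|split].
      -- change (0 * 1 + RtoC (sqrt (v x / (2 * b))) *
        (0 * iter_series 1 (beta a b v) (alpha b v) x 0) = 0). ring.
      -- change (pos_real (RtoC (/ sqrt (v x / (2 * b))) * 1 + 0 *
        (0 * iter_series 1 (beta a b v) (alpha b v) x 0))).
         replace (RtoC (/ sqrt (v x / (2 * b))) * 1 + 0 *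
           (0 * iter_series 1 (beta a b v) (alpha b v) x 0)) with (RtoC (/ sqrt (v x / (2 * b))))
           by ring.
         split; [reflexivity|]. simpl. now apply Rinv_0_lt_compat.
      -- change (pos_real (0 * iter_series 1 (alpha b v) (beta a b v) x 0 + RtoC
        (sqrt (v x / (2 * b))) * 1)).
         replace (0 * iter_series 1 (alpha b v) (beta a b v) x 0 + RtoC (sqrt (v x / (2 * b))) * 1)
           with (RtoC (sqrt (v x / (2 * b)))) by ring.
         split; [reflexivity|]. exact Hd.
- intros z _. unfold real_factor. rewrite mmul_assoc, mmul_adj_l, mmul_1_r by auto. reflexivity.
Qed.

Theorem theorem8p2 :
  forall (a b : R), a <> 0%R -> b <> 0%R ->
  forall v : R -> R, profile a b v ->
  forall r : R, (0 < r <= 1)%R ->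
  forall x y : R,
  exists F B : C -> M2,
    is_iwasawa r (Phi_mat a b x y) F B /\
    (forall z : C, on_circle r z -> regular_pt a b v x z ->
       exists s : R -> C,
         sqrt_det_branch a b v x z s /\
         F z = F_formula a b v s x y z /\
         B z = B_formula a b v s x z).
Proof.
intros a b Ha Hb v Hv r Hr x y. apply profile_has_facts in Hv as H; auto.
exists (real_factor a b v x y), (plus_factor a b v x). split.
- assert (Hsp := iwasawa_splitting_real_factor_plus_factor a b v x y r H Ha Hb Hr). split;
    [exact Hsp|].
  intros F' B' H'. now apply (iwasawa_unique r (Phi_mat a b x y)).
- intros z Hz Hreg. assert (Hz0 : z <> 0) by (apply Cmod_gt_0; unfold on_circle in Hz; lra).
  destruct (explicit_factor a b v x z H Ha Hb Hz0 Hreg) as (s & Hs & Hsx & EB).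
  exists s. split; [exact Hs|split; [|exact EB]].
  unfold real_factor, F_formula. rewrite EB. unfold B_formula. rewrite adj_mmul, mmul_assoc.
  unfold A_mat at 2. rewrite mexp_opp. change (mat2 0 (a * / z + b) (a * z + b) 0) with
    (A_mat a b z).
  rewrite minv_adj; [reflexivity|].
  unfold B1_mat. destruct Hs as (_ & Hs2 & _). specialize (Hs2 x (between_self x)).
  transitivity (/ s x * / s x * mdet (B0_mat a b v x z)).
  + generalize (B0_mat a b v x z). intros M. mat_ring.
  + rewrite <- Hs2. field. exact Hsx.
Qed.
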